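(* Let $(M,\mathcal F)$ be a locally projectively flat non-Riemannian Finsler surface of constant flag curvature $\lambda\neq 0$. Then the infinitesimal holonomy algebra of $(M,\mathcal F)$ is infinite dimensional: for every point $x\in M$ at which $(M,\mathcal F)$ is non-Riemannian (i.e. $\mathcal F_x^2$ is not a quadratic form on $T_xM$), the infinitesimal holonomy algebra $\mathfrak{hol}^*_x(M)$ at $x$ is an infinite dimensional real vector space.
   Context: $M$ is a $C^\infty$ smooth simply connected manifold; a Finsler surface is a Finsler manifold of dimension $n=2$. Summation over repeated indices is understood. ${\mathfrak X}^\infty(N)$ denotes the smooth vector fields on a manifold $N$. **Finsler manifold.** A Finsler manifold is a pair $(M,\mathcal F)$ where $\mathcal F\colon TM\to\mathbb R$ is a continuous non-negative function, smooth and positive on $TM\setminus\{0\}$, whose restriction $\mathcal F_x=\mathcal F|_{T_xM}$ is positively homogeneous of degree one for every $x$, and such that for every $y\in T_xM\setminus\{0\}$ the symmetric bilinear form with matrix $g_{ij}(x,y)=\frac12\frac{\partial^2\mathcal F^2}{\partial y^i\partial y^j}$ (in induced coordinates $(x^i,y^i)$ on $TM$) is positive definite; $g^{ij}$ is the inverse matrix. $(M,\mathcal F)$ is non-Riemannian if there is a point $x\in M$ such that $\mathcal F_x^2$ is not a quadratic form on $T_xM$. **Connection.** The geodesic coefficients are $G^i=\frac14 g^{il}\big(2\frac{\partial g_{jl}}{\partial x^k}-\frac{\partial g_{jk}}{\partial x^l}\big)y^jy^k$, and $G^i_j=\frac{\partial G^i}{\partial y^j}$, $G^i_{jk}=\frac{\partial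 G^i_j}{\partial y^k}$. Geodesics are the solutions of $\ddot x^i+2G^i(x,\dot x)=0$. The horizontal Berwald covariant derivative of $\xi=\xi^i(x,y)\frac{\partial}{\partial y^i}$ by $X=X^j(x)\frac{\partial}{\partial x^j}$ is $$\nabla_X\xi=\Big(\frac{\partial\xi^i}{\partial x^j}-G^k_j\frac{\partial\xi^i}{\partial y^k}+G^i_{jk}\xi^k\Big)X^j\frac{\partial}{\partial y^i}.$$ **Locally projectively flat.** $(M,\mathcal F)$ is locally projectively flat if every point has a coordinate neighbourhood $(U,x)$, mapping $U$ into $\mathbb R^n$, such that the straight lines of $\mathbb R^n$ correspond to the geodesics of $(M,\mathcal F)$ on $U$. **Curvature.** The Riemannian curvature tensor is $R=R^i_{jk}(x,y)\,dx^j\otimes dx^k\otimes\frac{\partial}{\partial x^i}$ with $R^i_{jk}=\frac{\partial G^i_j}{\partial x^k}-\frac{\partial G^i_k}{\partial x^j}+G^m_jG^i_{km}-G^m_kG^i_{jm}$. $(M,\mathcal F)$ has constant flag curvature $\lambda$ if $R^i_{jk}(x,y)=\lambda\big(\delta^i_k g_{jm}(x,y)y^m-\delta^i_j g_{km}(x,y)y^m\big)$ everywhere. **Infinitesimal holonomy algebra.** The indicatrix at $x$ is $\mathcal I_xM=\{y\in T_xM:\mathcal F(y)=1\}$, and $\mathcal IM\to M$ is the indicatrix bundle. For $X,Y\in{\mathfrak X}^\infty(M)$ the vector field $\xi=R(X,Y)=R^i_{jk}X^jY^k\frac{\partial}{\partial y^i}$, which is tangent to the fibres of $\mathcal IM$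 and is regarded as an element of ${\mathfrak X}^\infty(\mathcal IM)$, is called a curvature vector field. The infinitesimal holonomy algebra $\mathfrak{hol}^*(M)$ is the smallest Lie algebra of (fibre-tangent) vector fields on $\mathcal IM$ such that: (i) every curvature vector field belongs to it; (ii) it is closed under the Lie bracket; (iii) if $\xi\in\mathfrak{hol}^*(M)$ and $X\in{\mathfrak X}^\infty(M)$ then $\nabla_X\xi\in\mathfrak{hol}^*(M)$. The infinitesimal holonomy algebra at $x$ is $\mathfrak{hol}^*_x(M)=\{\xi|_{\mathcal I_xM}:\xi\in\mathfrak{hol}^*(M)\}\subset{\mathfrak X}^\infty(\mathcal I_xM)$. *)

(* Defs.v *)
From HB Require Import structures.
From mathcomp Require Import all_boot all_order all_algebra.
From mathcomp Require Import all_classical all_reals all_analysis.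

Set Implicit Arguments.
Unset Strict Implicit.
Unset Printing Implicit Defensive.

Import Order.TTheory GRing.Theory Num.Theory.
Import numFieldNormedType.Exports.

Local Open Scope classical_set_scope.
Local Open Scope ring_scope.

(* C^oo on an open set [A]: all iterated directional derivatives are
   differentiable at the points of [A]. It is only used with [V] of finite
   dimension, where this is the usual notion. *)
Definition smooth_on (R : realType) (V W : normedModType R) (A : set V)
    (f : V -> W) : Prop :=
  forall (s : seq V) (x : V), A x ->
    differentiable (foldr (fun v h => 'D_v h) f s) x.

(* [q], restricted to the linear subspace [T], is a quadratic form. *)
Definition quadratic_form_on (R : realType) (V : lmodType R) (T : set V)
    (q : V -> R) : Prop :=
  exists B : V -> V -> R,
    [/\ forall v, T v -> q v = B v v,
        forall u v, T u -> T v -> B u v = B v u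
      & forall (a : R) u v w, T u -> T v -> T w ->
          B (a *: u + v) w = a * B u w + B v w].

Definition infinite_dimensional (R : realType) (V : lmodType R)
    (S : set V) : Prop :=
  forall (N : nat) (e : 'I_N -> V),
    ~ S `<=` [set v | exists a : 'I_N -> R, v = \sum_(i < N) a i *: e i].

Definition simply_connected (R : realType) (T : topologicalType) : Prop :=
  (forall p q : T, exists c : R -> T,
     [/\ {within `[0, 1], continuous c}, c 0 = p & c 1 = q]) /\
  (forall c : R -> T, {within `[0, 1], continuous c} -> c 0 = c 1 ->
     exists H : R * R -> T,
       [/\ {within `[0, 1]%classic `*` `[0, 1]%classic, continuous H},
           forall t : R, 0 <= t <= 1 -> H (0, t) = c t,
           forall t : R, 0 <= t <= 1 -> H (1, t) = c 0
         & forall s : R, 0 <= s <= 1 -> H (s, 0) = c 0 /\ H (s, 1) = c 0]).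

(* The values of [chart_map] outside [chart_dom], and those of [chart_inv]
   outside [chart_img], are irrelevant. *)
Record chart (R : realType) (n : nat) (T : topologicalType) := Chart {
  chart_dom : set T;
  chart_map : T -> 'rV[R]_n;
  chart_inv : 'rV[R]_n -> T;
  chart_open_dom : open chart_dom;
  chart_open_img : open (chart_map @` chart_dom);
  chart_mapK : forall p, chart_dom p -> chart_inv (chart_map p) = p;
  chart_map_cont : {within chart_dom, continuous chart_map};
  chart_inv_cont : {within chart_map @` chart_dom, continuous chart_inv} }.

Definition chart_img (R : realType) (n : nat) (T : topologicalType)
    (phi : chart R n T) : set 'rV[R]_n :=
  chart_map phi @` chart_dom phi.

Definition transition (R : realType) (n : nat) (T : topologicalType)
    (phi psi : chart R n T) : 'rV[R]_n -> 'rV[R]_n :=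
  chart_map psi \o chart_inv phi.

Definition smooth_transition (R : realType) (n : nat) (T : topologicalType)
    (phi psi : chart R n T) : Prop :=
  smooth_on (chart_map phi @` (chart_dom phi `&` chart_dom psi))
    (transition phi psi).

Record manifold (R : realType) (n : nat) := Manifold {
  carrier :> topologicalType;
  atlas : set (chart R n carrier);
  manifold_hausdorff : hausdorff_space carrier;
  manifold_second_countable : @second_countable carrier;
  atlas_cover : forall p : carrier, exists2 phi, atlas phi & chart_dom phi p;
  atlas_smooth : forall phi psi, atlas phi -> atlas psi ->
    smooth_transition phi psi;
  atlas_maximal : forall phi,
    (forall psi, atlas psi ->
       smooth_transition phi psi /\ smooth_transition psi phi) ->
    atlas phi }.

Section Tangent.
Context (R : realType) (n : nat) (M : manifold R n).

Definition charts_at (p : M) : set (chart R n M) :=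
  [set phi | atlas phi /\ chart_dom phi p].

(* A tangent vector is the family of its components in all the charts around
   its base point: it lives in the vector space [comps] of all families and
   [tangent p] is the linear subspace T_pM of those which obey the
   transformation law. Components in charts which are not around [p] are
   normalised to 0. *)
Definition comps : Type := chart R n M -> 'rV[R]_n.

HB.instance Definition _ := GRing.Lmodule.on comps.

Definition comps_at (p : M) (f : comps) : comps :=
  patch (fun=> 0) (charts_at p) f.

Definition tangent (p : M) : set comps :=
  [set v | (forall phi, ~ charts_at p phi -> v phi = 0) /\
    forall phi psi, charts_at p phi -> charts_at p psi ->
      v psi = 'd (transition phi psi) (chart_map phi p) (v phi)].

(* The vector of T_pM whose components in the chart [phi] are [y]. *)
Definition vec (phi : chart R n M) (p : M) (y : 'rV[R]_n) : comps :=
  comps_at p (fun psi => 'd (transition phi psi) (chart_map phi p) y).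

(* Functions on TM, vector fields on M and vertical vector fields on TM; only
   the values at the vectors of [tangent p] are meaningful. *)
Definition TM_function : Type := M -> comps -> R.
Definition vector_field : Type := M -> comps.
Definition vertical_field : Type := M -> comps -> comps.

HB.instance Definition _ := GRing.Lmodule.on vertical_field.

(* Expressions in the induced coordinates (x, y) of TM. *)
Definition fun_loc (f : TM_function) (phi : chart R n M)
    (x y : 'rV[R]_n) : R :=
  let p := chart_inv phi x in f p (vec phi p y).
Definition field_loc (X : vector_field) (phi : chart R n M)
    (x : 'rV[R]_n) : 'rV[R]_n :=
  X (chart_inv phi x) phi.
Definition vert_loc (xi : vertical_field) (phi : chart R n M)
    (x y : 'rV[R]_n) : 'rV[R]_n :=
  let p := chart_inv phi x in xi p (vec phi p y) phi.

Definition TM_coords (phi : chart R n M) : set ('rV[R]_n * 'rV[R]_n) :=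
  [set z | chart_img phi z.1].
Definition slit_coords (phi : chart R n M) : set ('rV[R]_n * 'rV[R]_n) :=
  [set z | chart_img phi z.1 /\ z.2 != 0].

Definition smooth_vector_field (X : vector_field) : Prop :=
  (forall p, tangent p (X p)) /\
  (forall phi, atlas phi -> smooth_on (chart_img phi) (field_loc X phi)).

Definition smooth_vertical_field (xi : vertical_field) : Prop :=
  (forall p v, tangent p v -> v != 0 -> tangent p (xi p v)) /\
  (forall phi, atlas phi ->
     smooth_on (slit_coords phi) (fun z => vert_loc xi phi z.1 z.2)).

End Tangent.

Section Coordinates.
Context (R : realType) (n : nat).
Implicit Types (f : 'rV[R]_n -> 'rV[R]_n -> R) (x y : 'rV[R]_n).

Definition dx (j : 'I_n) f x y : R := 'D_(delta_mx 0 j) (f ^~ y) x.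
Definition dy (j : 'I_n) f x y : R := 'D_(delta_mx 0 j) (f x) y.

Section Metric.
Context (F : 'rV[R]_n -> 'rV[R]_n -> R).

Definition metric (i j : 'I_n) x y : R :=
  2^-1 * dy i (dy j (fun x y => F x y ^+ 2)) x y.
Definition metric_inv (i j : 'I_n) x y : R :=
  invmx (\matrix_(k, l) metric k l x y) i j.

Definition geod_coef (i : 'I_n) x y : R :=
  4^-1 * \sum_l \sum_j \sum_k
    metric_inv i l x y *
    (2 * dx k (metric j l) x y - dx l (metric j k) x y) * y 0 j * y 0 k.
Definition geod_coef1 (i j : 'I_n) : 'rV[R]_n -> 'rV[R]_n -> R :=
  dy j (geod_coef i).
Definition geod_coef2 (i j k : 'I_n) : 'rV[R]_n -> 'rV[R]_n -> R :=
  dy k (geod_coef1 i j).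

Definition riem (i j k : 'I_n) x y : R :=
  dx k (geod_coef1 i j) x y - dx j (geod_coef1 i k) x y
  + \sum_m (geod_coef1 m j x y * geod_coef2 i k m x y
            - geod_coef1 m k x y * geod_coef2 i j m x y).

End Metric.
End Coordinates.

Section Finsler.
Context (R : realType) (n : nat) (M : manifold R n) (F : TM_function M).

Record finsler : Prop := Finsler {
  finsler_continuous : forall phi, atlas phi ->
    {within TM_coords phi, continuous (fun z => fun_loc F phi z.1 z.2)};
  finsler_ge0 : forall p v, tangent p v -> 0 <= F p v;
  finsler_smooth : forall phi, atlas phi ->
    smooth_on (slit_coords phi) (fun z => fun_loc F phi z.1 z.2);
  finsler_gt0 : forall p v, tangent p v -> v != 0 -> 0 < F p v;
  finsler_homogeneous : forall p v (c : R), tangent p v -> 0 < c ->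
    F p (c *: v) = c * F p v;
  finsler_convex : forall phi (x y w : 'rV[R]_n), atlas phi -> chart_img phi x ->
    y != 0 -> w != 0 ->
    0 < \sum_i \sum_j metric (fun_loc F phi) i j x y * w 0 i * w 0 j }.

Definition non_riemannian_at (p : M) : Prop :=
  ~ quadratic_form_on (tangent p) (fun v => F p v ^+ 2).
Definition non_riemannian : Prop := exists p, non_riemannian_at p.

(* [c] is the expression in the chart [phi] of a geodesic parametrised by [J];
   constant curves are excluded. *)
Definition geodesic_in (phi : chart R n M) (J : set R)
    (c : R -> 'rV[R]_n) : Prop :=
  forall t, J t ->
    [/\ chart_img phi (c t), derivable c t 1, derivable (derive1 c) t 1,
        derive1 c t != 0
      & forall i, derive1 (derive1 c) t 0 i
          + 2 * geod_coef (fun_loc F phi) i (c t) (derive1 c t) = 0].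

Definition rectifying_chart (phi : chart R n M) : Prop :=
  (forall (J : set R) c, open J -> is_interval J -> geodesic_in phi J c ->
     exists u v : 'rV[R]_n,
       v != 0 /\ forall t, J t -> exists s : R, c t = u + s *: v) /\
  (forall (u v : 'rV[R]_n) (I : set R), v != 0 -> open I -> is_interval I ->
     (forall s, I s -> chart_img phi (u + s *: v)) ->
     exists (J : set R) (s : R -> R),
       [/\ open J, is_interval J, s @` J = I,
           forall t t', J t -> J t' -> t < t' -> s t < s t'
         & geodesic_in phi J (fun t => u + s t *: v)]).

Definition locally_projectively_flat : Prop :=
  forall p : M, exists phi, charts_at p phi /\ rectifying_chart phi.

Definition constant_flag_curvature (lambda : R) : Prop :=
  forall phi (x y : 'rV[R]_n) (i j k : 'I_n), atlas phi -> chart_img phi x -> y != 0 ->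
    let g := metric (fun_loc F phi) in
    riem (fun_loc F phi) i j k x y =
      lambda * ((i == k)%:R * (\sum_m g j m x y * y 0 m)
                - (i == j)%:R * (\sum_m g k m x y * y 0 m)).

Definition indicatrix (p : M) : set (comps M) :=
  [set v | tangent p v /\ F p v = 1].

Definition curvature_field (X Y : vector_field M) : vertical_field M :=
  fun p v => comps_at p (fun phi => \row_i \sum_j \sum_k
    riem (fun_loc F phi) i j k (chart_map phi p) (v phi)
    * X p phi 0 j * Y p phi 0 k).

Definition bracket (xi eta : vertical_field M) : vertical_field M :=
  fun p v => comps_at p (fun phi => \row_i \sum_j
    let x := chart_map phi p in let y := v phi in
    (vert_loc xi phi x y 0 j * dy j (fun x y => vert_loc eta phi x y 0 i) x y
     - vert_loc eta phi x y 0 j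
       * dy j (fun x y => vert_loc xi phi x y 0 i) x y)).

Definition nabla (X : vector_field M) (xi : vertical_field M) :
    vertical_field M :=
  fun p v => comps_at p (fun phi => \row_i \sum_j
    let x := chart_map phi p in let y := v phi in
    let xi_ k := fun x y => vert_loc xi phi x y 0 k in
    let G1 := geod_coef1 (fun_loc F phi) in
    let G2 := geod_coef2 (fun_loc F phi) in
    (dx j (xi_ i) x y
     - \sum_k G1 k j x y * dy k (xi_ i) x y
     + \sum_k G2 i j k x y * xi_ k x y) * X p phi 0 j).

(* A fibre-tangent vector field on the indicatrix bundle is represented by the
   smooth vertical fields on TM \ {0} that extend it, and [hol] contains all
   the extensions of each of its elements ([hol_ext]). The bracket and [nabla]
   do not depend on the extension along the indicatrix bundle: the fields are
   tangent to the indicatrices, and so are the horizontal lifts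
   d/dx^j - G^k_j d/dy^k to the indicatrix bundle. *)
Inductive hol : vertical_field M -> Prop :=
| hol_curvature X Y : smooth_vector_field X -> smooth_vector_field Y ->
    hol (curvature_field X Y)
| hol_linear (a : R) xi eta : hol xi -> hol eta -> hol (a *: xi + eta)
| hol_bracket xi eta : hol xi -> hol eta -> hol (bracket xi eta)
| hol_nabla X xi : smooth_vector_field X -> hol xi -> hol (nabla X xi)
| hol_ext xi eta : hol xi -> smooth_vertical_field eta ->
    (forall p v, indicatrix p v -> eta p v = xi p v) -> hol eta.

Definition hol_at (p : M) : set (comps M -> comps M) :=
  [set patch (fun=> 0) (indicatrix p) (xi p) | xi in hol].

End Finsler.

(* Main.v *)
Require Import Defs.
From HB Require Import structures.
From mathcomp Require Import all_boot all_order all_algebra.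
From mathcomp Require Import all_classical all_reals all_analysis.
From mathcomp Require Import ring lra zify.

Set Implicit Arguments.
Unset Strict Implicit.
Unset Printing Implicit Defensive.

Import Order.TTheory GRing.Theory Num.Theory.
Import numFieldNormedType.Exports.

Local Open Scope classical_set_scope.
Local Open Scope ring_scope.

(** Near a point where the metric is projectively flat, every field of the holonomy
    algebra that is obtained from the curvature by derivation is a function times one
    vertical field [xi]; the algebra at the point is then an algebra of functions
    under a Wronskian bracket, and finite dimension makes it so small that the metric
    is Riemannian at the point.

    In a rectifying chart with fibre coordinates [y], put [E = F^2 / 2] and write
    [E_j], [P_j], [E_jk] for fibre derivatives. Straight lines are geodesics, so the
    geodesic coefficients are radial: [G^i = P y^i] with
    [P = y^k (dE/dx^k) / (4 E)] ([geodesic_defect0], [geod_coefE]). Constant flag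
    curvature becomes [dP/dx^j = P P_j - lambda E_j] ([factor_dbase]), and the
    curvature field of the two coordinate fields is [xi = lambda (- E_2, E_1)]
    ([riem_curv_coef]). For [h] homogeneous of degree zero the horizontal
    derivative of [h xi] is [(dh/dx^j - P h_j + 3 h P_j) xi] ([nabla_curv_coef]).
    Applied to [1] and then to [P_k] it shows that [xi], [P_j xi] and
    [(4 P_j P_k - lambda E_jk) xi] belong to the algebra ([hol_coef_generators]).
    The coordinate fields are first extended to the manifold by a cut-off.

    On the fibre over the given point let [D] be the derivation along [xi], so that
    [[h xi, g xi] = (h Dg - g Dh) xi]. If [h] has order exactly [m >= 3] at a point,
    the bracket of [h xi] with [Dh xi] has order [2 m - 2 > m]; iterating produces
    fields of infinitely many orders, hence an infinite dimensional algebra. Thus in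
    the finite dimensional case a coefficient that vanishes to order three vanishes to
    infinite order ([flat_of_vanish3]). Homogeneity gives [y^j DP_j = 0] and
    [y^k DE_jk = 0]. Normalise the generators above to vanish at a point of the fibre
    and compare Taylor coefficients along [xi] in these relations: the flatness of two
    of the components forces [DP_j = 0] and [DE_jk = 0] at that point
    ([contraction_orders], [tensors_constant]). As [E_jk] is also constant along rays,
    it is constant on the punctured fibre, and [F^2 = E_jk y^j y^k] is a quadratic
    form ([quadratic_of_finite_dimension]). *)

(** * Smooth functions on an open set *)

Section SmoothUpto.
Context (R : realType) (V W : normedModType R) (A : set V).
Implicit Types f g : V -> W.

(** Differentiability of the derivatives of order at most [n]: products and
    composites are smooth by induction on this order. *)
Fixpoint smooth_upto (n : nat) (f : V -> W) : Prop :=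
  (forall x, A x -> differentiable f x) /\
  (if n is n'.+1 then forall v, smooth_upto n' ('D_v f) else True).

Lemma smooth_upto_diff n f x : smooth_upto n f -> A x -> differentiable f x.
Proof. by case: n => [|n] [df _] /df. Qed.

Lemma smooth_uptoW n f : smooth_upto n.+1 f -> smooth_upto n f.
Proof.
elim: n f => [|n IHn] f [df dDf]; first by split.
by split=> // v; apply/IHn/dDf.
Qed.

Lemma smooth_onP f : smooth_on A f <-> forall n, smooth_upto n f.
Proof.
split=> [sf n|sf s].
  elim: n f sf => [|n IHn] f sf; first by split=> // x /(sf [::]).
  split=> [x /(sf [::])//|v]; apply: IHn => s x Ax.
  by have := sf (rcons s v) x Ax; rewrite foldr_rcons.
elim/last_ind: s f sf => [|s v IHs] f sf x Ax.
  exact: smooth_upto_diff (sf 0%N) Ax.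
rewrite foldr_rcons; apply: IHs => // n.
by have [_] := sf n.+1; apply.
Qed.

Lemma smooth_diff f x : smooth_on A f -> A x -> differentiable f x.
Proof. by move=> /(_ [::] x) /[apply]. Qed.

Lemma smooth_derivable f x v : smooth_on A f -> A x -> derivable f x v.
Proof. by move=> sf Ax; apply: diff_derivable; exact: smooth_diff. Qed.

Lemma smooth_is_derive f x v : smooth_on A f -> A x -> is_derive x v f ('D_v f x).
Proof. by move=> sf Ax; apply: derivableP; exact: smooth_derivable. Qed.

Lemma smooth_derive f v : smooth_on A f -> smooth_on A ('D_v f).
Proof.
by move=> sf s x Ax; have := sf (rcons s v) x Ax; rewrite foldr_rcons.
Qed.

Context (oA : open A).

Lemma derive_eq_on f g x v : (forall x, A x -> f x = g x) -> A x ->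
  'D_v f x = 'D_v g x.
Proof.
move=> fg Ax; apply: near_eq_derive.
by near=> y; apply: fg; near: y; exact: open_nbhs_nbhs.
Unshelve. all: by end_near. Qed.

Lemma smooth_upto_ext n f g : (forall x, A x -> f x = g x) ->
  smooth_upto n f -> smooth_upto n g.
Proof.
have dE (f' g' : V -> W) x : (forall x, A x -> f' x = g' x) -> A x ->
    differentiable f' x -> differentiable g' x.
  move=> fg Ax /diff_locallyP[cd f'E].
  suff g'E : g' \o shift x = cst (g' x) + 'd f' x +o_ (0 : V) id.
    apply/diff_locallyP.
    by have -> : 'd g' x = 'd f' x :> (V -> W) by exact: diff_unique.
  apply/eqaddoP => _/posnumP[e].
  move/eqaddoP : f'E => /(_ _ [gt0 of e%:num]).
  have /nbhs0P : nbhs x A by exact: open_nbhs_nbhs.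
  apply: filterS2 => y; rewrite addrC => Ayx.
  by rewrite /= !fctE /= -!fg.
elim: n f g => [|n IHn] f g fg [df Df]; split=> [x Ax|].
- exact: dE fg Ax (df x Ax).
- by [].
- exact: dE fg Ax (df x Ax).
- move=> v; apply: IHn (Df v) => x Ax; exact: derive_eq_on.
Unshelve. all: by end_near. Qed.

Lemma smooth_ext f g : (forall x, A x -> f x = g x) ->
  smooth_on A f -> smooth_on A g.
Proof.
move=> fg /smooth_onP sf; apply/smooth_onP => n.
exact: smooth_upto_ext fg (sf n).
Qed.

End SmoothUpto.

Section DeriveRules.
Context (R : realType) (V W : normedModType R).
Implicit Types (f g : V -> W) (h k : V -> R).

Lemma is_derive_add f g x v df dg : is_derive x v f df -> is_derive x v g dg ->
  is_derive x v (fun x => f x + g x) (df + dg).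
Proof. by move=> ? ?; exact: is_deriveD. Qed.

Lemma is_derive_opp f x v df : is_derive x v f df -> is_derive x v (fun x => - f x) (- df).
Proof. by move=> ?; exact: is_deriveN. Qed.

Lemma is_derive_sub f g x v df dg : is_derive x v f df -> is_derive x v g dg ->
  is_derive x v (fun x => f x - g x) (df - dg).
Proof. by move=> ? ?; exact: is_deriveB. Qed.

Lemma is_derive_scale (a : R) f x v df : is_derive x v f df ->
  is_derive x v (fun x => a *: f x) (a *: df).
Proof. by move=> ?; exact: is_deriveZ. Qed.

Lemma is_derive_const (w : W) x v : is_derive x v (fun _ : V => w) 0.
Proof. exact: is_derive_cst. Qed.

Lemma is_derive_mul h k x v dh dk : is_derive x v h dh -> is_derive x v k dk ->
  is_derive x v (fun x => h x * k x) (dh * k x + h x * dk).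
Proof.
move=> dfh dfk; split; first by apply: (@derivableM _ _ h k).
rewrite (@deriveM _ _ h k)// !derive_val.
by rewrite /GRing.scale /= addrC (mulrC dh).
Qed.

Lemma is_derive_inv h x v dh : h x != 0 -> is_derive x v h dh ->
  is_derive x v (fun x => (h x)^-1) (- (h x) ^- 2 * dh).
Proof.
move=> hx dfh; split; first by apply: derivableV.
by rewrite deriveV// derive_val.
Qed.

Lemma is_derive_pow n h x v dh : is_derive x v h dh ->
  is_derive x v (fun x => h x ^+ n) (n%:R * h x ^+ n.-1 * dh).
Proof.
move=> dfh; rewrite (_ : (fun _ => _) = h ^+ n); first exact: is_deriveX.
by apply/funext => y; rewrite exprfctE.
Qed.

End DeriveRules.

Section SmoothRules.
Context (R : realType) (V : normedModType R) (A : set V) (oA : open A).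

Lemma smooth_cst (W : normedModType R) (w : W) : smooth_on A (fun=> w).
Proof.
apply/smooth_onP => n; elim: n w => [|n IHn] w.
  by split=> // x _; exact: differentiable_cst.
split=> [x _|v]; first exact: differentiable_cst.
by rewrite (_ : 'D_v _ = fun=> 0)//; apply/funext => x; rewrite derive_cst.
Qed.

Lemma smooth_upto_add (W : normedModType R) n (f g : V -> W) :
  smooth_upto A n f -> smooth_upto A n g ->
  smooth_upto A n (fun x => f x + g x).
Proof.
elim: n f g => [|n IHn] f g [df Df] [dg Dg];
  (split=> [x Ax|]; first by apply: differentiableD; [exact: df|exact: dg]) => //.
move=> v.
apply: smooth_upto_ext (IHn _ _ (Df v) (Dg v)) => // x Ax.
have hf : is_derive x v f ('D_v f x) by apply/derivableP/diff_derivable/df.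
have hg : is_derive x v g ('D_v g x) by apply/derivableP/diff_derivable/dg.
by have /@derive_val -> := is_derive_add hf hg.
Qed.

Lemma smooth_add (W : normedModType R) (f g : V -> W) :
  smooth_on A f -> smooth_on A g -> smooth_on A (fun x => f x + g x).
Proof.
by move=> /smooth_onP sf /smooth_onP sg; apply/smooth_onP => n; exact: smooth_upto_add.
Qed.

Lemma smooth_upto_mul n (f g : V -> R) :
  smooth_upto A n f -> smooth_upto A n g ->
  smooth_upto A n (fun x => f x * g x).
Proof.
elim: n f g => [|n IHn] f g sf sg; move: (sf) (sg) => [df Df] [dg Dg];
  (split=> [x Ax|]; first by exact: (@differentiableM _ _ f g _ (df x Ax) (dg x Ax))) => //.
move=> v.
apply: (@smooth_upto_ext _ _ _ _ oA _ (fun x => 'D_v f x * g x + f x * 'D_v g x)).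
  move=> x Ax.
  have hf : is_derive x v f ('D_v f x) by apply/derivableP/diff_derivable/df.
  have hg : is_derive x v g ('D_v g x) by apply/derivableP/diff_derivable/dg.
  by have /@derive_val -> := is_derive_mul hf hg.
apply: smooth_upto_add; apply: IHn; [exact: Df| | |exact: Dg];
  exact: smooth_uptoW.
Qed.

Lemma smooth_mul (f g : V -> R) :
  smooth_on A f -> smooth_on A g -> smooth_on A (fun x => f x * g x).
Proof.
by move=> /smooth_onP sf /smooth_onP sg; apply/smooth_onP => n; exact: smooth_upto_mul.
Qed.

Lemma smooth_scalel (W : normedModType R) (k : V -> R) (w : W) :
  smooth_on A k -> smooth_on A (fun x => k x *: w).
Proof.
move=> /smooth_onP sk; apply/smooth_onP => n; move: (sk n) => {sk}.
elim: n k => [|n IHn] k [dk Dk];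
  (split=> [x Ax|]; first by apply: differentiableZl; exact: dk) => //.
move=> v.
apply: smooth_upto_ext (IHn _ (Dk v)) => // x Ax.
have dkx := dk x Ax.
rewrite [RHS]deriveE; last exact: differentiableZl.
by rewrite diffZl// deriveE.
Qed.

Lemma smooth_upto_sum (W : normedModType R) n m (F : 'I_m -> V -> W) :
  (forall i, smooth_upto A n (F i)) ->
  smooth_upto A n (fun x => \sum_(i < m) F i x).
Proof.
elim: m F => [|m IHm] F sF.
  apply: (@smooth_upto_ext _ _ _ _ oA _ (fun=> 0)).
    by move=> x _; rewrite big_ord0.
  by apply: (smooth_onP _ _).1; exact: smooth_cst.
apply: (@smooth_upto_ext _ _ _ _ oA _
  (fun x => F ord0 x + \sum_(i < m) F (lift ord0 i) x)).
  by move=> x _; rewrite big_ord_recl.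
by apply: smooth_upto_add => //; apply: IHm => i.
Qed.

Lemma smooth_sum (W : normedModType R) m (F : 'I_m -> V -> W) :
  (forall i, smooth_on A (F i)) -> smooth_on A (fun x => \sum_(i < m) F i x).
Proof.
move=> sF; apply/smooth_onP => n; apply: smooth_upto_sum => i.
exact: (smooth_onP _ _).1.
Qed.

Lemma smooth_scale (a : R) (f : V -> R) : smooth_on A f ->
  smooth_on A (fun x => a * f x).
Proof. by move=> sf; apply: smooth_mul => //; exact: smooth_cst. Qed.

Lemma smooth_opp (f : V -> R) : smooth_on A f -> smooth_on A (fun x => - f x).
Proof.
move=> /(smooth_scale (-1)); apply: smooth_ext => // x _.
by rewrite mulN1r.
Qed.

Lemma smooth_sub (f g : V -> R) :
  smooth_on A f -> smooth_on A g -> smooth_on A (fun x => f x - g x).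
Proof. by move=> sf sg; apply: smooth_add => //; exact: smooth_opp. Qed.

Lemma smooth_inv (f : V -> R) : smooth_on A f -> (forall x, A x -> f x != 0) ->
  smooth_on A (fun x => (f x)^-1).
Proof.
move=> /smooth_onP sf f0; apply/smooth_onP => n.
elim: n => [|n IHn]; have [df Df] := sf 1%N.
  by split=> // x Ax; apply: differentiableV; [exact: df|exact: f0].
split=> [x Ax|v]; first by apply: differentiableV; [exact: df|exact: f0].
apply: (@smooth_upto_ext _ _ _ _ oA _
  (fun x => (-1) * ((f x)^-1 * (f x)^-1) * 'D_v f x)).
  move=> x Ax; rewrite deriveV ?f0//; last by apply: diff_derivable; exact: df.
  by rewrite /GRing.scale /= mulN1r -exprVn expr2.
apply: smooth_upto_mul; last by have [_] := sf n.+1; apply.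
apply: smooth_upto_mul; last exact: smooth_upto_mul.
by apply: (smooth_onP _ _).1; exact: smooth_cst.
Qed.

Lemma smooth_linear (W : normedModType R) (f : {linear V -> W}) :
  continuous f -> smooth_on A f.
Proof.
move=> cf; apply/smooth_onP; case=> [|n].
  by split=> // x _; exact: linear_differentiable.
split=> [x _|v]; first exact: linear_differentiable.
apply: (@smooth_upto_ext _ _ _ _ oA _ (fun=> f v)); last first.
  by apply: (smooth_onP _ _).1; exact: smooth_cst.
move=> x _; rewrite deriveE; last exact: linear_differentiable.
by rewrite diff_lin.
Qed.

(** The [l i] are the coordinates with respect to [e]. In them the chain rule writes the
    derivative of the composite as a sum of products with fewer derivatives left. *)
Lemma smooth_comp (W : normedModType R) m (e : 'I_m -> W) (l : 'I_m -> W -> R)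
    (B : set W) (g : V -> W) (f : W -> R) :
  open B -> (forall w, w = \sum_(i < m) l i w *: e i) ->
  (forall i (k : V -> W), smooth_on A k -> smooth_on A (l i \o k)) ->
  smooth_on A g -> smooth_on B f ->
  (forall x, A x -> B (g x)) -> smooth_on A (f \o g).
Proof.
move=> oB lE sl sg sf gAB; apply/smooth_onP => n.
elim: n f sf => [|n IHn] f sf.
  split=> // x Ax; apply: differentiable_comp; first exact: smooth_diff sg Ax.
  by apply: smooth_diff sf _; exact: gAB.
split=> [x Ax|v].
  apply: differentiable_comp; first exact: smooth_diff sg Ax.
  by apply: smooth_diff sf _; exact: gAB.
apply: (@smooth_upto_ext _ _ _ _ oA _
  (fun x => \sum_(i < m) (l i \o 'D_v g) x * ('D_(e i) f \o g) x)).
  move=> x Ax; have dg : differentiable g x by exact: smooth_diff sg Ax.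
  have df : differentiable f (g x) by apply: smooth_diff sf _; exact: gAB.
  rewrite deriveE; last exact: differentiable_comp.
  rewrite diff_comp//=; have <- : 'D_v g x = 'd g x v by rewrite deriveE.
  rewrite [in RHS](lE ('D_v g x)) linear_sum.
  by apply: eq_bigr => i _; rewrite linearZ -deriveE.
apply: smooth_upto_sum => i; apply: smooth_upto_mul.
  by apply: (smooth_onP _ _).1; apply: sl; exact: smooth_derive.
by apply: IHn; exact: smooth_derive.
Qed.

End SmoothRules.

(** * Symmetry of second derivatives, homogeneity *)

Section Line.
Context (R : realType) (V : normedModType R).

Lemma is_derive_line (W : normedModType R) (f : V -> W) x v (t : R) :
  derivable f (x + t *: v) v ->
  is_derive t 1 (fun t => f (x + t *: v)) ('D_v f (x + t *: v)).
Proof.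
have E : (fun h : R => h^-1 *: (((fun t : R => f (x + t *: v)) \o shift t) (h *: 1)
    - f (x + t *: v))) =
  (fun h => h^-1 *: ((f \o shift (x + t *: v)) (h *: v) - f (x + t *: v))).
  by apply/funext => h /=; rewrite [h *: 1]mulr1 scalerDl addrCA.
by move=> df; split; rewrite /derivable /derive E.
Qed.

Lemma derive_line (W : normedModType R) (f : V -> W) x v :
  'D_v f x = 'D_1 (fun t : R => f (x + t *: v)) 0.
Proof.
rewrite /derive; set g1 := fun h => h^-1 *: _; set g2 := fun h => h^-1 *: _.
suff -> : g1 = g2 by []; apply/funext => h; rewrite /g1 /g2 /=.
by rewrite [h *: 1]mulr1 addr0 scale0r addr0 [x + _]addrC.
Qed.

Lemma MVT_line (f : V -> R) x v (s : R) : 0 < s ->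
  (forall t, 0 <= t <= s -> derivable f (x + t *: v) v) ->
  exists2 t, 0 <= t <= s & f (x + s *: v) - f x = 'D_v f (x + t *: v) * s.
Proof.
move=> s0 df; pose k t := f (x + t *: v).
have dk t : 0 <= t <= s -> is_derive t 1 k ('D_v f (x + t *: v)).
  by move=> /df; exact: is_derive_line.
have [t ts kE] : exists2 c, c \in `]0, s[%R &
    k s - k 0 = 'D_v f (x + c *: v) * (s - 0).
  apply: (@MVT _ k (fun t => 'D_v f (x + t *: v))) => //.
    move=> t; rewrite in_itv /= => /andP[t0 ts]; apply: dk.
    by rewrite !ltW.
  apply: derivable_within_continuous => t; rewrite in_itv /= => ts.
  by have /@ex_derive := dk t ts.
exists t; first by move: ts; rewrite in_itv /= => /andP[t0 ts]; rewrite !ltW.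
by move: kE; rewrite /k scale0r addr0 subr0.
Qed.

End Line.

Section Schwarz.
Context (R : realType) (V : normedModType R) (A : set V) (oA : open A).

(** By the mean value theorem applied twice, the second difference of [f] along
    the parallelogram with sides [s u] and [s v] is [s^2] times a value of either
    mixed derivative nearby. *)
Lemma second_difference (f : V -> R) x u v (s : R) : 0 < s -> smooth_on A f ->
  (forall a b : R, 0 <= a <= s -> 0 <= b <= s -> A (x + a *: u + b *: v)) ->
  exists a b : R, [/\ 0 <= a <= s, 0 <= b <= s &
    f (x + s *: u + s *: v) - f (x + s *: u) - (f (x + s *: v) - f x) =
      'D_v ('D_u f) (x + a *: u + b *: v) * s * s].
Proof.
move=> s0 sf inA.
have s00 : 0 <= (0 : R) <= s by rewrite lexx ltW.
have ss : 0 <= s <= s by rewrite lexx ltW.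
pose k y := f (y + s *: v) - f y.
have dk a : 0 <= a <= s -> is_derive (x + a *: u) u k
    ('D_u f (x + a *: u + s *: v) - 'D_u f (x + a *: u)).
  move=> ha; have A1 : A (x + a *: u) by have := inA a 0 ha s00; rewrite scale0r addr0.
  apply: is_derive_sub; last exact: smooth_is_derive sf A1.
  have [d1 d2] : is_derive (x + a *: u + s *: v) u f ('D_u f (x + a *: u + s *: v)).
    exact: smooth_is_derive sf (inA _ _ ha ss).
  have E : (fun h : R => h^-1 *: (((fun y => f (y + s *: v)) \o shift (x + a *: u)) (h *: u)
     - f (x + a *: u + s *: v))) = (fun h => h^-1 *: ((f \o shift (x + a *: u + s *: v)) (h *: u)
     - f (x + a *: u + s *: v))).
    by apply/funext => h /=; rewrite !addrA.
  by split; rewrite ?/derivable ?/derive E.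
have [a ha kE] : exists2 a, 0 <= a <= s & k (x + s *: u) - k x = 'D_u k (x + a *: u) * s.
  by apply: MVT_line => // t /dk /@ex_derive.
have /@derive_val kaE := dk a ha.
have [b hb mE] : exists2 b, 0 <= b <= s &
    'D_u f (x + a *: u + s *: v) - 'D_u f (x + a *: u) =
    'D_v ('D_u f) (x + a *: u + b *: v) * s.
  apply: MVT_line => // t ht; apply: smooth_derivable (inA _ _ ha ht).
  exact: smooth_derive.
exists a, b; split=> //.
by rewrite -mE -kaE -kE /k.
Qed.

(** Divide the two expressions of the second difference by [s^2] and let [s] tend
    to zero. *)
Lemma eq_of_second_difference (f g1 g2 : V -> R) x u v : A x ->
  (forall s : R, 0 < s ->
    (forall a b, 0 <= a <= s -> 0 <= b <= s -> A (x + a *: u + b *: v)) ->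
    exists a b : R, [/\ 0 <= a <= s, 0 <= b <= s &
    f (x + s *: u + s *: v) - f (x + s *: u) - (f (x + s *: v) - f x) =
      g2 (x + a *: u + b *: v) * s * s]) ->
  (forall s : R, 0 < s ->
    (forall a b, 0 <= a <= s -> 0 <= b <= s -> A (x + a *: v + b *: u)) ->
    exists a b : R, [/\ 0 <= a <= s, 0 <= b <= s &
    f (x + s *: v + s *: u) - f (x + s *: v) - (f (x + s *: u) - f x) =
      g1 (x + a *: v + b *: u) * s * s]) ->
  {for x, continuous g1} -> {for x, continuous g2} -> g1 x = g2 x.
Proof.
move=> Ax sd1 sd2 c1 c2.
apply/eqP; rewrite -subr_eq0 -normr_le0; apply/ler_addgt0Pr => e e0.
rewrite add0r; have e20 : 0 < e / 2 by rewrite divr_gt0.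
have nA : nbhs x A by exact: open_nbhs_nbhs.
move/cvgrPdist_lt : c1 => /(_ _ e20) n1; move/cvgrPdist_lt : c2 => /(_ _ e20) n2.
have [d /= d0 dP] := (nbhs_ballP _ _).1 (filterI nA (filterI n1 n2)).
pose N := `|u| + `|v| + 1.
have N0 : 0 < N by rewrite /N ltr_wpDl// addr_ge0.
pose s := d / (2 * N).
have s0 : 0 < s by rewrite divr_gt0// mulr_gt0.
have inP a b : 0 <= a <= s -> 0 <= b <= s ->
  [/\ A (x + a *: u + b *: v),
    `|g1 x - g1 (x + a *: u + b *: v)| < e / 2
    & `|g2 x - g2 (x + a *: u + b *: v)| < e / 2].
  move=> /andP[a0 as_] /andP[b0 bs].
  suff /dP[p1 [p2 p3]] : ball x d (x + a *: u + b *: v) by split.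
  rewrite -ball_normE /= -addrA opprD addrA subrr sub0r.
  rewrite normrN (le_lt_trans (ler_normD _ _))// !normrZ !ger0_norm//.
  apply: (@le_lt_trans _ _ (s * N)).
    rewrite /N !mulrDr mulr1; apply: ler_wpDr; first exact: ltW.
    by apply: lerD; exact: ler_wpM2r.
  by rewrite /s invfM mulrA divfK ?gt_eqF// ltr_pdivrMr// ltr_pMr// ltr1n.
have [||a [b [ha hb E1]]] := sd1 s => //.
  by move=> p q hp hq; have [] := inP p q hp hq.
have [||b' [a' [hb' ha' E2]]] := sd2 s => //.
  by move=> p q hp hq; rewrite addrAC; have [] := inP q p hq hp.
have E : g2 (x + a *: u + b *: v) = g1 (x + a' *: u + b' *: v).
  apply: (mulIf (lt0r_neq0 s0)); apply: (mulIf (lt0r_neq0 s0)).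
  rewrite -E1 [x + a' *: u + _]addrAC -E2 [x + s *: v + _]addrAC.
  by rewrite !opprB addrACA [RHS]addrACA [- _ - _]addrC.
have [_ _ L1] := inP a b ha hb; have [_ L2 _] := inP a' b' ha' hb'.
rewrite E in L1; set D := g1 (_ + _) in L1 L2.
rewrite (_ : _ - _ = (g1 x - D) - (g2 x - D)); last by rewrite opprB addrA subrK.
rewrite (le_trans (ler_normB _ _))// ltW// (lt_le_trans (ltrD L2 L1))//.
by rewrite -splitr.
Qed.

Lemma derive_comm (f : V -> R) x u v : smooth_on A f -> A x ->
  'D_u ('D_v f) x = 'D_v ('D_u f) x.
Proof.
move=> sf Ax; apply: (@eq_of_second_difference f ('D_u ('D_v f)) ('D_v ('D_u f)) x u v Ax).
- by move=> s s0; exact: (@second_difference f x u v s s0 sf).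
- by move=> s s0; exact: (@second_difference f x v u s s0 sf).
- apply: differentiable_continuous; apply: smooth_diff Ax.
  exact: (smooth_derive u (smooth_derive v sf)).
- apply: differentiable_continuous; apply: smooth_diff Ax.
  exact: (smooth_derive v (smooth_derive u sf)).
Qed.

End Schwarz.

(** * Calculus in the coordinates of the tangent bundle of a surface *)

Section Coords.
Context (R : realType).
Local Notation rV := 'rV[R]_2.
Local Notation Z := (rV * rV)%type.
Implicit Types (f g h : Z -> R) (z : Z) (i j k : 'I_2).

Definition base_vec i : Z := (delta_mx 0 i, 0).
Definition fibre_vec i : Z := (0, delta_mx 0 i).
Definition ycoord i : Z -> R := fun z => z.2 0 i.

Definition split_fun (f : rV -> rV -> R) : Z -> R := fun z => f z.1 z.2.

Lemma dxE (f : rV -> rV -> R) j x y : dx j f x y = 'D_(base_vec j) (split_fun f) (x, y).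
Proof.
rewrite /dx /derive; set g1 := fun s => s^-1 *: _; set g2 := fun s => s^-1 *: _.
suff -> : g1 = g2 by []; apply/funext => t; rewrite /g1 /g2 /split_fun /=.
by rewrite scaler0 add0r.
Qed.

Lemma dyE (f : rV -> rV -> R) j x y : dy j f x y = 'D_(fibre_vec j) (split_fun f) (x, y).
Proof.
rewrite /dy /derive; set g1 := fun s => s^-1 *: _; set g2 := fun s => s^-1 *: _.
suff -> : g1 = g2 by []; apply/funext => t; rewrite /g1 /g2 /split_fun /=.
by rewrite scaler0 add0r.
Qed.

Lemma ord2_ind (P : 'I_2 -> Prop) : P 0 -> P 1 -> forall i, P i.
Proof.
move=> P0 P1; case=> -[|[|//]] lti.
  by rewrite (_ : Ordinal lti = 0)//; exact/val_inj.
by rewrite (_ : Ordinal lti = 1)//; exact/val_inj.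
Qed.

Lemma sum2E (W : nmodType) (G : 'I_2 -> W) : \sum_(i < 2) G i = G 0 + G 1.
Proof.
rewrite big_ord_recl big_ord1; congr (_ + G _).
exact/val_inj.
Qed.

Lemma rV2E (y : rV) : y = y 0 0 *: delta_mx 0 0 + y 0 1 *: delta_mx 0 1.
Proof.
by apply/rowP; elim/ord2_ind; rewrite !mxE /= ?mulr1 ?mulr0 ?addr0 ?add0r.
Qed.

Lemma ycoord_linear i : linear (ycoord i).
Proof. by move=> a u v; rewrite /ycoord /= !mxE. Qed.

Lemma ycoord_continuous i : continuous (ycoord i).
Proof.
move=> z; apply: (@continuous_comp _ _ _ snd (fun y : rV => y 0 i)).
  exact: cvg_snd.
exact: coord_continuous.
Qed.

Definition ycoord_lin i : {linear Z -> R} :=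
  HB.pack (ycoord i) (GRing.isLinear.Build _ _ _ _ _ (ycoord_linear i)).

Lemma smooth_ycoord (A : set Z) i : open A -> smooth_on A (ycoord i).
Proof. by move=> oA; apply: (@smooth_linear _ _ _ oA _ (ycoord_lin i)); exact: ycoord_continuous. Qed.

Lemma is_derive_ycoord i z v : is_derive z v (ycoord i) (v.2 0 i).
Proof.
have df : differentiable (ycoord i) z.
  exact: (@linear_differentiable _ _ _ (ycoord_lin i) z (@ycoord_continuous i)).
split; first exact: diff_derivable.
by rewrite deriveE// (@diff_lin _ _ _ (ycoord_lin i) z (@ycoord_continuous i)).
Qed.

Definition base_dir i : 'I_2 + 'I_2 := inl i.
Definition fibre_dir i : 'I_2 + 'I_2 := inr i.

Definition direction (d : 'I_2 + 'I_2) : Z :=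
  match d with inl i => base_vec i | inr i => fibre_vec i end.

(** Opaque, because unification would otherwise unfold the limits that define the
    partial derivatives. *)
Fact pd_sealed : {D : 'I_2 + 'I_2 -> (Z -> R) -> Z -> R |
  forall d f z, D d f z = 'D_(direction d) f z}.
Proof. by exists (fun d f z => 'D_(direction d) f z). Qed.

Definition pd := sval pd_sealed.

Lemma pdE d f z : pd d f z = 'D_(direction d) f z.
Proof. exact: (svalP pd_sealed). Qed.

Lemma smooth_pd (A : set Z) d f : smooth_on A f -> smooth_on A (pd d f).
Proof.
move=> sf; rewrite (_ : pd d f = 'D_(direction d) f); first exact: smooth_derive.
by apply/funext => z; exact: pdE.
Qed.

Section Homogeneous.
Context (A : set Z) (oA : open A).

(** The fibre derivative along the position vector measures homogeneity. *)
Lemma derive_radial f z : smooth_on A f -> A z ->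
  'D_(0, z.2) f z = ycoord 0 z * pd (fibre_dir 0) f z + ycoord 1 z * pd (fibre_dir 1) f z.
Proof.
move=> sf Az; have df := smooth_diff sf Az; rewrite !pdE !deriveE//.
rewrite (_ : (0, z.2) = ycoord 0 z *: fibre_vec 0 + ycoord 1 z *: fibre_vec 1).
  by rewrite linearD !linearZ.
rewrite {1}(rV2E z.2) /ycoord /fibre_vec; apply/pair_equal_spec; split=> //=.
by rewrite !scaler0 addr0.
Qed.

(** Euler's identity, the infinitesimal form of homogeneity of degree [n] in the fibre. *)
Definition euler (n : nat) f := forall z, A z ->
  ycoord 0 z * pd (fibre_dir 0) f z + ycoord 1 z * pd (fibre_dir 1) f z = n%:R * f z.

Lemma homogeneous_euler n f : smooth_on A f ->
  (forall z (c : R), A z -> 0 < c -> f (z.1, c *: z.2) = c ^+ n * f z) ->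
  euler n f.
Proof.
move=> sf hf z Az; rewrite -derive_radial//.
rewrite derive_line.
have E : \forall t \near (0 : R), f (z + t *: (0, z.2)) = (1 + t) ^+ n * f z.
  have : \forall t \near (0 : R), -1 < t by apply: lt_nbhsr; rewrite oppr_lt0.
  apply: filterS => t t1; rewrite -hf//; last by rewrite -ltrBlDl sub0r.
  congr f; case: z {Az} => x y /=; rewrite scalerDl scale1r.
  by apply/pair_equal_spec; split=> //=; rewrite scaler0 addr0.
rewrite (near_eq_derive _ E).
have d1 : is_derive (0 : R) 1 (fun t : R => 1 + t) (0 + 1).
  exact: is_derive_add.
have d2 : is_derive (0 : R) 1 (fun t : R => (1 + t) ^+ n) (n%:R * (1 + 0) ^+ n.-1 * (0 + 1)).
  exact: is_derive_pow.
have /@derive_val -> := is_derive_mul d2 (is_derive_const (f z) (0 : R) 1).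
by rewrite mulr0 !addr0 expr1n add0r !mulr1.
Qed.

Lemma cst_of_derive0 (k : R -> R) (a b : R) : 0 < a -> 0 < b ->
  (forall t : R, 0 < t -> is_derive t 1 k 0) -> k a = k b.
Proof.
wlog ab : a b / a <= b.
  by move=> H a0 b0 dk; case: (leP a b) => [|/ltW] ab; [|apply: esym]; exact: H.
move=> a0 b0 dk.
have [||c _] := @MVT_segment _ k (fun=> 0) a b ab.
- by move=> x; rewrite in_itv /= => /andP[ax _]; apply: dk; exact: lt_trans ax.
- apply: derivable_within_continuous => t; rewrite in_itv /= => /andP[ta _].
  by have /@ex_derive := dk t (lt_le_trans a0 ta).
by rewrite mul0r => /eqP; rewrite subr_eq0 => /eqP.
Qed.

(** The function [t |-> f (x, t y) / t^n] has derivative zero for [t > 0]. *)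
Lemma euler_homogeneous n f : smooth_on A f -> euler n f ->
  (forall z (c : R), A z -> 0 < c -> A (z.1, c *: z.2)) ->
  forall z (c : R), A z -> 0 < c -> f (z.1, c *: z.2) = c ^+ n * f z.
Proof.
move=> sf ef cA z c Az c0.
pose k t := f (z.1, t *: z.2) * (t ^+ n)^-1.
suff : k c = k 1.
  rewrite /k expr1n invr1 mulr1 scale1r -surjective_pairing => <-.
  by rewrite mulrC divfK// expf_neq0// gt_eqF.
apply: cst_of_derive0 => // t t0.
have At : A (z.1, t *: z.2) by exact: cA.
have zE s : (z.1, s *: z.2) = (z.1, 0) + s *: (0, z.2).
  by apply/pair_equal_spec; split; rewrite /= ?scaler0 ?addr0 ?add0r.
have d1 : is_derive t 1 (fun t : R => f (z.1, t *: z.2)) ('D_(0, z.2) f (z.1, t *: z.2)).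
  under eq_fun do rewrite zE.
  rewrite zE; apply: is_derive_line; rewrite -zE.
  exact: smooth_derivable sf At.
have d2 : is_derive t 1 (fun t : R => t ^+ n) (n%:R * t ^+ n.-1 * 1).
  exact: is_derive_pow.
have tn0 : t ^+ n != 0 by rewrite expf_neq0// gt_eqF.
have d3 := is_derive_mul d1 (@is_derive_inv _ _ (fun s : R => s ^+ n) t 1 _ tn0 d2).
rewrite /k; apply: is_derive_eq d3 _.
have := ef _ At; rewrite -derive_radial// => efz.
have -> : 'D_(0, z.2) f (z.1, t *: z.2) = t^-1 * (n%:R * f (z.1, t *: z.2)).
  rewrite -efz !deriveE; [|exact: smooth_diff sf At..].
  rewrite (_ : (0, (z.1, t *: z.2).2) = t *: (0, z.2)).
    by rewrite linearZ /= mulKf// gt_eqF.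
  by apply/pair_equal_spec; split; rewrite /= ?scaler0.
move: (f _) => w; clear -t0 tn0.
case: n tn0 => [|n] tn0 /=; first by rewrite !mul0r !mulr0 mul0r addr0.
move: tn0; rewrite exprS; move: (t ^+ n) => p; rewrite mulf_eq0 negb_or => /andP[tn0 pn0].
by field; apply/andP.
Qed.

End Homogeneous.
End Coords.

Section DRules.
Context (R : realType) (A : set ('rV[R]_2 * 'rV[R]_2)) (oA : open A).
Local Notation Z := ('rV[R]_2 * 'rV[R]_2)%type.
Local Notation ycoord := (@ycoord R).
Implicit Types (f g : Z -> R) (d : 'I_2 + 'I_2).

Lemma pd_is_derive d f z : smooth_on A f -> A z ->
  is_derive z (direction R d) f (pd d f z).
Proof. by move=> sf Az; rewrite pdE; exact: smooth_is_derive sf Az. Qed.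

Lemma pd_eq d f g z : (forall z, A z -> f z = g z) -> A z -> pd d f z = pd d g z.
Proof. by move=> fg Az; rewrite !pdE; exact: (derive_eq_on oA). Qed.

Lemma pd_add d f g z : smooth_on A f -> smooth_on A g -> A z ->
  pd d (fun z => f z + g z) z = pd d f z + pd d g z.
Proof.
move=> sf sg Az; rewrite pdE.
by have /@derive_val := is_derive_add (pd_is_derive d sf Az) (pd_is_derive d sg Az).
Qed.

Lemma pd_sub d f g z : smooth_on A f -> smooth_on A g -> A z ->
  pd d (fun z => f z - g z) z = pd d f z - pd d g z.
Proof.
move=> sf sg Az; rewrite pdE.
by have /@derive_val := is_derive_sub (pd_is_derive d sf Az) (pd_is_derive d sg Az).
Qed.

Lemma pd_mul d f g z : smooth_on A f -> smooth_on A g -> A z ->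
  pd d (fun z => f z * g z) z = pd d f z * g z + f z * pd d g z.
Proof.
move=> sf sg Az; rewrite pdE.
by have /@derive_val := is_derive_mul (pd_is_derive d sf Az) (pd_is_derive d sg Az).
Qed.

Lemma pd_scale d (a : R) f z : smooth_on A f -> A z ->
  pd d (fun z => a * f z) z = a * pd d f z.
Proof.
by move=> sf Az; rewrite pdE; have /@derive_val := is_derive_scale a (pd_is_derive d sf Az).
Qed.

Lemma pd_cst d (a : R) z : pd d (fun=> a) z = 0.
Proof. by rewrite pdE; have /@derive_val := is_derive_const a z (direction R d). Qed.

Lemma pd_comm d d' f z : smooth_on A f -> A z -> pd d (pd d' f) z = pd d' (pd d f) z.
Proof.
move=> sf Az; rewrite !pdE.
rewrite (_ : pd d f = 'D_(direction R d) f); last by apply/funext => w; exact: pdE.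
rewrite (_ : pd d' f = 'D_(direction R d') f); last by apply/funext => w; exact: pdE.
exact: (derive_comm oA).
Qed.

Lemma pd_base_ycoord i j z : pd (base_dir i) (ycoord j) z = 0.
Proof. by rewrite pdE; have /@derive_val -> := is_derive_ycoord j z (base_vec R i); rewrite mxE. Qed.

Lemma pd_fibre_ycoord i j z : pd (fibre_dir i) (ycoord j) z = (i == j)%:R.
Proof.
by rewrite pdE; have /@derive_val -> := is_derive_ycoord j z (fibre_vec R i); rewrite mxE eqxx eq_sym.
Qed.

End DRules.

Ltac smooth :=
  repeat (first [ assumption | apply: smooth_pd | apply: smooth_ycoord
    | apply: smooth_sub | apply: smooth_add
    | apply: smooth_scale | apply: smooth_mul | apply: smooth_opp
    | apply: smooth_cst ]).

Section Euler.
Context (R : realType) (A : set ('rV[R]_2 * 'rV[R]_2)) (oA : open A).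
Local Notation Z := ('rV[R]_2 * 'rV[R]_2)%type.
Local Notation ycoord := (@ycoord R).
Local Notation X i := (pd (base_dir i)).
Local Notation Y i := (pd (fibre_dir i)).
Implicit Types (f g : Z -> R) (n m : nat) (i j k : 'I_2).

(** Base derivatives commute with the fibre derivatives and annihilate [y]. *)
Lemma euler_dbase n f k : smooth_on A f -> euler A n f -> euler A n (X k f).
Proof.
move=> sf ef z Az.
have s0 : smooth_on A (ycoord 0) by smooth.
have s1 : smooth_on A (ycoord 1) by smooth.
have d0 : smooth_on A (Y 0 f) by smooth.
have d1 : smooth_on A (Y 1 f) by smooth.
have := pd_eq oA (base_dir k) ef Az.
rewrite (pd_add _ (smooth_mul oA s0 d0) (smooth_mul oA s1 d1) Az).
rewrite (pd_mul _ s0 d0 Az) (pd_mul _ s1 d1 Az) (pd_scale _ _ sf Az).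
rewrite !pd_base_ycoord (pd_comm oA (base_dir k) (fibre_dir 0) sf Az)
  (pd_comm oA (base_dir k) (fibre_dir 1) sf Az).
by rewrite !mul0r !add0r.
Qed.

(** Differentiating Euler's identity along the fibre lowers the degree by one. In degree
    zero this is still an identity, although [euler_dfibre] has no value [n - 1]. *)
Lemma derive_euler n f k z : smooth_on A f -> euler A n f -> A z ->
  ycoord 0 z * Y 0 (Y k f) z + ycoord 1 z * Y 1 (Y k f) z = (n%:R - 1) * Y k f z.
Proof.
move=> sf ef Az.
have s0 : smooth_on A (ycoord 0) by smooth.
have s1 : smooth_on A (ycoord 1) by smooth.
have d0 : smooth_on A (Y 0 f) by smooth.
have d1 : smooth_on A (Y 1 f) by smooth.
have := pd_eq oA (fibre_dir k) ef Az.
rewrite (pd_add _ (smooth_mul oA s0 d0) (smooth_mul oA s1 d1) Az).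
rewrite (pd_mul _ s0 d0 Az) (pd_mul _ s1 d1 Az) (pd_scale _ _ sf Az).
rewrite !pd_fibre_ycoord (pd_comm oA (fibre_dir k) (fibre_dir 0) sf Az)
  (pd_comm oA (fibre_dir k) (fibre_dir 1) sf Az).
set p := Y 0 (Y k f) z; set q := Y 1 (Y k f) z => E.
have {}E : ycoord 0 z * p + ycoord 1 z * q =
   n%:R * Y k f z - (k == 0)%:R * Y 0 f z - (k == 1)%:R * Y 1 f z.
  by rewrite -E; ring.
rewrite {}E; clear p q.
by elim/ord2_ind: k => /=; ring.
Qed.

Lemma euler_dfibre n f k : smooth_on A f -> euler A n.+1 f -> euler A n (Y k f).
Proof.
by move=> sf ef z Az; rewrite (derive_euler k sf ef Az) -natr1 addrK.
Qed.

Lemma euler_ycoord i : euler A 1 (ycoord i).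
Proof.
move=> z Az; rewrite !pd_fibre_ycoord mul1r.
by elim/ord2_ind: i; rewrite /= ?mulr1 ?mulr0 ?addr0 ?add0r.
Qed.

Lemma euler_cst (a : R) : euler A 0 (fun=> a).
Proof. by move=> z Az; rewrite !pd_cst !mulr0 addr0 mul0r. Qed.

Lemma euler_mul n m f g : smooth_on A f -> smooth_on A g ->
  euler A n f -> euler A m g -> euler A (n + m) (fun z => f z * g z).
Proof.
move=> sf sg ef eg z Az.
rewrite (pd_mul (fibre_dir 0) sf sg Az) (pd_mul (fibre_dir 1) sf sg Az) natrD.
transitivity (n%:R * f z * g z + f z * (m%:R * g z)); last ring.
by rewrite -(ef z Az) -(eg z Az); ring.
Qed.

Lemma euler_add n f g : smooth_on A f -> smooth_on A g ->
  euler A n f -> euler A n g -> euler A n (fun z => f z + g z).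
Proof.
move=> sf sg ef eg z Az.
rewrite (pd_add (fibre_dir 0) sf sg Az) (pd_add (fibre_dir 1) sf sg Az).
by rewrite [RHS]mulrDr -(ef z Az) -(eg z Az); ring.
Qed.

Lemma euler_scale n (a : R) f : smooth_on A f ->
  euler A n f -> euler A n (fun z => a * f z).
Proof.
move=> sf ef z Az.
rewrite (pd_scale (fibre_dir 0) a sf Az) (pd_scale (fibre_dir 1) a sf Az).
by rewrite [RHS]mulrCA -(ef z Az); ring.
Qed.

Lemma euler_sub n f g : smooth_on A f -> smooth_on A g ->
  euler A n f -> euler A n g -> euler A n (fun z => f z - g z).
Proof.
move=> sf sg ef eg z Az.
rewrite (pd_sub (fibre_dir 0) sf sg Az) (pd_sub (fibre_dir 1) sf sg Az).
by rewrite [RHS]mulrBr -(ef z Az) -(eg z Az); ring.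
Qed.

Lemma euler_quotient n m f g : smooth_on A f -> smooth_on A g ->
  (forall z, A z -> g z != 0) -> euler A m g ->
  euler A (n + m) (fun z => f z * g z) -> euler A n f.
Proof.
move=> sf sg g0 eg efg z Az; have := efg z Az.
rewrite (pd_mul (fibre_dir 0) sf sg Az) (pd_mul (fibre_dir 1) sf sg Az) natrD => H.
apply: (mulIf (g0 z Az)).
have -> : n%:R * f z * g z = (n%:R + m%:R) * (f z * g z) - f z * (m%:R * g z) by ring.
by rewrite -H -(eg z Az); ring.
Qed.

End Euler.

(** * The energy and the projective factor of a projectively flat metric *)

Section ProjectiveFactor.
Context (R : realType) (A : set ('rV[R]_2 * 'rV[R]_2)) (oA : open A).
Local Notation Z := ('rV[R]_2 * 'rV[R]_2)%type.
Local Notation y := (@ycoord R).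
Local Notation X i := (pd (base_dir i)).
Local Notation Y i := (pd (fibre_dir i)).
Implicit Types (i j k l : 'I_2) (z : Z).
Context (E : Z -> R) (sE : smooth_on A E) (eE : euler A 2 E).
Context (E0 : forall z, A z -> E z != 0).

Definition base_derivative (z : Z) : R := y 0 z * X 0 E z + y 1 z * X 1 E z.

(** The only possible factor of a radial spray [G^i = P y^i]: the energy is constant along
    geodesics, so [y^k dE/dx^k = 2 P y^k dE/dy^k = 4 P E]. *)
Definition projective_factor (z : Z) : R := base_derivative z * (4 * E z)^-1.

Local Notation N := base_derivative.
Local Notation P := projective_factor.

Lemma smooth_base_derivative : smooth_on A N.
Proof. by rewrite /N; smooth. Qed.

Lemma euler_base_derivative : euler A 3 N.
Proof.
have h i : euler A 3 (fun z => y i z * X i E z).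
  by apply: (@euler_mul _ A 1 2); [smooth|smooth|exact: euler_ycoord|exact: euler_dbase].
by apply: (euler_add _ _ (h 0) (h 1)); smooth.
Qed.

Lemma fourE_neq0 z : A z -> 4 * E z != 0.
Proof. by move=> /E0 Ez; rewrite mulf_neq0// pnatr_eq0. Qed.

Lemma smooth_projective_factor : smooth_on A P.
Proof.
have s4 : smooth_on A (fun z => 4 * E z) by smooth.
by apply: (smooth_mul oA smooth_base_derivative); exact: (smooth_inv oA s4 fourE_neq0).
Qed.

Lemma base_derivativeE z : A z -> N z = P z * (4 * E z).
Proof. by move=> Az; rewrite /P divfK// fourE_neq0. Qed.

Lemma euler_projective_factor : euler A 1 P.
Proof.
have s4 : smooth_on A (fun z => 4 * E z) by smooth.
apply: (@euler_quotient _ A 1 2 _ _ smooth_projective_factor s4 fourE_neq0).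
  exact: euler_scale.
have sm := smooth_mul oA smooth_projective_factor s4.
move=> z Az; rewrite -!(@pd_eq _ A oA _ _ _ z base_derivativeE Az) -base_derivativeE//.
exact: euler_base_derivative.
Qed.

(** The covector [2 g_li (G^i - P y^i)]. *)
Definition geodesic_defect l z : R :=
  y 0 z * X 0 (Y l E) z + y 1 z * X 1 (Y l E) z - X l E z - 2 * P z * Y l E z.

Lemma smooth_defect l : smooth_on A (geodesic_defect l).
Proof. by have sP := smooth_projective_factor; rewrite /geodesic_defect; smooth. Qed.

Lemma euler_defect l : euler A 2 (geodesic_defect l).
Proof.
have sP := smooth_projective_factor; have eP := euler_projective_factor.
have eY : euler A 1 (Y l E) by exact: euler_dfibre.
have h i : euler A 2 (fun z => y i z * X i (Y l E) z).
  by apply: (@euler_mul _ A 1 1); [smooth|smooth|exact: euler_ycoord|apply: euler_dbase => //; smooth].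
have e1 : euler A 2 (fun z => y 0 z * X 0 (Y l E) z + y 1 z * X 1 (Y l E) z).
  by apply: (euler_add _ _ (h 0) (h 1)); smooth.
have e2 : euler A 2 (fun z => y 0 z * X 0 (Y l E) z + y 1 z * X 1 (Y l E) z - X l E z).
  by apply: (euler_sub _ _ e1 (euler_dbase oA l sE eE)); smooth.
apply: (euler_sub _ _ e2); [smooth|smooth|].
apply: (@euler_mul _ A 1 1) => //; [smooth|smooth|exact: euler_scale].
Qed.

Context (defect0 : forall l z, A z -> geodesic_defect l z = 0).

(** Differentiate [y^k dE/dx^k = 4 P E] along the fibre and subtract the vanishing
    geodesic defect. *)
Lemma energy_dx l z : A z -> X l E z = 2 * E z * Y l P z + P z * Y l E z.
Proof.
move=> Az; have sP := smooth_projective_factor.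
have s0 : smooth_on A (y 0) by smooth.
have s1 : smooth_on A (y 1) by smooth.
have d0 : smooth_on A (X 0 E) by smooth.
have d1 : smooth_on A (X 1 E) by smooth.
have s4 : smooth_on A (fun z => 4 * E z) by smooth.
have := pd_eq oA (fibre_dir l) base_derivativeE Az.
rewrite /N (pd_add _ (smooth_mul oA s0 d0) (smooth_mul oA s1 d1) Az).
rewrite (pd_mul _ s0 d0 Az) (pd_mul _ s1 d1 Az) (pd_mul _ sP s4 Az) (pd_scale _ _ sE Az).
rewrite !pd_fibre_ycoord (pd_comm oA (fibre_dir l) (base_dir 0) sE Az)
  (pd_comm oA (fibre_dir l) (base_dir 1) sE Az).
have := defect0 l Az; rewrite /geodesic_defect.
move: (X 0 (Y l E) z) (X 1 (Y l E) z) => a b.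
have -> : X l E z = (l == 0)%:R * X 0 E z + (l == 1)%:R * X 1 E z.
  by elim/ord2_ind: l => /=; ring.
move: (X 0 E z) (X 1 E z) => c d; lra.
Qed.

Context (lambda : R).
Definition curl z : R := X 1 (Y 0 P) z - X 0 (Y 1 P) z.
Definition factor_defect j z : R := P z * Y j P z - X j P z - lambda * Y j E z.

Context (curv0 : forall z, A z -> curl z * y 0 z = factor_defect 1 z).
Context (curv1 : forall z, A z -> curl z * y 1 z = - factor_defect 0 z).

(** The fibre curl of the covector [factor_defect] is [curl] by its definition and
    [-2 curl] by homogeneity. *)
Lemma curl0 z : A z -> curl z = 0.
Proof.
have sP := smooth_projective_factor; have eP := euler_projective_factor.
have sc : smooth_on A curl by rewrite /curl; smooth.
have ec : euler A 0 curl.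
  by apply: (@euler_sub _ A 0); [smooth|smooth|apply: euler_dbase => //; [smooth|exact: euler_dfibre]..].
move=> Az.
have s0 : smooth_on A (y 0) by smooth.
have s1 : smooth_on A (y 1) by smooth.
have sPY j : smooth_on A (fun z => P z * Y j P z) by smooth.
have sXP j : smooth_on A (X j P) by smooth.
have sYP j : smooth_on A (Y j P) by smooth.
have sYE j : smooth_on A (Y j E) by smooth.
have sYE' j : smooth_on A (fun z => lambda * Y j E z) by smooth.
have sF j : smooth_on A (factor_defect j) by rewrite /factor_defect; smooth.
have dF i j : Y i (factor_defect j) z =
    Y i P z * Y j P z + P z * Y i (Y j P) z - Y i (X j P) z - lambda * Y i (Y j E) z.
  rewrite /factor_defect (pd_sub _ (smooth_sub oA (sPY j) (sXP j)) (sYE' j) Az).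
  rewrite (pd_sub _ (sPY j) (sXP j) Az) (pd_mul _ sP (sYP j) Az).
  by rewrite (pd_scale _ _ (sYE j) Az).
have H0 := pd_eq oA (fibre_dir 0) curv0 Az; have H1 := pd_eq oA (fibre_dir 1) curv1 Az.
rewrite (pd_mul _ sc s0 Az) dF in H0.
have sN : pd (fibre_dir 1) (fun z => - factor_defect 0 z) z = - Y 1 (factor_defect 0) z.
  rewrite -mulN1r -(pd_scale _ _ (sF 0) Az); congr pd.
  by apply/funext => w; rewrite mulN1r.
rewrite (pd_mul _ sc s1 Az) sN dF in H1; rewrite !pd_fibre_ycoord /= in H0 H1.
rewrite (pd_comm oA (fibre_dir 0) (base_dir 1) sP Az) (pd_comm oA (fibre_dir 0) (fibre_dir 1) sE Az)
  (pd_comm oA (fibre_dir 0) (fibre_dir 1) sP Az) in H0.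
rewrite (pd_comm oA (fibre_dir 1) (base_dir 0) sP Az) in H1.
have := ec z Az; rewrite mul0r => e.
have : 2 * curl z = - curl z; last lra.
rewrite {2}/curl; lra.
Qed.

Lemma factor_dx j z : A z -> X j P z = P z * Y j P z - lambda * Y j E z.
Proof.
move=> Az; have c0 := curl0 Az.
have : factor_defect j z = 0; last by rewrite /factor_defect => ?; lra.
have := curv0 Az; have := curv1 Az; rewrite c0 !mul0r => h0 h1.
by elim/ord2_ind: j; rewrite -?h1//; apply/eqP; rewrite -oppr_eq0 -h0.
Qed.

(** The components of the curvature field of the two coordinate fields. *)
Definition curv_coef i z : R := if i == 0 then - (lambda * Y 1 E z) else lambda * Y 0 E z.

(** The factor of [curv_coef] in the horizontal derivative of [h * curv_coef] along the
    [j]-th coordinate field. *)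
Definition transport j (h : Z -> R) z : R :=
  X j h z - P z * Y j h z + 3 * h z * Y j P z.

End ProjectiveFactor.

(** * Connection and curvature of a projectively flat metric *)

(** Proves an equation modulo two known ones, from explicit cofactors. *)
Lemma eq_mod2 (R : comNzRingType) (a b l1 r1 l2 r2 c1 c2 : R) : l1 = r1 -> l2 = r2 ->
  a - b = c1 * (l1 - r1) + c2 * (l2 - r2) -> a = b.
Proof. by move=> -> ->; rewrite !subrr !mulr0 addr0 => /subr0_eq. Qed.

Section LocalFinsler.
Context (R : realType) (A : set ('rV[R]_2 * 'rV[R]_2)) (oA : open A).
Local Notation rV := 'rV[R]_2.
Local Notation Z := (rV * rV)%type.
Local Notation y := (@ycoord R).
Local Notation X i := (pd (base_dir i)).
Local Notation Y i := (pd (fibre_dir i)).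
Implicit Types (i j k l : 'I_2) (z : Z).

Lemma dy_pd (f : rV -> rV -> R) j x v : dy j f x v = Y j (split_fun f) (x, v).
Proof. by rewrite dyE pdE. Qed.

Lemma dx_pd (f : rV -> rV -> R) j x v : dx j f x v = X j (split_fun f) (x, v).
Proof. by rewrite dxE pdE. Qed.

Lemma split_dy (f : rV -> rV -> R) j : split_fun (dy j f) = Y j (split_fun f).
Proof. by apply/funext => -[x v]; rewrite /split_fun /= dy_pd. Qed.

Context (F : rV -> rV -> R) (sF : smooth_on A (split_fun F)).
Context (F_gt0 : forall z, A z -> 0 < F z.1 z.2).
Context (F_convex : forall z (w : rV), A z -> w != 0 ->
  0 < \sum_i \sum_j metric F i j z.1 z.2 * w 0 i * w 0 j).

Definition energy z : R := 2^-1 * (split_fun F z * split_fun F z).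
Local Notation E := energy.
Local Notation P := (projective_factor E).

Context (eE : euler A 2 E).

Lemma smooth_energy : smooth_on A E.
Proof. by rewrite /E; smooth. Qed.
Let sE := smooth_energy.

Lemma energy_neq0 z : A z -> E z != 0.
Proof.
by move=> /F_gt0 Fz; rewrite /E mulf_neq0 ?invr_eq0 ?pnatr_eq0// mulf_neq0// gt_eqF.
Qed.

Lemma metricE i j z : A z -> metric F i j z.1 z.2 = Y i (Y j E) z.
Proof.
move=> Az; pose Q z := split_fun F z * split_fun F z.
have sQ : smooth_on A Q by rewrite /Q; smooth.
have sYQ : smooth_on A (Y j Q) by smooth.
have H w : A w -> Y j E w = 2^-1 * Y j Q w by move=> Aw; rewrite (pd_scale _ _ sQ Aw).
rewrite (pd_eq oA (fibre_dir i) H Az) (pd_scale _ _ sYQ Az) /metric dy_pd split_dy.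
by rewrite -surjective_pairing.
Qed.

Lemma dx_metricE k i j z : A z -> dx k (metric F i j) z.1 z.2 = X k (Y i (Y j E)) z.
Proof.
move=> Az; rewrite dx_pd -surjective_pairing; apply: (pd_eq oA) => // w.
exact: metricE.
Qed.

Definition geodesic_source l z : R :=
  2 * (y 0 z * X 0 (Y l E) z + y 1 z * X 1 (Y l E) z) - 2 * X l E z.

Lemma geodesic_sourceE l z : A z ->
  \sum_j \sum_k (2 * dx k (metric F j l) z.1 z.2 - dx l (metric F j k) z.1 z.2)
    * z.2 0 j * z.2 0 k = geodesic_source l z.
Proof.
move=> Az; have sY i : smooth_on A (Y i E) by smooth.
have eY i : euler A 1 (Y i E) by exact: euler_dfibre.
have h k : X k (Y l E) z = y 0 z * X k (Y 0 (Y l E)) z + y 1 z * X k (Y 1 (Y l E)) z.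
  rewrite (pd_comm oA (base_dir k) (fibre_dir 0) (sY l) Az) (pd_comm oA (base_dir k) (fibre_dir 1) (sY l) Az).
  by rewrite (euler_dbase oA k (sY l) (eY l) Az) mul1r.
have h' k : X l (Y k E) z = y 0 z * X l (Y 0 (Y k E)) z + y 1 z * X l (Y 1 (Y k E)) z.
  rewrite (pd_comm oA (base_dir l) (fibre_dir 0) (sY k) Az) (pd_comm oA (base_dir l) (fibre_dir 1) (sY k) Az).
  by rewrite (euler_dbase oA l (sY k) (eY k) Az) mul1r.
have h2 : 2 * X l E z = y 0 z * X l (Y 0 E) z + y 1 z * X l (Y 1 E) z.
  rewrite (pd_comm oA (base_dir l) (fibre_dir 0) sE Az) (pd_comm oA (base_dir l) (fibre_dir 1) sE Az).
  by rewrite (euler_dbase oA l sE eE Az).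
transitivity (\sum_j \sum_k
    (2 * X k (Y j (Y l E)) z - X l (Y j (Y k E)) z) * y j z * y k z).
  apply: eq_bigr => j _; apply: eq_bigr => k _.
  by congr ((2 * _ - _) * _ * _); exact: dx_metricE.
rewrite /geodesic_source h2 (h 0) (h 1) (h' 0) (h' 1) !sum2E.
ring.
Qed.

Lemma det2E (M : 'M[R]_2) : \det M = M 0 0 * M 1 1 - M 0 1 * M 1 0.
Proof.
rewrite (expand_det_row M 0) sum2E /cofactor !det_mx11 !mxE /=.
have -> : lift (0 : 'I_2) (0 : 'I_1) = 1 by exact/val_inj.
have -> : lift (1 : 'I_2) (0 : 'I_1) = 0 by exact/val_inj.
by rewrite modn_small// !add0n expr0 expr1; ring.
Qed.

Definition metric_mx z : 'M[R]_2 := \matrix_(i, j) metric F i j z.1 z.2.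

Lemma metric_mx_unit z : A z -> metric_mx z \in unitmx.
Proof.
move=> Az; rewrite unitmxE unitfE det2E /metric_mx !mxE.
pose g i j := metric F i j z.1 z.2; rewrite -!/(g _ _).
have cvx a b : (a != 0) || (b != 0) ->
    0 < g 0 0 * a * a + g 0 1 * a * b + (g 1 0 * b * a + g 1 1 * b * b).
  move=> ab; have := F_convex (w := \row_j if j == 0 then a else b) Az.
  rewrite !sum2E !mxE /=; apply; apply: contraTneq ab => /rowP ab0.
  by have := ab0 0; have := ab0 1; rewrite !mxE /= => -> ->; rewrite eqxx.
move: (g 0 0) (g 0 1) (g 1 0) (g 1 1) cvx => a b c d cvx.
have a0 : 0 < a by have := cvx 1 0; rewrite oner_eq0 /= => /(_ isT); lra.
(* on [(- b, a)] the form takes the value [a] times the determinant *)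
have := cvx (- b) a; rewrite (gt_eqF a0) orbT => /(_ isT) H.
rewrite gt_eqF// -(pmulr_rgt0 _ a0).
lra.
Qed.

Lemma geodesic_mx z : A z ->
  \col_i geod_coef F i z.1 z.2 =
  4^-1 *: (invmx (metric_mx z) *m \col_l geodesic_source l z).
Proof.
move=> Az; apply/colP => i; rewrite !mxE /geod_coef; congr (_ * _).
apply: eq_bigr => l _; rewrite mxE -geodesic_sourceE// mulr_sumr.
apply: eq_bigr => j _; rewrite mulr_sumr; apply: eq_bigr => k _.
by rewrite !mulrA.
Qed.

Lemma metric_mul_y z : A z -> metric_mx z *m \col_i y i z = \col_i Y i E z.
Proof.
move=> Az; apply/colP => l; rewrite !mxE.
transitivity (\sum_i Y l (Y i E) z * y i z).
  by apply: eq_bigr => i _; rewrite !mxE; congr (_ * _); exact: metricE.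
rewrite sum2E.
rewrite (pd_comm oA (fibre_dir l) (fibre_dir 0) sE Az) (pd_comm oA (fibre_dir l) (fibre_dir 1) sE Az).
rewrite mulrC [T in _ + T]mulrC.
by rewrite (euler_dfibre oA l sE eE Az) mul1r.
Qed.

(** Lowering the index of [G^i = c y^i] gives the vanishing of the defect with [c] in the
    place of [P]; contracting with [y] identifies [c] with [P]. *)
Lemma geodesic_defect0 (c : R) z : A z ->
  (forall i, geod_coef F i z.1 z.2 = c * y i z) ->
  forall l, geodesic_defect E l z = 0.
Proof.
move=> Az Gc.
have S l : geodesic_source l z = 4 * c * Y l E z.
  have := congr1 (fun v => (4 *: (metric_mx z *m v)) l 0) (geodesic_mx Az).
  rewrite -scalemxAr mulmxA mulmxV ?metric_mx_unit// mul1mx scalerA divff ?pnatr_eq0//.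
  rewrite scale1r [RHS]mxE => <-.
  have -> : \col_i geod_coef F i z.1 z.2 = c *: \col_i y i z.
    by apply/colP => i; rewrite !mxE Gc.
  by rewrite -scalemxAr metric_mul_y// !mxE mulrA.
have cP : P z = c.
  have h1 k : y 0 z * X k (Y 0 E) z + y 1 z * X k (Y 1 E) z = 2 * X k E z.
    rewrite (pd_comm oA (base_dir k) (fibre_dir 0) sE Az) (pd_comm oA (base_dir k) (fibre_dir 1) sE Az).
    by rewrite (euler_dbase oA k sE eE Az).
  have h2 : base_derivative E z = c * (4 * E z).
    have := S 0; have := S 1; rewrite /geodesic_source /base_derivative.
    have := eE Az; have := h1 0; have := h1 1.
    move: (X 0 (Y 0 E) z) (X 0 (Y 1 E) z) (X 1 (Y 0 E) z) (X 1 (Y 1 E) z).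
    move: (X 0 E z) (X 1 E z) (Y 0 E z) (Y 1 E z) (y 0 z) (y 1 z) (E z).
    move=> a b p q u v e m n m' n' H1 H2 H3 H4 H5.
    have : 2 * (u * a + v * b) = 2 * (c * (4 * e)); last lra.
    have -> : 2 * (c * (4 * e)) = 4 * c * (2 * e) by ring.
    rewrite -H3.
    have -> : 4 * c * (u * p + v * q) = u * (4 * c * p) + v * (4 * c * q) by ring.
    rewrite -H4 -H5.
    have -> : u * (2 * (u * m + v * m') - 2 * a) + v * (2 * (u * n + v * n') - 2 * b)
      = 2 * (u * (u * m + v * n) + v * (u * m' + v * n')) - 2 * (u * a + v * b) by ring.
    rewrite H1 H2; ring.
  by rewrite /projective_factor h2 mulfK// (fourE_neq0 energy_neq0).
by move=> l; have := S l; rewrite /geodesic_source /geodesic_defect cP; lra.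
Qed.

Context (defect0 : forall l z, A z -> geodesic_defect E l z = 0).

Lemma geod_coefE i z : A z -> geod_coef F i z.1 z.2 = P z * y i z.
Proof.
move=> Az; have := congr1 (fun v : 'cV[R]_2 => v i 0) (geodesic_mx Az); rewrite mxE => ->.
have -> : \col_l geodesic_source l z = 4 * P z *: (metric_mx z *m \col_i y i z).
  rewrite metric_mul_y//; apply/colP => l; rewrite !mxE.
  by have := defect0 l Az; rewrite /geodesic_source /geodesic_defect; lra.
rewrite -scalemxAr mulmxA mulVmx ?metric_mx_unit// mul1mx scalerA mulrA.
by rewrite mulVf ?pnatr_eq0// mul1r !mxE.
Qed.

Let sP : smooth_on A P := smooth_projective_factor oA sE energy_neq0.
Let eP : euler A 1 P := euler_projective_factor oA sE eE energy_neq0.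

Lemma geod_coef1E i j z : A z ->
  geod_coef1 F i j z.1 z.2 = Y j P z * y i z + (j == i)%:R * P z.
Proof.
move=> Az; rewrite /geod_coef1 dy_pd -surjective_pairing.
rewrite (pd_eq oA (fibre_dir j) (fun w Aw => geod_coefE i Aw : split_fun _ w = _) Az).
have si : smooth_on A (y i) by smooth.
by rewrite (pd_mul _ sP si Az) pd_fibre_ycoord; ring.
Qed.

Let sYP j : smooth_on A (Y j P). Proof. by smooth. Qed.
Let sy i : smooth_on A (y i). Proof. by smooth. Qed.
Let s2 i j : smooth_on A (fun z => (j == i)%:R * P z). Proof. by smooth. Qed.

Lemma geod_coef2E i j k z : A z -> geod_coef2 F i j k z.1 z.2 =
  Y k (Y j P) z * y i z + (k == i)%:R * Y j P z + (j == i)%:R * Y k P z.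
Proof.
move=> Az; rewrite /geod_coef2 dy_pd -surjective_pairing.
rewrite (pd_eq oA (fibre_dir k) (fun w Aw => geod_coef1E i j Aw : split_fun _ w = _) Az).
rewrite (pd_add _ (smooth_mul oA (sYP j) (sy i)) (s2 i j) Az).
by rewrite (pd_mul _ (sYP j) (sy i) Az) pd_fibre_ycoord (pd_scale _ _ sP Az) [Y j P z * _]mulrC.
Qed.

Lemma dx_geod_coef1E i j k z : A z -> dx k (geod_coef1 F i j) z.1 z.2 =
  X k (Y j P) z * y i z + (j == i)%:R * X k P z.
Proof.
move=> Az; rewrite dx_pd -surjective_pairing.
rewrite (pd_eq oA (base_dir k) (fun w Aw => geod_coef1E i j Aw : split_fun _ w = _) Az).
rewrite (pd_add _ (smooth_mul oA (sYP j) (sy i)) (s2 i j) Az).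
by rewrite (pd_mul _ (sYP j) (sy i) Az) pd_base_ycoord (pd_scale _ _ sP Az) mulr0 addr0.
Qed.

(** Insert [G^i_j = P_j y^i + delta^i_j P]. Euler's identities for [P] and its fibre
    derivatives cancel the other terms. *)
Lemma riemE i z : A z -> riem F i 0 1 z.1 z.2 =
  curl E z * y i z + (1 == i)%:R * (P z * Y 0 P z - X 0 P z)
  - (0 == i)%:R * (P z * Y 1 P z - X 1 P z).
Proof.
move=> Az; transitivity (
    (X 1 (Y 0 P) z * y i z + (0 == i)%:R * X 1 P z)
  - (X 0 (Y 1 P) z * y i z + (1 == i)%:R * X 0 P z)
  + \sum_m ((Y 0 P z * y m z + (0 == m)%:R * P z) *
     (Y m (Y 1 P) z * y i z + (m == i)%:R * Y 1 P z + (1 == i)%:R * Y m P z)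
    - (Y 1 P z * y m z + (1 == m)%:R * P z) *
     (Y m (Y 0 P) z * y i z + (m == i)%:R * Y 0 P z + (0 == i)%:R * Y m P z))).
  rewrite /riem; congr (_ - _ + _); [exact: dx_geod_coef1E..|].
  by apply: eq_bigr => m _; congr (_ * _ - _ * _);
    [exact: geod_coef1E|exact: geod_coef2E|exact: geod_coef1E|exact: geod_coef2E].
rewrite sum2E.
have e1 := eP Az; have e2 := euler_dfibre oA 0 sP eP Az; have e3 := euler_dfibre oA 1 sP eP Az.
move: e1 e2 e3; rewrite (pd_comm oA (fibre_dir 1) (fibre_dir 0) sP Az) mul1r mul0r.
rewrite /curl.
move: (Y 0 (Y 0 P) z) (Y 0 (Y 1 P) z) (Y 1 (Y 1 P) z) (X 1 (Y 0 P) z) (X 0 (Y 1 P) z).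
move=> p00 p01 p11 c1 c0; move: (X 0 P z) (X 1 P z) (Y 0 P z) (Y 1 P z) (P z).
move=> x0 x1 p0 p1 p e1 e2 e3.
transitivity ((c1 - c0) * y i z
  + (1 == i)%:R * (p * p0 - x0) - (0 == i)%:R * (p * p1 - x1)
  + p0 * y i z * (y 0 z * p01 + y 1 z * p11)
  - p1 * y i z * (y 0 z * p00 + y 1 z * p01)
  + ((1 == i)%:R * p0 - (0 == i)%:R * p1) * (y 0 z * p0 + y 1 z * p1 - p)).
  by elim/ord2_ind: i => /=; ring.
rewrite e1 e2 e3; ring.
Qed.

Context (lambda : R).
Context (F_curvature : forall i j k z, A z ->
  riem F i j k z.1 z.2 = lambda *
    ((i == k)%:R * (\sum_m metric F j m z.1 z.2 * z.2 0 m)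
     - (i == j)%:R * (\sum_m metric F k m z.1 z.2 * z.2 0 m))).

Lemma lower_y j z : A z -> \sum_m metric F j m z.1 z.2 * z.2 0 m = Y j E z.
Proof.
move=> Az; have := congr1 (fun v : 'cV[R]_2 => v j 0) (metric_mul_y Az).
rewrite !mxE => <-; apply: eq_bigr => m _.
by rewrite !mxE.
Qed.

Lemma riem_curv_coef i z : A z -> riem F i 0 1 z.1 z.2 = curv_coef E lambda i z.
Proof.
move=> Az; rewrite F_curvature//.
transitivity (lambda * ((i == 1)%:R * Y 0 E z - (i == 0)%:R * Y 1 E z)).
  by congr (_ * (_ * _ - _ * _)); exact: lower_y.
rewrite /curv_coef.
by elim/ord2_ind: i => /=; ring.
Qed.

Lemma energy_dbase l z : A z -> X l E z = 2 * E z * Y l P z + P z * Y l E z.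
Proof. exact: (energy_dx oA sE energy_neq0 defect0). Qed.

(** The two components of [riemE] = [riem_curv_coef] are what [factor_dx] needs. *)
Lemma factor_dbase j z : A z -> X j P z = P z * Y j P z - lambda * Y j E z.
Proof.
have H i w : A w -> curl E w * y i w + (1 == i)%:R * (P w * Y 0 P w - X 0 P w)
    - (0 == i)%:R * (P w * Y 1 P w - X 1 P w) = curv_coef E lambda i w.
  by move=> Aw; exact: etrans (esym (riemE i Aw)) (riem_curv_coef i Aw).
apply: (factor_dx oA sE eE energy_neq0) => w Aw.
  by have := H 0 w Aw; rewrite /curv_coef /factor_defect /=; lra.
by have := H 1 w Aw; rewrite /curv_coef /factor_defect /=; lra.
Qed.

Lemma smooth_curv_coef i : smooth_on A (curv_coef E lambda i).
Proof. by elim/ord2_ind: i; rewrite /curv_coef /=; smooth. Qed.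

Lemma euler_curv_coef i : euler A 1 (curv_coef E lambda i).
Proof.
have h j : euler A 1 (fun z => lambda * Y j E z).
  by apply: euler_scale; [smooth|exact: euler_dfibre].
elim/ord2_ind: i; rewrite /curv_coef /=; last exact: h.
have := euler_scale (-1) _ (h 1).
under [T in euler _ _ T]eq_fun do rewrite mulN1r.
by apply; smooth.
Qed.

Lemma energy_dbase_dfibre j l z : A z -> X j (Y l E) z =
  2 * (Y l E z * Y j P z + E z * Y l (Y j P) z) + (Y l P z * Y j E z + P z * Y j (Y l E) z).
Proof.
move=> Az; rewrite (pd_comm oA (base_dir j) (fibre_dir l) sE Az).
rewrite (pd_eq oA (fibre_dir l) (fun w Aw => energy_dbase j Aw) Az).
have sYE : smooth_on A (Y j E) by smooth.
have sE2 : smooth_on A (fun z => 2 * E z) by smooth.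
rewrite (pd_add _ (smooth_mul oA sE2 (sYP j)) (smooth_mul oA sP sYE) Az).
rewrite (pd_mul _ sE2 (sYP j) Az) (pd_mul _ sP sYE Az) (pd_scale _ _ sE Az).
by rewrite (pd_comm oA (fibre_dir l) (fibre_dir j) sE Az); ring.
Qed.

Lemma pd_curv_coef0 d z : A z -> pd d (curv_coef E lambda 0) z = - lambda * pd d (Y 1 E) z.
Proof.
move=> Az; have sYE : smooth_on A (Y 1 E) by smooth.
rewrite -(pd_scale _ _ sYE Az); congr (pd d _ z).
by apply/funext => w; rewrite /curv_coef /= mulNr.
Qed.

Lemma pd_curv_coef1 d z : A z -> pd d (curv_coef E lambda 1) z = lambda * pd d (Y 0 E) z.
Proof.
move=> Az; have sYE : smooth_on A (Y 0 E) by smooth.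
by rewrite -(pd_scale _ _ sYE Az); congr (pd d _ z).
Qed.

(** The horizontal derivative of the curvature field without its term
    [- P_j y^k (d xi^i / dy^k)], which equals [- P_j xi^i] by homogeneity and lowers the
    factor from 4 to 3. *)
Lemma transport_curv_coef i j z : A z ->
  X j (curv_coef E lambda i) z - P z * Y j (curv_coef E lambda i) z
  + ((Y 0 (Y j P) z * y i z + (0 == i)%:R * Y j P z + (j == i)%:R * Y 0 P z)
       * curv_coef E lambda 0 z +
     (Y 1 (Y j P) z * y i z + (1 == i)%:R * Y j P z + (j == i)%:R * Y 1 P z)
       * curv_coef E lambda 1 z)
  = 4 * Y j P z * curv_coef E lambda i z.
Proof.
move=> Az; have := euler_dfibre oA j sP eP Az; have := eE Az; rewrite mul0r.
have F0 : X j (curv_coef E lambda 0) z - P z * Y j (curv_coef E lambda 0) z = - lambda *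
    (2 * (Y 1 E z * Y j P z + E z * Y 1 (Y j P) z) + Y 1 P z * Y j E z).
  by rewrite !(pd_curv_coef0 _ Az) energy_dbase_dfibre//; ring.
have F1 : X j (curv_coef E lambda 1) z - P z * Y j (curv_coef E lambda 1) z = lambda *
    (2 * (Y 0 E z * Y j P z + E z * Y 0 (Y j P) z) + Y 0 P z * Y j E z).
  by rewrite !(pd_curv_coef1 _ Az) energy_dbase_dfibre//; ring.
move: F0 F1; elim/ord2_ind: i => F0 F1; rewrite ?F0 ?F1 /curv_coef /= {F0 F1} => e1 e2.
  apply: (eq_mod2 (c1 := lambda * Y 1 (Y j P) z) (c2 := - lambda * Y 1 E z) e1 e2).
  move: (Y 0 (Y j P) z) (Y 1 (Y j P) z) => p0 p1 {e1 e2}.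
  move: (y 0 z) (y 1 z) (E z) => u v e.
  by elim/ord2_ind: j => /=; move: (Y 0 P z) (Y 1 P z) (Y 0 E z) (Y 1 E z) => a b c d; ring.
apply: (eq_mod2 (c1 := - lambda * Y 0 (Y j P) z) (c2 := lambda * Y 0 E z) e1 e2).
move: (Y 0 (Y j P) z) (Y 1 (Y j P) z) => p0 p1 {e1 e2}.
move: (y 0 z) (y 1 z) (E z) => u v e.
by elim/ord2_ind: j => /=; move: (Y 0 P z) (Y 1 P z) (Y 0 E z) (Y 1 E z) => a b c d; ring.
Qed.

(** The field [curv_coef] is multiplied by [3 dP/dy^j] under the horizontal derivative, and
    the term [y^k dh/dy^k] of the Leibniz rule vanishes. *)
Lemma nabla_curv_coef (h : Z -> R) i j z : smooth_on A h -> A z ->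
  euler A 0 h ->
  X j (fun z => h z * curv_coef E lambda i z) z
  - \sum_k geod_coef1 F k j z.1 z.2 * Y k (fun z => h z * curv_coef E lambda i z) z
  + \sum_k geod_coef2 F i j k z.1 z.2 * (h z * curv_coef E lambda k z)
  = transport E j h z * curv_coef E lambda i z.
Proof.
move=> sh Az eh.
have sx k := smooth_curv_coef k.
transitivity (X j (fun z => h z * curv_coef E lambda i z) z
  - \sum_k (Y j P z * y k z + (j == k)%:R * P z) * Y k (fun z => h z * curv_coef E lambda i z) z
  + \sum_k (Y k (Y j P) z * y i z + (k == i)%:R * Y j P z + (j == i)%:R * Y k P z)
     * (h z * curv_coef E lambda k z)).
  congr (_ - _ + _); apply: eq_bigr => k _; congr (_ * _); [exact: geod_coef1E|exact: geod_coef2E].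
rewrite !sum2E (pd_mul (base_dir j) sh (sx i) Az) (pd_mul (fibre_dir 0) sh (sx i) Az)
  (pd_mul (fibre_dir 1) sh (sx i) Az) /transport.
have := transport_curv_coef i j Az; have := euler_curv_coef i Az; have := eh z Az; rewrite mul1r mul0r.
have -> : Y j (curv_coef E lambda i) z =
    (j == 0)%:R * Y 0 (curv_coef E lambda i) z + (j == 1)%:R * Y 1 (curv_coef E lambda i) z.
  by elim/ord2_ind: j => /=; ring.
have -> : Y j h z = (j == 0)%:R * Y 0 h z + (j == 1)%:R * Y 1 h z.
  by elim/ord2_ind: j => /=; ring.
move: (Y 0 (Y j P) z) (Y 1 (Y j P) z) (Y j P z) (X j (curv_coef E lambda i) z) => p0 p1 pj xx.
move: (Y 0 (curv_coef E lambda i) z) (Y 1 (curv_coef E lambda i) z) => x0 x1.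
move: (curv_coef E lambda i z) (curv_coef E lambda 0 z) (curv_coef E lambda 1 z) => w w0 w1.
move: (Y 0 h z) (Y 1 h z) (X j h z) (h z) => h0 h1 hx h'.
move: (Y 0 P z) (Y 1 P z) (P z) (y 0 z) (y 1 z) (y i z) => a b p u v yi e0 e1 e2.
apply/eqP; rewrite -subr_eq0; apply/eqP.
transitivity (h' * (xx - p * ((j == 0)%:R * x0 + (j == 1)%:R * x1) +
     ((p0 * yi + (0 == i)%:R * pj + (j == i)%:R * a) * w0 +
      (p1 * yi + (1 == i)%:R * pj + (j == i)%:R * b) * w1) - 4 * pj * w)
  - pj * w * (u * h0 + v * h1) - pj * h' * (u * x0 + v * x1 - w)); first ring.
rewrite e0 e1 e2; ring.
Qed.

End LocalFinsler.

(** * Vanishing orders along a vertical field *)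

Section FibreDerivation.
Context (R : realType) (A : set ('rV[R]_2 * 'rV[R]_2)) (oA : open A).
Local Notation Z := ('rV[R]_2 * 'rV[R]_2)%type.
Local Notation Y i := (pd (fibre_dir i)).
Context (x0 : 'rV[R]_2).
Implicit Types (f g : Z -> R) (z : Z) (j k : nat).

Definition fibre : set Z := [set z | A z /\ z.1 = x0].

(** A fibre derivative is a limit along the fibre. *)
Lemma pd_fibre_eq (d : 'I_2) f g z : (forall z, fibre z -> f z = g z) -> fibre z ->
  Y d f z = Y d g z.
Proof.
move=> fg [Az zx]; rewrite !pdE [LHS]derive_line [RHS]derive_line; apply: near_eq_derive.
have cl : {for (0 : R), continuous (fun t : R => z + t *: direction R (fibre_dir d))}.
  by apply: continuousD; [exact: cst_continuous|exact: scalel_continuous].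
have nA : nbhs (z + 0 *: direction R (fibre_dir d)) A.
  by rewrite scale0r addr0; exact: open_nbhs_nbhs.
have : nbhs (0 : R) (fun t => A (z + t *: direction R (fibre_dir d))) := cl _ nA.
apply: filterS => t At; apply: fg; split=> //=.
by rewrite scaler0 addr0.
Qed.

Context (v : 'I_2 -> Z -> R) (sv : forall i : 'I_2, smooth_on A (v i)).

Definition vder f z : R := v 0 z * Y 0 f z + v 1 z * Y 1 f z.
Local Notation D := vder.

Lemma smooth_vder f : smooth_on A f -> smooth_on A (D f).
Proof. by move=> sf; have := sv 0; have := sv 1; rewrite /vder => ? ?; smooth. Qed.

Lemma vder_eq f g z : (forall z, fibre z -> f z = g z) -> fibre z -> D f z = D g z.
Proof. by move=> fg Fz; rewrite /vder (pd_fibre_eq 0 fg Fz) (pd_fibre_eq 1 fg Fz). Qed.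

Lemma vder_add f g z : smooth_on A f -> smooth_on A g -> A z ->
  D (fun z => f z + g z) z = D f z + D g z.
Proof.
by move=> sf sg Az; rewrite /vder (pd_add _ sf sg Az) (pd_add _ sf sg Az); ring.
Qed.

Lemma vder_mul f g z : smooth_on A f -> smooth_on A g -> A z ->
  D (fun z => f z * g z) z = D f z * g z + f z * D g z.
Proof.
by move=> sf sg Az; rewrite /vder (pd_mul _ sf sg Az) (pd_mul _ sf sg Az); ring.
Qed.

Lemma vder_scale (a : R) f z : smooth_on A f -> A z ->
  D (fun z => a * f z) z = a * D f z.
Proof.
by move=> sf Az; rewrite /vder (pd_scale _ _ sf Az) (pd_scale _ _ sf Az); ring.
Qed.

Lemma vder_cst (a : R) z : D (fun=> a) z = 0.
Proof. by rewrite /vder !pd_cst !mulr0 addr0. Qed.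

Context (z0 : Z) (Fz0 : fibre z0).
Let Az0 : A z0 := Fz0.1.

(** Taylor coefficient of [f] at [z0] along the flow of the field. *)
Definition taylor k f : R := iter k D f z0 / k`!%:R.
Local Notation tc := taylor.
Definition vanish k f : Prop := forall i, (i < k)%N -> tc i f = 0.

Lemma taylor0 f : tc 0 f = f z0. Proof. by rewrite /tc /= divr1. Qed.

Lemma taylor_vder k f : tc k (D f) = k.+1%:R * tc k.+1 f.
Proof.
by rewrite /tc -iterSr factS natrM invfM mulrCA mulVKf// pnatr_eq0.
Qed.

Lemma iter_vder_eq k f g z : (forall z, fibre z -> f z = g z) -> fibre z ->
  iter k D f z = iter k D g z.
Proof.
by elim: k z => [|k IHk] z fg Fz; [exact: fg|apply: vder_eq => // w; exact: IHk].
Qed.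

Lemma taylor_eq k f g : (forall z, fibre z -> f z = g z) -> tc k f = tc k g.
Proof. by move=> fg; rewrite /tc (iter_vder_eq k fg Fz0). Qed.

Lemma smooth_iter_vder k f : smooth_on A f -> smooth_on A (iter k D f).
Proof. by elim: k => //= k IHk /IHk; exact: smooth_vder. Qed.

Lemma taylor_add k f g : smooth_on A f -> smooth_on A g ->
  tc k (fun z => f z + g z) = tc k f + tc k g.
Proof.
move=> sf sg; rewrite /tc -mulrDl; congr (_ / _).
suff H z : fibre z -> iter k D (fun z => f z + g z) z = iter k D f z + iter k D g z.
  exact: H.
elim: k z => [//|k IHk] z Fz.
rewrite [LHS](vder_eq IHk Fz) (vder_add _ _ Fz.1)//; exact: smooth_iter_vder.
Qed.

Lemma taylor_scale k (a : R) f : smooth_on A f -> tc k (fun z => a * f z) = a * tc k f.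
Proof.
move=> sf; rewrite /tc mulrA; congr (_ / _).
suff H z : fibre z -> iter k D (fun z => a * f z) z = a * iter k D f z.
  exact: H.
elim: k z => [//|k IHk] z Fz.
rewrite [LHS](vder_eq IHk Fz) (vder_scale _ _ Fz.1)//; exact: smooth_iter_vder.
Qed.

Lemma taylor_zero k f : (forall z, fibre z -> f z = 0) -> tc k f = 0.
Proof.
move=> f0; transitivity (tc k (fun _ => 0 * 0)).
  by apply: taylor_eq => z /f0 ->; rewrite mulr0.
by rewrite taylor_scale ?mul0r//; exact: smooth_cst.
Qed.

Lemma taylor_sub k f g : smooth_on A f -> smooth_on A g ->
  tc k (fun z => f z - g z) = tc k f - tc k g.
Proof.
move=> sf sg; transitivity (tc k (fun z => f z + (-1) * g z)).
  by apply: taylor_eq => z _; rewrite mulN1r.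
by rewrite taylor_add ?taylor_scale ?mulN1r//; smooth.
Qed.

Lemma taylor_sum k n (c : 'I_n -> R) (f : 'I_n -> Z -> R) :
  (forall i, smooth_on A (f i)) ->
  tc k (fun z => \sum_i c i * f i z) = \sum_i c i * tc k (f i).
Proof.
elim: n c f => [|n IHn] c f sf.
  by rewrite big_ord0 taylor_zero// => z _; rewrite big_ord0.
transitivity (tc k (fun z => c ord0 * f ord0 z +
    \sum_(i < n) c (lift ord0 i) * f (lift ord0 i) z)).
  by apply: taylor_eq => z _; rewrite big_ord_recl.
rewrite taylor_add ?taylor_scale//; first last.
- by apply: smooth_sum => // i; have := sf (lift ord0 i); smooth.
- by have := sf ord0; smooth.
by rewrite IHn ?big_ord_recl// => i; exact: sf.
Qed.

Lemma vanishW j k f : (j <= k)%N -> vanish k f -> vanish j f.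
Proof. by move=> jk kf i ij; apply: kf; exact: leq_trans jk. Qed.

Lemma vanish_vder k f : vanish k.+1 f -> vanish k (D f).
Proof. by move=> kf i ik; rewrite taylor_vder kf ?mulr0. Qed.

Lemma vanish_antider k f : f z0 = 0 -> vanish k (D f) -> vanish k.+1 f.
Proof.
move=> f0 kf [|i] ik; first by rewrite taylor0.
by have /eqP := kf i ik; rewrite taylor_vder mulf_eq0 pnatr_eq0 /= => /eqP.
Qed.

(** Leading coefficients multiply: by Leibniz' rule [(a + b) T_(a+b)(f g)] is the sum of
    [a T_a(f) T_b(g)] and [b T_a(f) T_b(g)], by induction on the total order. *)
Lemma taylor_mul a b f g : smooth_on A f -> smooth_on A g ->
  vanish a f -> vanish b g -> tc (a + b) (fun z => f z * g z) = tc a f * tc b g.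
Proof.
move en : (a + b)%N => n; elim: n => [|n IHn] in a b f g en *.
  by move: en; case: a => //; case: b => // _ _ _ _ _; rewrite !taylor0.
move=> sf sg af bg; have sDf := smooth_vder sf; have sDg := smooth_vder sg.
apply: (@mulfI _ n.+1%:R); first by rewrite pnatr_eq0.
rewrite -taylor_vder.
transitivity (tc n (fun z => D f z * g z + f z * D g z)).
  by apply: taylor_eq => z Fz; exact: (vder_mul sf sg Fz.1).
have E1 : tc n (fun z => D f z * g z) = a%:R * (tc a f * tc b g).
  case: a en af => [|a] en af.
    move: en; rewrite add0n => en; rewrite (IHn 0%N n)// ?mul0r.
      by rewrite bg ?mulr0// en.
    by apply: vanishW bg; rewrite en.
  move: en; rewrite addSn => -[en].
  by rewrite (IHn a b)// ?taylor_vder ?mulrA//; exact: vanish_vder.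
have E2 : tc n (fun z => f z * D g z) = b%:R * (tc a f * tc b g).
  case: b en bg {E1} => [|b] en bg.
    move: en; rewrite addn0 => en; rewrite (IHn n 0%N)// ?mul0r ?addn0//.
      by rewrite af ?mul0r// en.
    by apply: vanishW af; rewrite en.
  move: en; rewrite addnS => -[en].
  rewrite (IHn a b)// ?taylor_vder; [by rewrite mulrCA|exact: vanish_vder].
rewrite taylor_add ?E1 ?E2; [|smooth|smooth].
by rewrite -mulrDl -natrD en.
Qed.

Lemma vanish_mul a b f g : smooth_on A f -> smooth_on A g ->
  vanish a f -> vanish b g -> vanish (a + b) (fun z => f z * g z).
Proof.
move=> sf sg af bg k kab; case: (ltnP k a) => ka.
  rewrite -[k]addn0 (taylor_mul sf sg)//; last exact: vanishW (ltnW ka) af.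
  by rewrite af ?mul0r.
have kb : (k - a < b)%N by rewrite ltn_subLR.
rewrite -(subnKC ka) (taylor_mul sf sg)//; last exact: vanishW (ltnW kb) bg.
by rewrite (bg _ kb) mulr0.
Qed.

Lemma vanish_div k f g : smooth_on A f -> smooth_on A g -> f z0 != 0 ->
  vanish k (fun z => f z * g z) -> vanish k g.
Proof.
move=> sf sg f0; elim: k => [//|k IHk] fg.
have kg : vanish k g by apply: IHk; exact: vanishW fg.
move=> i; rewrite ltnS leq_eqVlt => /orP[/eqP ->|/kg//].
have := fg k (leqnn _); rewrite -{1}[k]add0n (taylor_mul sf sg)//.
by rewrite taylor0 => /eqP; rewrite mulf_eq0 (negbTE f0) => /eqP.
Qed.

(** The coefficient of the bracket of [f] and [g] times the field [v]. *)
Definition wronskian f g z : R := f z * D g z - g z * D f z.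

(** Both [f D^2 f] and [(D f)^2] have order [2 m - 2], with leading coefficients
    [m (m - 1) T^2] and [m^2 T^2] for the leading coefficient [T] of [f]. *)
Lemma wronskian_vder m f : (1 < m)%N -> smooth_on A f -> vanish m f ->
  vanish (m + m - 2) (wronskian f (D f)) /\
  tc (m + m - 2) (wronskian f (D f)) = - m%:R * tc m f ^+ 2.
Proof.
case: m => [//|[//|m]] _ sf mf.
have sDf := smooth_vder sf; have sDDf := smooth_vder sDf.
have v1 := vanish_vder mf; have v2 := vanish_vder v1.
have s1 : smooth_on A (fun z => f z * D (D f) z) by smooth.
have s2 : smooth_on A (fun z => D f z * D f z) by smooth.
have -> : (m.+2 + m.+2 - 2)%N = (m.+2 + m)%N by lia.
have e1 : (m.+2 + m)%N = (m.+1 + m.+1)%N by lia.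
split.
  move=> i im; rewrite /wronskian taylor_sub//.
  rewrite (vanish_mul sf sDDf mf v2 im) (vanish_mul sDf sDf v1 v1) ?subr0//.
  by rewrite -e1.
rewrite /wronskian taylor_sub// (taylor_mul sf sDDf)// e1 (taylor_mul sDf sDf)//.
rewrite !taylor_vder -!natr1; ring.
Qed.

End FibreDerivation.

(** * Finite-dimensional Lie algebras of fields on a fibre *)

Section LieOrders.
Context (R : realType) (A : set ('rV[R]_2 * 'rV[R]_2)) (oA : open A).
Local Notation Z := ('rV[R]_2 * 'rV[R]_2)%type.
Local Notation y := (@ycoord R).
Context (x0 : 'rV[R]_2) (v : 'I_2 -> Z -> R) (sv : forall i, smooth_on A (v i)).
Local Notation fibre := (fibre A x0).
Local Notation D := (vder v).
Local Notation W := (wronskian v).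
(* [FF] is the set of coefficients of a Lie algebra of multiples of [v] that contains [v];
   [FF_dependent] bounds its dimension by [N]. *)
Context (FF : (Z -> R) -> Prop).
Context (FF_smooth : forall f, FF f -> smooth_on A f).
Context (FF_vder : forall f, FF f -> FF (D f)).
Context (FF_wronskian : forall f g, FF f -> FF g -> FF (W f g)).
Context (N : nat) (FF_dependent : forall f : 'I_N.+1 -> Z -> R, (forall i, FF (f i)) ->
  exists c : 'I_N.+1 -> R, (exists i, c i != 0) /\
    forall z, fibre z -> \sum_i c i * f i z = 0).

(** Lie's argument: if the vanishing order of a function were finite and at least
    three, iterated brackets with its derivative would have ever larger orders, and
    functions of distinct orders are linearly independent. *)
Lemma flat_of_vanish3 z0 f : fibre z0 -> FF f -> vanish v z0 3 f ->
  forall k, taylor v z0 k f = 0.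
Proof.
move=> Fz0 Ff f3 k; apply/eqP/negPn/negP => fk.
have [m fm mmin] := @ex_minnP (fun k => taylor v z0 k f != 0) (ex_intro _ k fk).
have vm : vanish v z0 m f.
  by move=> i im; apply/eqP/negPn/negP => /mmin; rewrite leqNgt im.
have m3 : (2 < m)%N by rewrite ltnNge; apply/negP => m2; move: fm; rewrite f3 ?eqxx.
pose g n := iter n (fun h => W h (D h)) f.
pose M n := iter n (fun n => (n + n - 2)%N) m.
have gP n : [/\ FF (g n), (2 < M n)%N, vanish v z0 (M n) (g n)
    & taylor v z0 (M n) (g n) != 0].
  elim: n => [//|n [Fg M3 vg tg]] /=.
  have sg := FF_smooth Fg.
  have [|vW tW] := wronskian_vder oA sv Fz0 _ sg vg; first exact: ltnW.
  split; [by apply: FF_wronskian => //; exact: FF_vder|by rewrite /= -/(M n); lia|by []|].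
  rewrite tW mulf_neq0// ?oppr_eq0 ?pnatr_eq0 ?expf_neq0//.
  by rewrite -lt0n; apply: ltn_trans M3.
have Mlt n p : (n < p)%N -> (M n < M p)%N.
  elim: p => [//|p IHp]; rewrite ltnS leq_eqVlt => np.
  have Mp : (M p < M p.+1)%N by rewrite /= -/(M p); have [_ + _ _] := gP p; lia.
  by case/orP: np => [/eqP ->//|/IHp/ltn_trans]; apply.
have [|c [[i0 ci0] cg]] := FF_dependent (f := fun i => g i); first by move=> i; have [] := gP i.
have [i ci imin] : exists2 i, c i != 0 & forall j : 'I_N.+1, (j < i)%N -> c j = 0.
  case: (@arg_minnP _ i0 (fun i => c i != 0) (fun i => i : nat) ci0) => i ci imin.
  exists i => // j ji; apply/eqP/negPn/negP => /imin.
  by rewrite leqNgt ji.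
have [_ _ _ /negP[]] := gP i.
have sg (j : 'I_N.+1) : smooth_on A (g j) by apply: FF_smooth; have [] := gP j.
have : taylor v z0 (M i) (fun z => \sum_j c j * g j z) = 0.
  exact: (taylor_zero oA sv Fz0).
rewrite (taylor_sum oA sv Fz0)// (bigD1 i)//= big1 ?addr0.
  by move/eqP; rewrite mulf_eq0 (negbTE ci).
move=> j ji; case: (ltngtP j i) => ji'; first by rewrite imin ?mul0r.
  by have [_ _ + _] := gP j; move=> -> //; rewrite ?mulr0//; exact: Mlt.
by move: ji; rewrite -val_eqE /= ji' eqxx.
Qed.

Context (z0 : Z).
Local Notation T := (taylor v z0).
Local Notation O := (vanish v z0).

(** The contraction identities for a covector [p] and a symmetric tensor [q], in a basis
    whose first vector is the position vector at [z0]. Their low order terms show that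
    [q12] has order two and [q11] order three. So [q11] is flat; hence [q12] has order
    three and is flat too. At order three the second identity then reduces to
    [8 Y1 T_2(p1)^2 = 0], and all first derivatives vanish. *)
Lemma contraction_orders (Y1 Y2 p1 p2 q11 q12 q22 : Z -> R) : fibre z0 ->
  smooth_on A Y1 -> smooth_on A Y2 -> smooth_on A p1 -> smooth_on A p2 ->
  smooth_on A q22 -> FF q11 -> FF q12 ->
  Y1 z0 != 0 -> Y2 z0 = 0 -> D Y2 z0 != 0 -> p1 z0 = 0 -> p2 z0 = 0 ->
  q11 z0 = 0 -> q12 z0 = 0 ->
  (forall z, fibre z -> Y1 z * D p1 z + Y2 z * D p2 z = 0) ->
  (forall z, fibre z -> Y1 z * D q11 z + Y2 z * D q12 z =
     4 * (D p1 z * (Y1 z * p1 z + Y2 z * p2 z))) ->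
  (forall z, fibre z -> Y1 z * D q12 z + Y2 z * D q22 z =
     4 * (D p2 z * (Y1 z * p1 z + Y2 z * p2 z))) ->
  [/\ D p1 z0 = 0, D p2 z0 = 0, D q11 z0 = 0, D q12 z0 = 0 & D q22 z0 = 0].
Proof.
move=> Fz0 sY1 sY2 sp1 sp2 sq22 Fq11 Fq12 Y10 Y20 DY2 p10 p20 q110 q120 r1 r2 r3.
have sq11 := FF_smooth Fq11; have sq12 := FF_smooth Fq12.
have sD (f : Z -> R) : smooth_on A f -> smooth_on A (D f) by exact: smooth_vder.
have sDp1 := sD _ sp1; have sDp2 := sD _ sp2; have sDq11 := sD _ sq11.
have sDq12 := sD _ sq12; have sDq22 := sD _ sq22.
have TM a b (f g : Z -> R) : smooth_on A f -> smooth_on A g -> O a f -> O b g ->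
    T (a + b)%N (fun z => f z * g z) = T a f * T b g
    by move=> sf sg; exact: (taylor_mul oA sv Fz0 sf sg).
have OM a b (f g : Z -> R) : smooth_on A f -> smooth_on A g -> O a f -> O b g ->
    O (a + b)%N (fun z => f z * g z)
    by move=> sf sg; exact: (vanish_mul oA sv Fz0 sf sg).
have TD k f : T k (D f) = k.+1%:R * T k.+1 f by exact: taylor_vder.
have O0 f : O 0%N f by [].
have O1 f : f z0 = 0 -> O 1%N f by move=> f0 [|//] _; rewrite taylor0.
have T0 f : T 0%N f = f z0 by exact: taylor0.
have T1 f : T 1%N f = D f z0 by have := TD 0%N f; rewrite T0 mul1r => ->.
set Zt := fun z => Y1 z * p1 z + Y2 z * p2 z in r2 r3.
have sm1 : smooth_on A (fun z => Y1 z * p1 z) by smooth.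
have sm2 : smooth_on A (fun z => Y2 z * p2 z) by smooth.
have sZt : smooth_on A Zt by rewrite /Zt; smooth.
(* the expansion of a relation [Y1 f + Y2 g = 4 (h Zt)] *)
have rel k (f g h : Z -> R) : smooth_on A f -> smooth_on A g -> smooth_on A h ->
    (forall z, fibre z -> Y1 z * f z + Y2 z * g z = 4 * (h z * Zt z)) ->
    T k (fun z => Y1 z * f z) + T k (fun z => Y2 z * g z) = 4 * T k (fun z => h z * Zt z).
  move=> sf sg sh E; have s1 : smooth_on A (fun z => Y1 z * f z) by smooth.
  have s2 : smooth_on A (fun z => Y2 z * g z) by smooth.
  have s3 : smooth_on A (fun z => h z * Zt z) by smooth.
  rewrite -(taylor_add oA sv Fz0)// -(taylor_scale oA sv Fz0)//.
  exact: (taylor_eq oA v Fz0).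
have Dp1 : D p1 z0 = 0.
  by have /eqP := r1 z0 Fz0; rewrite Y20 mul0r addr0 mulf_eq0 (negbTE Y10) => /eqP.
have Op1 : O 2%N p1 by apply: vanish_antider => //; exact: O1.
have ODp1 : O 1%N (D p1) by exact: vanish_vder.
have OY2 := O1 _ Y20; have Op2 := O1 _ p20.
(* the first order term of [r1] *)
have R1 : Y1 z0 * (2 * T 2%N p1) + D Y2 z0 * D p2 z0 = 0.
  have s1 : smooth_on A (fun z => Y1 z * D p1 z) by smooth.
  have s2 : smooth_on A (fun z => Y2 z * D p2 z) by smooth.
  have <- : T 1%N (fun z => Y1 z * D p1 z + Y2 z * D p2 z) = 0.
    exact: (taylor_zero oA sv Fz0).
  rewrite (taylor_add oA sv Fz0)//.
  by rewrite (TM 0%N 1%N)// (TM 1%N 0%N)// TD !T0 T1.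
have OZt : O 2%N Zt.
  move=> k k2; rewrite /Zt (taylor_add oA sv Fz0)//.
  by rewrite (OM 0%N 2%N _ _ sY1 sp1)// (OM 1%N 1%N _ _ sY2 sp2)// addr0.
have TZt : T 2%N Zt = - (Y1 z0 * T 2%N p1).
  rewrite /Zt (taylor_add oA sv Fz0)//.
  rewrite (TM 0%N 2%N _ _ sY1 sp1)// (TM 1%N 1%N _ _ sY2 sp2)// T0 !T1.
  by move: R1; lra.
have Dq12 : D q12 z0 = 0.
  have := rel 0%N _ _ _ sDq12 sDq22 sDp2 r3; rewrite !T0 Y20 mul0r addr0.
  have -> : Zt z0 = 0 by rewrite -T0 OZt.
  by rewrite !mulr0 => /eqP; rewrite mulf_eq0 (negbTE Y10) => /eqP.
have Oq12 : O 2%N q12 by apply: vanish_antider => //; exact: O1.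
have ODq12 : O 1%N (D q12) by exact: vanish_vder.
have OpZ : O 3%N (fun z => D p1 z * Zt z) by exact: (OM 1%N 2%N).
have Oq11 : O 3%N q11.
  apply: vanish_antider => //; apply: (@vanish_div _ _ oA _ _ sv _ Fz0 2 Y1) => //.
  move=> k k2; have := rel k _ _ _ sDq11 sDq12 sDp1 r2.
  rewrite (OpZ k (ltn_trans k2 (ltnSn _))) mulr0.
  by rewrite [X in _ + X](OM 1%N 1%N _ _ sY2 sDq12)// addr0.
(* from here on [q11] drops out of every expansion *)
have F11 := flat_of_vanish3 Fz0 Fq11 Oq11.
have FD11 k : O k (D q11) by move=> i _; rewrite TD F11 mulr0.
have Oq12' : O 3%N q12.
  move=> k; rewrite ltnS leq_eqVlt => /orP[/eqP ->|/Oq12//].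
  have := rel 2%N _ _ _ sDq11 sDq12 sDp1 r2; rewrite (OpZ 2%N)// mulr0.
  rewrite (OM 0%N 3%N _ _ sY1 sDq11 _ (FD11 3%N))// add0r (TM 1%N 1%N _ _ sY2 sDq12)//.
  rewrite TD T1 => /eqP; rewrite mulf_eq0 (negbTE DY2) /= mulf_eq0 pnatr_eq0 /=.
  by move/eqP.
have F12 := flat_of_vanish3 Fz0 Fq12 Oq12'.
have FD12 k : O k (D q12) by move=> i _; rewrite TD F12 mulr0.
(* order three of [r2]: both terms on its left are flat *)
have p12 : T 2%N p1 = 0.
  have := rel 3%N _ _ _ sDq11 sDq12 sDp1 r2.
  rewrite (OM 0%N 4%N _ _ sY1 sDq11 _ (FD11 4%N))//.
  rewrite (OM 0%N 4%N _ _ sY2 sDq12 _ (FD12 4%N))//.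
  rewrite (TM 1%N 2%N _ _ sDp1 sZt)// TZt TD addr0; move: (T 2%N p1) => t.
  move/esym/eqP; rewrite (_ : 4 * _ = - (8 * Y1 z0) * t ^+ 2); last by ring.
  by rewrite mulf_eq0 oppr_eq0 mulf_eq0 (negbTE Y10) pnatr_eq0 /= sqrf_eq0 => /eqP.
have Dp2 : D p2 z0 = 0.
  by move/eqP: R1; rewrite p12 !mulr0 add0r mulf_eq0 (negbTE DY2) => /eqP.
split=> //; first by rewrite -T1 F11.
have := rel 1%N _ _ _ sDq12 sDq22 sDp2 r3.
rewrite (OM 0%N 2%N _ _ sY1 sDq12 _ (FD12 2%N))// add0r.
rewrite (OM 0%N 2%N _ _ sDp2 sZt)// mulr0 (TM 1%N 0%N _ _ sY2 sDq22)// T1 T0.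
by move/eqP; rewrite mulf_eq0 (negbTE DY2) => /eqP.
Qed.

End LieOrders.

(** Inverts a system of linear equations from explicit cofactors. *)
Lemma eq0_mod3 (R : comNzRingType) (c1 c2 c3 x l1 l2 l3 : R) :
  l1 = 0 -> l2 = 0 -> l3 = 0 -> x = c1 * l1 + c2 * l2 + c3 * l3 -> x = 0.
Proof. by move=> -> -> -> ->; rewrite !mulr0 !addr0. Qed.

Section Contraction.
Context (R : realType) (A : set ('rV[R]_2 * 'rV[R]_2)) (oA : open A).
Local Notation Z := ('rV[R]_2 * 'rV[R]_2)%type.
Local Notation y := (@ycoord R).
Context (x0 : 'rV[R]_2) (v : 'I_2 -> Z -> R) (sv : forall i, smooth_on A (v i)).
Local Notation fibre := (fibre A x0).
Local Notation D := (vder v).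
Context (FF : (Z -> R) -> Prop).
Context (FF_smooth : forall f, FF f -> smooth_on A f) (FF1 : FF (fun=> 1)).
Context (FF_linear : forall (a : R) f g, FF f -> FF g -> FF (fun z => a * f z + g z)).
Context (FF_wronskian : forall f g, FF f -> FF g -> FF (wronskian v f g)).
Context (N : nat) (FF_dependent : forall f : 'I_N.+1 -> Z -> R, (forall i, FF (f i)) ->
  exists c : 'I_N.+1 -> R, (exists i, c i != 0) /\
    forall z, fibre z -> \sum_i c i * f i z = 0).

Let FF_eq f g : FF f -> (forall z, f z = g z) -> FF g.
Proof. by move=> Ff /funext <-. Qed.

Let FF_vder f : FF f -> FF (D f).
Proof.
move=> Ff; apply: FF_eq (FF_wronskian FF1 Ff) _ => z.
by rewrite /wronskian vder_cst mulr0 subr0 mul1r.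
Qed.

Let FF_cst (a : R) : FF (fun=> a).
Proof.
apply: FF_eq (FF_linear (a - 1) FF1 FF1) _ => z; ring.
Qed.

Let FF_scale (a : R) f : FF f -> FF (fun z => a * f z).
Proof. by move=> Ff; apply: FF_eq (FF_linear a Ff (FF_cst 0)) _ => z; ring. Qed.

Let FF_add f g : FF f -> FF g -> FF (fun z => f z + g z).
Proof. by move=> Ff Fg; apply: FF_eq (FF_linear 1 Ff Fg) _ => z; ring. Qed.

Context (transverse : forall z, fibre z -> y 0 z * v 1 z - y 1 z * v 0 z != 0).
Context (p : 'I_2 -> Z -> R) (e : 'I_2 -> 'I_2 -> Z -> R) (lambda : R).
Context (se : forall j k, smooth_on A (e j k)) (lambda0 : lambda != 0).
Context (e_sym : forall z, A z -> e 0 1 z = e 1 0 z).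
Context (FFp : forall j, FF (p j)).
Context (FFq : forall j k, FF (fun z => 4 * (p j z * p k z) - lambda * e j k z)).
Context (yDp : forall z, fibre z -> y 0 z * D (p 0) z + y 1 z * D (p 1) z = 0).
Context (yDe : forall j z, fibre z -> y 0 z * D (e j 0) z + y 1 z * D (e j 1) z = 0).

(** In the basis formed by the position vector [(s, t)] at [z0] and the orthogonal vector
    [(- t, s)] the contraction identities become those of [contraction_orders]. Its
    normalisation at [z0] is achieved by subtracting constants from [p] and a
    combination of the other generators from the quadratic ones. *)
Lemma tensors_constant z0 : fibre z0 ->
  (forall j, D (p j) z0 = 0) /\ (forall j k, D (e j k) z0 = 0).
Proof.
move=> Fz0; have Az0 := Fz0.1.
have sp j : smooth_on A (p j) by exact: FF_smooth.
pose s := y 0 z0; pose t := y 1 z0; pose c j := p j z0; pose n := s * s + t * t.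
have n0 : n != 0.
  apply: contraNneq (transverse Fz0); rewrite -/s -/t /n => /eqP.
  rewrite -!expr2 paddr_eq0 ?sqr_ge0// !sqrf_eq0 => /andP[/eqP -> /eqP ->].
  by rewrite !mul0r subrr.
pose pt j z := p j z - c j.
have spt j : smooth_on A (pt j) by have := sp j; rewrite /pt => ?; smooth.
pose Q j k z := 4 * (pt j z * pt k z) - lambda * e j k z + lambda * e j k z0.
have FFQ j k : FF (Q j k).
  have := FF_add (FF_linear (- 4 * c j) (FFp k) (FF_scale (- 4 * c k) (FFp j)))
     (FF_add (FFq j k) (FF_cst (4 * c j * c k + lambda * e j k z0))).
  by move/FF_eq; apply => z; rewrite /Q /pt; ring.
have Dpt j z : A z -> D (pt j) z = D (p j) z.
  move=> Az; have sc : smooth_on A (fun _ : Z => - c j) by exact: smooth_cst.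
  by rewrite (vder_add v (sp j) sc Az) vder_cst addr0.
have DQ j k z : A z -> D (Q j k) z =
    4 * (D (p j) z * pt k z + pt j z * D (p k) z) - lambda * D (e j k) z.
  move=> Az; have s1 : smooth_on A (fun z => pt j z * pt k z).
    by have := spt j; have := spt k => ? ?; smooth.
  have s2 : smooth_on A (fun z => 4 * (pt j z * pt k z)) by smooth.
  have se' := se j k.
  have s3 : smooth_on A (fun z => - lambda * e j k z) by smooth.
  have s4 : smooth_on A (fun z => 4 * (pt j z * pt k z) + - lambda * e j k z) by smooth.
  have s5 : smooth_on A (fun _ : Z => lambda * e j k z0) by exact: smooth_cst.
  transitivity (D (fun z => (4 * (pt j z * pt k z) + - lambda * e j k z) + lambda * e j k z0) z).
    by congr (D _ z); apply/funext => w; rewrite /Q mulNr.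
  rewrite (vder_add v s4 s5 Az) vder_cst addr0 (vder_add v s2 s3 Az).
  rewrite (vder_scale v _ s1 Az) (vder_scale v _ se' Az) (vder_mul v (spt j) (spt k) Az).
  by rewrite (Dpt j z Az) (Dpt k z Az) mulNr.
have D2 (a b : R) (f g : Z -> R) z : smooth_on A f -> smooth_on A g -> A z ->
    D (fun z => a * f z + b * g z) z = a * D f z + b * D g z.
  move=> sf sg Az; have s1 : smooth_on A (fun z => a * f z) by smooth.
  have s2 : smooth_on A (fun z => b * g z) by smooth.
  by rewrite (vder_add v s1 s2 Az) (vder_scale v _ sf Az) (vder_scale v _ sg Az).
have D3 (a b d : R) (f g h : Z -> R) z : smooth_on A f -> smooth_on A g -> smooth_on A h -> A z ->
    D (fun z => a * f z + (b * g z + d * h z)) z = a * D f z + (b * D g z + d * D h z).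
  move=> sf sg sh Az; have s1 : smooth_on A (fun z => a * f z) by smooth.
  have s2 : smooth_on A (fun z => b * g z + d * h z) by smooth.
  by rewrite (vder_add v s1 s2 Az) (vder_scale v _ sf Az) D2.
pose P1 z := s * pt 0 z + t * pt 1 z; pose P2 z := - t * pt 0 z + s * pt 1 z.
pose Y1 z := s * y 0 z + t * y 1 z; pose Y2 z := - t * y 0 z + s * y 1 z.
pose Q11 z := s * s * Q 0 0 z + (2 * s * t * Q 0 1 z + t * t * Q 1 1 z).
pose Q12 z := - (s * t) * Q 0 0 z + ((s * s - t * t) * Q 0 1 z + s * t * Q 1 1 z).
pose Q22 z := t * t * Q 0 0 z + (- (2 * s * t) * Q 0 1 z + s * s * Q 1 1 z).
have F3 (a b d : R) : FF (fun z => a * Q 0 0 z + (b * Q 0 1 z + d * Q 1 1 z)).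
  exact: FF_linear (FFQ 0 0) (FF_linear b (FFQ 0 1) (FF_scale d (FFQ 1 1))).
have sQ j k : smooth_on A (Q j k) by exact: FF_smooth.
have Dy i z : D (y i) z = v i z.
  rewrite /vder !pd_fibre_ycoord; move: i; elim/ord2_ind => /=; ring.
have sy i : smooth_on A (y i) by smooth.
have DP1 z : A z -> D P1 z = s * D (p 0) z + t * D (p 1) z.
  by move=> Az; rewrite (D2 _ _ _ _ _ (spt 0) (spt 1) Az) (Dpt 0 z Az) (Dpt 1 z Az).
have DP2 z : A z -> D P2 z = - t * D (p 0) z + s * D (p 1) z.
  by move=> Az; rewrite (D2 _ _ _ _ _ (spt 0) (spt 1) Az) (Dpt 0 z Az) (Dpt 1 z Az).
have De z : fibre z -> D (e 1 0) z = D (e 0 1) z.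
  move=> Fz; apply: (vder_eq oA v _ Fz) => w [Aw _]; exact/esym/e_sym.
have D3Q (a b d : R) z : fibre z -> D (fun z => a * Q 0 0 z + (b * Q 0 1 z + d * Q 1 1 z)) z =
   a * (4 * (D (p 0) z * pt 0 z + pt 0 z * D (p 0) z) - lambda * D (e 0 0) z) +
   (b * (4 * (D (p 0) z * pt 1 z + pt 0 z * D (p 1) z) - lambda * D (e 0 1) z) +
    d * (4 * (D (p 1) z * pt 1 z + pt 1 z * D (p 1) z) - lambda * D (e 1 1) z)).
  move=> [Az _]; rewrite (D3 _ _ _ _ _ _ _ (sQ 0 0) (sQ 0 1) (sQ 1 1) Az).
  by rewrite (DQ 0 0 z Az) (DQ 0 1 z Az) (DQ 1 1 z Az).
have Q0 j k : Q j k z0 = 0 by rewrite /Q /pt !subrr; ring.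
have [] := @contraction_orders R A oA x0 v sv FF FF_smooth FF_vder FF_wronskian N
  FF_dependent z0 Y1 Y2 P1 P2 Q11 Q12 Q22 Fz0.
- by have := sy 0; have := sy 1; rewrite /Y1 => ? ?; smooth.
- by have := sy 0; have := sy 1; rewrite /Y2 => ? ?; smooth.
- by have := spt 0; have := spt 1; rewrite /P1 => ? ?; smooth.
- by have := spt 0; have := spt 1; rewrite /P2 => ? ?; smooth.
- by apply: FF_smooth; exact: F3.
- exact: F3.
- exact: F3.
- by rewrite /Y1 -/s -/t -/n.
- by rewrite /Y2 -/s -/t; ring.
- rewrite (D2 _ _ _ _ _ (sy 0) (sy 1) Az0) !Dy.
  by have := transverse Fz0; rewrite -/s -/t; congr (_ != 0); ring.
- by rewrite /P1 /pt !subrr; ring.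
- by rewrite /P2 /pt !subrr; ring.
- by rewrite /Q11 !Q0; ring.
- by rewrite /Q12 !Q0; ring.
- move=> z Fz; rewrite (DP1 z Fz.1) (DP2 z Fz.1) /Y1 /Y2.
  transitivity (n * (y 0 z * D (p 0) z + y 1 z * D (p 1) z)); first by rewrite /n; ring.
  by rewrite (yDp Fz) mulr0.
- move=> z Fz; rewrite !(D3Q _ _ _ z Fz) (DP1 z Fz.1) /Y1 /Y2 /P1 /P2.
  have := yDp Fz; have := yDe 0 Fz; have := yDe 1 Fz; rewrite (De z Fz).
  move: (D (p 0) z) (D (p 1) z) (D (e 0 0) z) (D (e 0 1) z) (D (e 1 1) z).
  move: (pt 0 z) (pt 1 z) (y 0 z) (y 1 z) => a b u w d0 d1 e00 e01 e11 h1 h2 h3.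
  apply/eqP; rewrite -subr_eq0; apply/eqP.
  transitivity (n * (4 * (s * a + t * b) * (u * d0 + w * d1)
    - lambda * (s * (u * e00 + w * e01) + t * (u * e01 + w * e11)))).
    by rewrite /n; ring.
  by rewrite h1 h2 h3; ring.
- move=> z Fz; rewrite !(D3Q _ _ _ z Fz) (DP2 z Fz.1) /Y1 /Y2 /P1 /P2.
  have := yDp Fz; have := yDe 0 Fz; have := yDe 1 Fz; rewrite (De z Fz).
  move: (D (p 0) z) (D (p 1) z) (D (e 0 0) z) (D (e 0 1) z) (D (e 1 1) z).
  move: (pt 0 z) (pt 1 z) (y 0 z) (y 1 z) => a b u w d0 d1 e00 e01 e11 h1 h2 h3.
  apply/eqP; rewrite -subr_eq0; apply/eqP.
  transitivity (n * (4 * (- t * a + s * b) * (u * d0 + w * d1)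
    - lambda * (- t * (u * e00 + w * e01) + s * (u * e01 + w * e11)))).
    by rewrite /n; ring.
  by rewrite h1 h2 h3; ring.
rewrite (DP1 z0 Az0) (DP2 z0 Az0) !(D3Q _ _ _ z0 Fz0).
have -> : pt 0 z0 = 0 by rewrite /pt subrr.
have -> : pt 1 z0 = 0 by rewrite /pt subrr.
move=> H1 H2 H3 H4 H5; split.
  elim/ord2_ind; apply: (mulfI n0); rewrite mulr0.
    transitivity (s * (s * D (p 0) z0 + t * D (p 1) z0)
      - t * (- t * D (p 0) z0 + s * D (p 1) z0)); first by rewrite /n; ring.
    by rewrite H1 H2; ring.
  transitivity (t * (s * D (p 0) z0 + t * D (p 1) z0)
      + s * (- t * D (p 0) z0 + s * D (p 1) z0)); first by rewrite /n; ring.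
  by rewrite H1 H2; ring.
(* back from the rotated components to the original ones *)
have n2 : - (n * n * lambda) != 0 by rewrite oppr_eq0 !mulf_neq0.
have De0 := De z0 Fz0.
move: H3 H4 H5; rewrite !mulr0 !mul0r !addr0 !mulr0 !sub0r.
set e00 := D (e 0 0) z0; set e01 := D (e 0 1) z0; set e11 := D (e 1 1) z0 => H3 H4 H5.
have k00 : e00 = 0.
  apply: (mulfI n2); rewrite mulr0.
  by apply: (eq0_mod3 (c1 := s * s) (c2 := - (2 * s * t)) (c3 := t * t) H3 H4 H5); rewrite /n; ring.
have k01 : e01 = 0.
  apply: (mulfI n2); rewrite mulr0.
  by apply: (eq0_mod3 (c1 := s * t) (c2 := s * s - t * t) (c3 := - (s * t)) H3 H4 H5); rewrite /n; ring.
have k11 : e11 = 0.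
  apply: (mulfI n2); rewrite mulr0.
  by apply: (eq0_mod3 (c1 := t * t) (c2 := 2 * s * t) (c3 := s * s) H3 H4 H5); rewrite /n; ring.
by elim/ord2_ind; elim/ord2_ind => //; rewrite De0.
Qed.

End Contraction.

Section FibreConstant.
Context (R : realType) (A : set ('rV[R]_2 * 'rV[R]_2)) (oA : open A).
Local Notation rV := 'rV[R]_2.
Local Notation Z := (rV * rV)%type.
Local Notation y := (@ycoord R).
Local Notation Y i := (pd (fibre_dir i)).

(** The field has coefficients of degree one, and a fibre derivative lowers the degree by
    one. *)
Lemma euler_vder (v : 'I_2 -> Z -> R) (f : Z -> R) :
  (forall i, smooth_on A (v i)) -> (forall i, euler A 1 (v i)) ->
  smooth_on A f -> euler A 0 f -> euler A 0 (vder v f).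
Proof.
move=> sv ev sf ef z Az; have sY i : smooth_on A (Y i f) by smooth.
have sm i : smooth_on A (fun z => v i z * Y i f z) by have := sv i; have := sY i => ? ?; smooth.
have pdv i : Y i (vder v f) z = Y i (v 0) z * Y 0 f z + v 0 z * Y i (Y 0 f) z
    + (Y i (v 1) z * Y 1 f z + v 1 z * Y i (Y 1 f) z).
  rewrite (pd_add _ (sm 0) (sm 1) Az).
  by rewrite (pd_mul _ (sv 0) (sY 0) Az) (pd_mul _ (sv 1) (sY 1) Az).
rewrite !pdv mul0r.
have h0 := ev 0 z Az; have h1 := ev 1 z Az.
have k0 := derive_euler oA 0 sf ef Az; have k1 := derive_euler oA 1 sf ef Az.
transitivity ((y 0 z * Y 0 (v 0) z + y 1 z * Y 1 (v 0) z) * Y 0 f z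
  + (y 0 z * Y 0 (v 1) z + y 1 z * Y 1 (v 1) z) * Y 1 f z
  + v 0 z * (y 0 z * Y 0 (Y 0 f) z + y 1 z * Y 1 (Y 0 f) z)
  + v 1 z * (y 0 z * Y 0 (Y 1 f) z + y 1 z * Y 1 (Y 1 f) z)); first ring.
rewrite h0 h1 k0 k1; ring.
Qed.

Context (x0 : rV) (f : Z -> R) (sf : smooth_on A f).
Context (inA : forall w : rV, w != 0 -> A (x0, w)).
Context (df0 : forall (w : rV) i, w != 0 -> Y i f (x0, w) = 0).

Lemma segment_constant (w u : rV) :
  (forall t : R, 0 <= t <= 1 -> w + t *: u != 0) -> f (x0, w + u) = f (x0, w).
Proof.
move=> wu0.
have zE (t : R) : (x0, w) + t *: ((0, u) : Z) = (x0, w + t *: u).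
  by apply/pair_equal_spec; split; rewrite /= ?scaler0 ?addr0.
have derf (t : R) : 0 <= t <= 1 -> derivable f ((x0, w) + t *: ((0, u) : Z)) (0, u).
  by move=> t01; apply: smooth_derivable sf _; rewrite zE; exact/inA/wu0.
have [t t01] := MVT_line ltr01 derf.
rewrite !zE scale1r => fE; apply/eqP; rewrite -subr_eq0 fE mulr1.
have At := inA (wu0 t t01); rewrite (deriveE _ (smooth_diff sf At)).
have -> : ((0, u) : Z) = u 0 0 *: direction R (fibre_dir 0) + u 0 1 *: direction R (fibre_dir 1).
  apply/pair_equal_spec; split; last exact: rV2E.
  by rewrite /= /fibre_vec /= !scaler0 addr0.
rewrite linearD !linearZZ -!(deriveE _ (smooth_diff sf At)) -!pdE !df0 ?wu0//.
by rewrite ?scaler0 ?mulr0 ?addr0.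
Qed.

(** Any two points of the punctured plane are joined by at most three segments. *)
Lemma fibre_constant (w w' : rV) : w != 0 -> w' != 0 -> f (x0, w) = f (x0, w').
Proof.
pose e0 : rV := delta_mx 0 0; pose e1 : rV := delta_mx 0 1.
suff H (u : rV) : u != 0 -> f (x0, u) = f (x0, e0) by move=> w0 w'0; rewrite !H.
have H1 (a : rV) : a 0 1 != 0 -> f (x0, a) = f (x0, e0).
  move: a => {}u u1; have uE : u + (e0 - u) = e0 by rewrite addrC subrK.
  rewrite -uE {uE}; apply/esym/segment_constant => t t01.
  apply/eqP => /rowP E; have := E 0; have := E 1; rewrite !mxE /= mulr1n mulr0n.
  rewrite sub0r mulrN -{1}[u 0 1]mul1r -mulrBl => /eqP; rewrite mulf_eq0 (negbTE u1) orbF.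
  rewrite subr_eq0 => /eqP <-; rewrite mul1r addrC subrK => /eqP.
  by rewrite oner_eq0.
move=> u0; case: (eqVneq (u 0 1) 0) => [u1|/H1//].
rewrite -(H1 e1); last by rewrite mxE /= pnatr_eq0.
have uE : u + (e1 - u) = e1 by rewrite addrC subrK.
rewrite -uE {uE}; apply/esym/segment_constant => t t01.
apply: contra_neqN u0 => /eqP/rowP E.
have := E 0; have := E 1; rewrite !mxE /= mulr1n mulr0n u1 oppr0 addr0 add0r mulr1 => t0.
rewrite t0 mul0r addr0 => u00.
by apply/rowP; elim/ord2_ind; rewrite mxE.
Qed.

End FibreConstant.

Section LineGeodesic.
Context (R : realType).
Local Notation rV := 'rV[R]_2.

(** A regular curve that runs along a line in the direction of [v] has velocity a
    positive multiple of [v] and acceleration a multiple of [v]. *)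
Lemma line_velocity (u v : rV) (J : set R) (s : R -> R) (t0 : R) :
  let c := fun t => u + s t *: v in
  v != 0 -> open J -> J t0 -> (forall t t', J t -> J t' -> t < t' -> s t < s t') ->
  (forall t, J t -> derivable c t 1) -> derivable (derive1 c) t0 1 ->
  derive1 c t0 != 0 ->
  exists a b : R, [/\ 0 < a, derive1 c t0 = a *: v & derive1 (derive1 c) t0 = b *: v].
Proof.
move=> c v0 oJ Jt0 s_incr dc ddc c0.
have [i vi] : exists i, v 0 i != 0.
  by apply/existsP; apply: contra_neqT v0 => /existsPn vi; apply/rowP => i;
    rewrite mxE; apply/eqP; have := vi i; rewrite negbK.
have sE : s = fun t => (c t 0 i - u 0 i) * (v 0 i)^-1.
  by apply/funext => t; rewrite /c !mxE addrC addKr mulfK.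
have ds t : J t -> derivable s t 1.
  move=> /dc /derivable_mxP /(_ 0 i) dci; rewrite sE.
  have /@ex_derive := is_derive_mul (is_derive_sub (derivableP dci) (is_derive_const (u 0 i) t 1))
    (is_derive_const (v 0 i)^-1 t 1).
  exact.
have c1 t : J t -> derive1 c t = 'D_1 s t *: v.
  move=> Jt; rewrite derive1E (derive_mx (dc t Jt)); apply/rowP => k; rewrite !mxE.
  have := is_derive_add (is_derive_const (u 0 k) t 1)
    (is_derive_mul (derivableP (ds t Jt)) (is_derive_const (v 0 k) t 1)).
  rewrite mulr0 addr0 add0r => /@derive_val <-; congr ('D_1 _ t).
  by apply/funext => r; rewrite /c !mxE.
exists ('D_1 s t0), ('D_1 ('D_1 s) t0); split.
- rewrite lt_def; apply/andP; split.
    by apply: contra_neq c0; rewrite c1// => ->; rewrite scale0r.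
  rewrite -derive1E; apply: (@incr_derive1_ge0 _ s J).
  + by move=> t; rewrite inE => /interior_subset; exact: ds.
  + by move=> t t'; rewrite !inE; exact: s_incr.
  + by apply: open_nbhs_nbhs.
- exact: c1.
- have nJ : \forall t \near t0, derive1 c t = 'D_1 s t *: v.
    by apply: filterS c1 _; exact: open_nbhs_nbhs.
  rewrite derive1E (near_eq_derive _ nJ).
  have dds : derivable ('D_1 s) t0 1.
    move: ddc => /(near_eq_derivable nJ) /derivable_mxP /(_ 0 i) dd.
    have /@ex_derive := is_derive_mul (derivableP dd) (is_derive_const (v 0 i)^-1 t0 1).
    congr (derivable _ t0 1); apply/funext => t.
    by rewrite !mxE mulfK.
  have dv : is_derive t0 1 (fun t => 'D_1 s t *: v) ('D_1 ('D_1 s) t0 *: v).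
    have dsd : differentiable ('D_1 s) t0 by exact/derivable1_diffP.
    split; first by apply/derivable1_diffP; exact: differentiableZl.
    rewrite deriveE; last exact: differentiableZl.
    by rewrite diffZl// deriveE.
  by have /@derive_val := dv.
Qed.

End LineGeodesic.

(** * Smooth bump functions *)

Section Plateau.
Context (R : realType).
Implicit Types (t : R) (k : nat).

(** The functions [t^-k exp(- 1/t)] are considered for all [k] together because their span
    is closed under differentiation. *)
Definition flat_exp k t : R := if 0 < t then t^-1 ^+ k * expR (- t^-1) else 0.

(** Quadratic decay at zero, from the term of degree [k + 2] of the exponential series in
    [1/t]; it makes the derivative at zero vanish. *)
Lemma flat_exp_bound k t : `|flat_exp k t| <= (k.+2)`!%:R * t ^+ 2.
Proof.
rewrite /flat_exp; case: ltP => t0; last by rewrite normr0 mulr_ge0 ?sqr_ge0.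
have x0 : 0 < t^-1 by rewrite invr_gt0.
rewrite ger0_norm; last by rewrite mulr_ge0 ?expR_ge0 ?exprn_ge0// ltW.
rewrite expRN ler_pdivrMr ?expR_gt0//.
have B : t^-1 ^+ k.+2 / (k.+2)`!%:R <= expR t^-1.
  by apply: le_trans (expR_ge1Dxn k.+1 (ltW x0)); rewrite lerDr.
have c0 : (k.+2)`!%:R != 0 :> R by rewrite pnatr_eq0 -lt0n fact_gt0.
have -> : t^-1 ^+ k = (k.+2)`!%:R * t ^+ 2 * (t^-1 ^+ k.+2 / (k.+2)`!%:R).
  by rewrite !exprS; move: (t^-1 ^+ k) (_%:R) c0 => x c c0; field; rewrite c0 gt_eqF.
by rewrite ler_wpM2l// mulr_ge0 ?sqr_ge0.
Qed.

Lemma is_derive_comp1 (f g : R -> R) (t df dg : R) :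
  is_derive t 1 g dg -> is_derive (g t) 1 f df ->
  is_derive t 1 (fun s => f (g s)) (df * dg).
Proof.
move=> [g1 <-] [f1 <-]; split.
  by apply/derivable1_diffP/differentiable_comp; exact/derivable1_diffP.
by rewrite -!derive1E (derive1_comp g1 f1).
Qed.

Lemma flat_exp_derive k t :
  is_derive t 1 (flat_exp k) (flat_exp k.+2 t - k%:R * flat_exp k.+1 t).
Proof.
case: (ltrgtP t 0) => t0.
- have -> : flat_exp k.+2 t - k%:R * flat_exp k.+1 t = 0.
    by rewrite /flat_exp ltNge (ltW t0) /= mulr0 subrr.
  apply: (near_eq_is_derive _ (is_derive_const (0 : R) t 1)).
  near=> s; rewrite /flat_exp ltNge ltW//.
  by near: s; exact: lt_nbhsl.
- have tn0 : t != 0 by rewrite gt_eqF.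
  have di := @is_derive_inv _ _ id t 1 _ tn0 (is_derive_id t 1).
  have de := is_derive_comp1 (is_derive_opp di) (is_derive_expR (- t^-1)).
  have E := is_derive_mul (is_derive_pow k di) de.
  have nE : \forall s \near t, s^-1 ^+ k * expR (- s^-1) = flat_exp k s.
    by near=> s; rewrite /flat_exp ifT//; near: s; exact: lt_nbhsr.
  apply: is_derive_eq; first exact: near_eq_is_derive nE E.
  rewrite /flat_exp t0 /=; set e := expR _.
  case: k {E nE} => [|k]; first by rewrite !mul0r !expr0; field.
  by rewrite /= !exprVn !exprS; field; rewrite expf_neq0.
- subst t.
  have -> : flat_exp k.+2 0 - k%:R * flat_exp k.+1 0 = 0.
    by rewrite /flat_exp ltxx mulr0 subrr.
  have cv : h^-1 *: ((flat_exp k \o shift 0) (h *: 1) - flat_exp k 0) @[h --> 0^'] --> (0 : R).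
    apply/cvgr0Pnorm_le => e e0; near=> h.
    have h0 : h != 0 by near: h; exact: nbhs_dnbhs_neq.
    rewrite /= addr0 [h *: 1]mulr1 {2}/flat_exp ltxx subr0 normrZ normfV.
    rewrite ler_pdivrMl ?normr_gt0//; apply: le_trans (flat_exp_bound _ _) _.
    rewrite -real_normK ?num_real// expr2 mulrCA ler_wpM2l//.
    have C0 : 0 < (k.+2)`!%:R :> R by rewrite ltr0n fact_gt0.
    rewrite -ler_pdivlMl//; near: h.
    by apply: dnbhs0_le; rewrite mulr_gt0// invr_gt0.
  by split; [apply/cvg_ex; exists 0|exact: cvg_lim cv].
Unshelve. all: by end_near. Qed.

Lemma smooth_flat_exp k : smooth_on setT (flat_exp k).
Proof.
have oT : open (@setT R) by exact: openT.
apply/smooth_onP => n; elim: n k => [|n IHn] k.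
  split=> // t _; apply/derivable1_diffP.
  by have /@ex_derive := flat_exp_derive k t.
have df t : differentiable (flat_exp k) t.
  by apply/derivable1_diffP; have /@ex_derive := flat_exp_derive k t.
split=> [//|v]; apply: (@smooth_upto_ext _ _ _ _ oT _
    (fun t => v * (flat_exp k.+2 t + (- k%:R) * flat_exp k.+1 t))).
  move=> t _; rewrite deriveE// -[v]mulr1 -[_ * 1]/(v *: 1) linearZZ -deriveE//.
  by have /@derive_val -> := flat_exp_derive k t; rewrite /GRing.scale /= mulNr mulr1.
apply: (smooth_upto_mul oT); first by apply: (smooth_onP _ _).1; exact: smooth_cst.
apply: (smooth_upto_add oT) => //; apply: (smooth_upto_mul oT) => //.
by apply: (smooth_onP _ _).1; exact: smooth_cst.
Qed.

Lemma smooth_comp1 (V : normedModType R) (A : set V) (g : V -> R) (f : R -> R) :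
  open A -> smooth_on A g -> smooth_on setT f -> smooth_on A (f \o g).
Proof.
move=> oA sg sf.
by apply: (@smooth_comp _ _ _ oA R 1%N (fun=> 1) (fun _ => id) setT) => //;
  [exact: openT|move=> w; rewrite big_ord1 /GRing.scale /= mulr1].
Qed.

Definition smooth_step t : R := flat_exp 0 t * (flat_exp 0 t + flat_exp 0 (1 - t))^-1.

Lemma flat_exp_gt0 t : 0 < t -> 0 < flat_exp 0 t.
Proof. by move=> t0; rewrite /flat_exp t0 expr0 mul1r expR_gt0. Qed.

Lemma flat_exp_eq0 t : t <= 0 -> flat_exp 0 t = 0.
Proof. by move=> t0; rewrite /flat_exp ltNge t0. Qed.

Lemma flat_exp_ge0 t : 0 <= flat_exp 0 t.
Proof. by case: (lerP t 0) => [/flat_exp_eq0 ->//|/flat_exp_gt0/ltW]. Qed.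

Lemma smooth_smooth_step : smooth_on setT smooth_step.
Proof.
have oT : open (@setT R) by exact: openT.
have s1 := smooth_flat_exp 0.
have sid : smooth_on setT (@id R).
  by apply: (@smooth_linear _ _ _ oT _ idfun) => t; exact: cvg_id.
have s2 : smooth_on setT (fun t => flat_exp 0 (1 - t)).
  apply: (smooth_comp1 oT _ s1); apply: smooth_sub => //; exact: smooth_cst.
apply: smooth_mul => //; apply: smooth_inv => //; first exact: smooth_add.
move=> t _; rewrite gt_eqF//; case: (ltrP 0 t) => t0.
  by rewrite ltr_wpDr ?flat_exp_ge0// flat_exp_gt0.
rewrite ltr_wpDl ?flat_exp_ge0// flat_exp_gt0// subr_gt0.
exact: le_lt_trans t0 ltr01.
Qed.

Lemma smooth_step0 t : t <= 0 -> smooth_step t = 0.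
Proof. by move=> t0; rewrite /smooth_step flat_exp_eq0 ?mul0r. Qed.

Lemma smooth_step1 t : 1 <= t -> smooth_step t = 1.
Proof.
move=> t1; rewrite /smooth_step [flat_exp 0 (1 - t)]flat_exp_eq0 ?subr_le0// addr0 divff//.
by rewrite gt_eqF// flat_exp_gt0//; exact: lt_le_trans t1.
Qed.

(** A bump function: [1] on the square of radius [r] around [a], and [0] outside the one of
    radius [2 r]. *)
Definition plateau (a : 'rV[R]_2) (r : R) (x : 'rV[R]_2) : R :=
  \prod_(i < 2) (smooth_step (2 - (x 0 i - a 0 i) / r) *
                 smooth_step (2 + (x 0 i - a 0 i) / r)).

Lemma smooth_coordinate (A : set 'rV[R]_2) i : open A -> smooth_on A (fun x : 'rV[R]_2 => x 0 i : R).
Proof.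
move=> oA.
have lin : linear (fun x : 'rV[R]_2 => x 0 i : R) by move=> c u v; rewrite !mxE.
pose l : {linear 'rV[R]_2 -> R} := HB.pack (fun x : 'rV[R]_2 => x 0 i : R)
  (GRing.isLinear.Build _ _ _ _ _ lin).
by apply: (@smooth_linear _ _ _ oA _ l) => x; exact: coord_continuous.
Qed.

Lemma smooth_plateau a r : smooth_on setT (plateau a r).
Proof.
have oT : open (@setT 'rV[R]_2) by exact: openT.
have sl i : smooth_on setT (fun x : 'rV[R]_2 => (x 0 i - a 0 i) * r^-1).
  apply: smooth_mul => //; last exact: smooth_cst.
  by apply: smooth_sub => //; [exact: smooth_coordinate|exact: smooth_cst].
pose b i (x : 'rV[R]_2) := smooth_step (2 - (x 0 i - a 0 i) / r) *
  smooth_step (2 + (x 0 i - a 0 i) / r).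
have sb i : smooth_on setT (b i).
  apply: smooth_mul => //; apply: (smooth_comp1 oT _ smooth_smooth_step).
    by apply: smooth_sub => //; exact: smooth_cst.
  by apply: smooth_add => //; exact: smooth_cst.
apply: (@smooth_ext _ _ _ _ oT (fun x => b 0 x * b 1 x)); last exact: smooth_mul.
move=> x _; rewrite /plateau big_ord_recl big_ord1 /b; congr (_ * _).
by rewrite (_ : lift ord0 ord0 = 1)//; exact/val_inj.
Qed.

Lemma plateau1 (a : 'rV[R]_2) (r : R) (x : 'rV[R]_2) : 0 < r ->
  (forall i, `|x 0 i - a 0 i| <= r) -> plateau a r x = 1.
Proof.
move=> r0 xa; rewrite /plateau big1// => i _.
have := xa i; rewrite ler_norml => /andP[h1 h2].
have q1 : - 1 <= (x 0 i - a 0 i) / r by rewrite ler_pdivlMr// mulN1r.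
have q2 : (x 0 i - a 0 i) / r <= 1 by rewrite ler_pdivrMr// mul1r.
by rewrite !smooth_step1 ?mulr1//; lra.
Qed.

Lemma plateau0 (a : 'rV[R]_2) (r : R) (x : 'rV[R]_2) : 0 < r ->
  (exists i, 2 * r <= `|x 0 i - a 0 i|) -> plateau a r x = 0.
Proof.
move=> r0 [i xa]; rewrite /plateau (bigD1 i)//=; apply/eqP; rewrite mulf_eq0; apply/orP; left.
rewrite mulf_eq0; move: xa; rewrite ler_normr => /orP[h|h]; apply/orP; [left|right].
  have q : 2 <= (x 0 i - a 0 i) / r by rewrite ler_pdivlMr.
  by rewrite smooth_step0//; lra.
have q : (x 0 i - a 0 i) / r <= - 2 by rewrite ler_pdivrMr// mulNr lerNr.
by rewrite smooth_step0//; lra.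
Qed.

End Plateau.

(** * Charts, tangent vectors and local coordinate fields *)

(** Transition maps satisfy the cocycle identity only on the common domains, so the chain
    rule is needed for a composite given on an open set. *)
Lemma diff_comp_on (R : realType) (V W U : normedModType R) (O : set V) (f : V -> W)
    (g : W -> U) (h : V -> U) x z y : open O -> O x -> (forall x, O x -> h x = g (f x)) ->
  f x = z -> differentiable f x -> differentiable g z -> differentiable h x ->
  'd h x y = 'd g z ('d f x y).
Proof.
move=> oO Ox hE <- df dg dh; rewrite -(deriveE _ dh).
have -> : 'D_y h x = 'D_y (g \o f) x by exact: (derive_eq_on oO).
by rewrite (deriveE _ (differentiable_comp df dg)) (diff_comp df dg).
Qed.

Section Charts.
Context (R : realType) (n : nat) (M : manifold R n).
Implicit Types (phi psi chi : chart R n M) (p q : M) (x y : 'rV[R]_n).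

Lemma chart_inv_continuous phi x : chart_img phi x -> {for x, continuous (chart_inv phi)}.
Proof.
move=> Ux; have := @chart_inv_cont _ _ _ phi.
rewrite continuous_open_subspace; last exact: chart_open_img.
by apply; rewrite inE.
Qed.

Lemma chart_invK phi x : chart_img phi x -> chart_map phi (chart_inv phi x) = x.
Proof. by move=> [p dp <-]; rewrite chart_mapK. Qed.

Lemma chart_inv_dom phi x : chart_img phi x -> chart_dom phi (chart_inv phi x).
Proof. by move=> [p dp <-]; rewrite chart_mapK. Qed.

Lemma chart_map_dom phi p : chart_dom phi p -> chart_img phi (chart_map phi p).
Proof. by move=> dp; exists p. Qed.

Lemma open_chart_image phi (O : set M) : open O ->
  open (chart_map phi @` (chart_dom phi `&` O)).
Proof.
move=> oO; rewrite openE => x [p [dp Op] <-].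
have Ux := chart_map_dom dp.
have n1 : nbhs (chart_map phi p) (chart_img phi).
  by apply: open_nbhs_nbhs; split => //; exact: chart_open_img.
have n2 : nbhs (chart_map phi p) (chart_inv phi @^-1` O).
  apply: chart_inv_continuous => //; rewrite chart_mapK//.
  exact: open_nbhs_nbhs.
apply: filterS2 n1 n2 => z Uz Oz; exists (chart_inv phi z); last exact: chart_invK.
by split => //; exact: chart_inv_dom.
Qed.

Definition overlap phi psi : set 'rV[R]_n := chart_map phi @` (chart_dom phi `&` chart_dom psi).

Lemma open_overlap phi psi : open (overlap phi psi).
Proof. by apply: open_chart_image; exact: chart_open_dom. Qed.

Lemma overlapP phi psi p : chart_dom phi p -> chart_dom psi p -> overlap phi psi (chart_map phi p).
Proof. by move=> dp dq; exists p. Qed.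

Lemma transitionE phi psi p : chart_dom phi p -> transition phi psi (chart_map phi p) = chart_map psi p.
Proof. by move=> dp; rewrite /transition /= chart_mapK. Qed.

Lemma transition_diff phi psi p : charts_at p phi -> charts_at p psi ->
  differentiable (transition phi psi) (chart_map phi p).
Proof.
move=> [ap dp] [aq dq]; apply: smooth_diff (overlapP dp dq).
exact: (atlas_smooth ap aq).
Qed.

Lemma diff_transition_id phi p y : charts_at p phi ->
  'd (transition phi phi) (chart_map phi p) y = y.
Proof.
move=> [ap dp]; rewrite -deriveE; last exact: transition_diff.
have -> : 'D_y (transition phi phi) (chart_map phi p) = 'D_y id (chart_map phi p).
  apply: (derive_eq_on (@open_overlap phi phi)); last exact: overlapP.
  by move=> _ [q [dq _] <-]; rewrite transitionE.
exact: derive_id.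
Qed.

Lemma diff_transition_comp phi psi chi p y :
  charts_at p phi -> charts_at p psi -> charts_at p chi ->
  'd (transition phi chi) (chart_map phi p) y =
  'd (transition psi chi) (chart_map psi p) ('d (transition phi psi) (chart_map phi p) y).
Proof.
move=> cphi cpsi cchi.
have oO : open (chart_map phi @` (chart_dom phi `&` (chart_dom psi `&` chart_dom chi))).
  by apply: open_chart_image; apply: openI; exact: chart_open_dom.
apply: (diff_comp_on _ oO); [| | |exact: transition_diff..].
- by exists p => //; move: cphi cpsi cchi => [_ ?] [_ ?] [_ ?].
- by move=> _ [q [dq [dq1 dq2]] <-]; rewrite !transitionE.
- by rewrite transitionE//; case: cphi.
Qed.

Lemma comps_atE p (f : comps M) phi : charts_at p phi -> comps_at p f phi = f phi.
Proof. by move=> cp; rewrite /comps_at patchT// inE. Qed.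

Lemma comps_at0 p (f : comps M) phi : ~ charts_at p phi -> comps_at p f phi = 0.
Proof. by move=> cp; rewrite /comps_at patchN// notin_setE. Qed.

Lemma vecE phi p y psi : charts_at p psi ->
  vec phi p y psi = 'd (transition phi psi) (chart_map phi p) y.
Proof. by move=> cp; rewrite /vec comps_atE. Qed.

Lemma vec_self phi p y : charts_at p phi -> vec phi p y phi = y.
Proof. by move=> cp; rewrite vecE// diff_transition_id. Qed.

Lemma vec_tangent phi p y : charts_at p phi -> tangent p (vec phi p y).
Proof.
move=> cphi; split=> [psi cp|psi chi cpsi cchi]; first by rewrite /vec comps_at0.
rewrite (vecE phi y cchi) (vecE phi y cpsi); exact: diff_transition_comp.
Qed.

Lemma tangent_vec phi p (v : comps M) : charts_at p phi -> tangent p v ->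
  vec phi p (v phi) = v.
Proof.
move=> cphi [v0 vt]; apply/funext => psi.
have [cpsi|cpsi] := pselect (charts_at p psi); last by rewrite (v0 _ cpsi) /vec comps_at0.
by rewrite vecE// -vt.
Qed.

Lemma vecZ phi p (a : R) y : vec phi p (a *: y) = a *: vec phi p y.
Proof.
apply/funext => psi; have [cpsi|cpsi] := pselect (charts_at p psi).
  rewrite vecE// linearZ; congr (_ *: _).
  by rewrite vecE.
by rewrite /vec comps_at0//; rewrite [RHS]/GRing.scale /= comps_at0// scaler0.
Qed.

Lemma vec0 phi p : vec phi p 0 = 0.
Proof. by rewrite -(scale0r 0) vecZ scale0r. Qed.

Lemma vec_eq0 phi p y : charts_at p phi -> (vec phi p y == 0) = (y == 0).
Proof.
move=> cp; apply/eqP/eqP => [v0|->]; last exact: vec0.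
by rewrite -(vec_self y cp) v0.
Qed.

Lemma tangent0 p : tangent p (0 : comps M).
Proof. by split=> // phi psi _ _; rewrite linear0. Qed.

End Charts.

Section VectorSmooth.
Context (R : realType) (V : normedModType R) (A : set V) (oA : open A).

Lemma smooth_row n (f : V -> 'rV[R]_n) :
  (forall k, smooth_on A (fun x => f x 0 k : R)) -> smooth_on A f.
Proof.
move=> sf; apply: (@smooth_ext _ _ _ _ oA (fun x => \sum_k f x 0 k *: delta_mx 0 k)).
  by move=> x _; rewrite [RHS]row_sum_delta.
by apply: smooth_sum => // k; exact: smooth_scalel.
Qed.

Lemma smooth_lin_comp (W W' : normedModType R) (f : V -> W) (l : {linear W -> W'}) :
  continuous l -> smooth_on A f -> smooth_on A (l \o f).
Proof.
move=> cl /smooth_onP sf; apply/smooth_onP => n; move: {sf}(sf n).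
elim: n f => [|n IHn] f [df Df].
  split=> // x /df dfx; apply: differentiable_comp => //.
  exact: linear_differentiable.
split=> [x /df dfx|v].
  by apply: differentiable_comp => //; exact: linear_differentiable.
apply: (@smooth_upto_ext _ _ _ _ oA _ (l \o 'D_v f)); last exact: IHn (Df v).
move=> x /df dfx; have dl : differentiable l (f x) by exact: linear_differentiable.
rewrite /= [in RHS]deriveE; last exact: differentiable_comp.
by rewrite diff_comp// /= diff_lin// deriveE.
Qed.

Lemma smooth_component n (f : V -> 'rV[R]_n) k : smooth_on A f ->
  smooth_on A (fun x => f x 0 k : R).
Proof.
have lin : linear (fun x : 'rV[R]_n => x 0 k : R) by move=> c u v; rewrite !mxE.
pose l : {linear 'rV[R]_n -> R} := HB.pack (fun x : 'rV[R]_n => x 0 k : R)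
  (GRing.isLinear.Build _ _ _ _ _ lin).
by apply: (@smooth_lin_comp _ _ f l) => x; exact: coord_continuous.
Qed.

Lemma smooth_comp_row n (B : set 'rV[R]_n) (g : V -> 'rV[R]_n) (f : 'rV[R]_n -> R) :
  open B -> smooth_on A g -> smooth_on B f -> (forall x, A x -> B (g x)) ->
  smooth_on A (f \o g).
Proof.
move=> oB; apply: (@smooth_comp _ _ _ oA _ n (fun k => delta_mx 0 k) (fun k w => w 0 k)) => //.
  by move=> w; exact: row_sum_delta.
by move=> i k; exact: smooth_component.
Qed.

End VectorSmooth.

Section CoordinateField.
Context (R : realType) (M : manifold R 2).
Implicit Types (phi psi : chart R 2 M).

(** A coordinate field of a chart, cut off outside a compact square of its image.
    The preimage of the square is closed because the manifold is Hausdorff, so the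
    extension by zero is smooth. *)
Definition coordinate_field phi (a : 'rV[R]_2) (r : R) (i : 'I_2) : vector_field M :=
  fun p => if pselect (chart_dom phi p) then
    vec phi p (plateau a r (chart_map phi p) *: delta_mx 0 i) else 0.

Definition square (a : 'rV[R]_2) (r : R) : set 'rV[R]_2 :=
  [set x | forall i, `|x 0 i - a 0 i| <= r].

Lemma compact_square a r : compact (square a r).
Proof.
have -> : square a r = [set x : 'rV[R]_2 | forall i, `[a 0 i - r, a 0 i + r]%classic (x ord0 i)].
  apply/seteqP; split=> x /= xa i; have := xa i.
    by rewrite in_itv /= ler_norml => /andP[h1 h2]; apply/andP; split; lra.
  by rewrite in_itv /= ler_norml => /andP[h1 h2]; apply/andP; split; lra.
by apply: (@rV_compact R 2 (fun i => `[a 0 i - r, a 0 i + r]%classic)) => i;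
  exact: segment_compact.
Qed.

Lemma coordinate_field_smooth phi a r i : atlas phi -> 0 < r ->
  square a (2 * r) `<=` chart_img phi -> smooth_vector_field (coordinate_field phi a r i).
Proof.
move=> aphi r0 Kphi; split=> [p|psi apsi].
  rewrite /coordinate_field; case: pselect => dp /=; last exact: tangent0.
  by apply: vec_tangent.
pose K := chart_inv phi @` square a (2 * r).
have cK : closed K.
  apply: compact_closed; first exact: manifold_hausdorff.
  apply: continuous_compact; last exact: compact_square.
  by apply: continuous_subspaceW (@chart_inv_cont _ _ _ phi).
have oS := @open_overlap _ _ _ psi phi; have oT := @openT 'rV[R]_2.
have sT := atlas_smooth aphi apsi; have sT' := atlas_smooth apsi aphi.
have sO : smooth_on (overlap psi phi) (field_loc (coordinate_field phi a r i) psi).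
  apply: smooth_row => // k.
  apply: (@smooth_ext _ _ _ _ oS (fun x => (plateau a r \o transition psi phi) x *
     ((fun z => 'D_(delta_mx 0 i) (transition phi psi) z 0 k) \o transition psi phi) x)).
    move=> _ [q [dq dq'] <-]; rewrite /field_loc /coordinate_field /= transitionE// chart_mapK//.
    case: pselect => // dphi; have cphi : charts_at q phi by [].
    have cpsi : charts_at q psi by [].
    rewrite /= (vecE phi _ cpsi) linearZ mxE deriveE//.
    exact: transition_diff.
  apply: smooth_mul => //.
    by apply: (@smooth_comp_row _ _ _ oS _ setT) => //; exact: smooth_plateau.
  apply: (@smooth_comp_row _ _ _ oS _ (overlap phi psi)) => //.
  - exact: open_overlap.
  - by apply: smooth_component; [exact: open_overlap|exact: smooth_derive].
  - by move=> _ [q [dq dq'] <-]; rewrite transitionE//; exact: overlapP.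
have oC : open (chart_map psi @` (chart_dom psi `&` ~` K)).
  by apply: open_chart_image; exact: closed_openC.
have sC : smooth_on (chart_map psi @` (chart_dom psi `&` ~` K))
    (field_loc (coordinate_field phi a r i) psi).
  apply: (@smooth_ext _ _ _ _ oC (fun=> 0)); last exact: smooth_cst.
  move=> _ [q [dq nK] <-]; rewrite /field_loc /coordinate_field /= chart_mapK//.
  case: pselect => //= dq'; suff -> : plateau a r (chart_map phi q) = 0 by rewrite scale0r vec0.
  apply: plateau0 => //; apply: contrapT => /forallNP nb; apply: nK.
  exists (chart_map phi q); last by rewrite chart_mapK.
  by move=> j; have := nb j => /negP; rewrite -ltNge => /ltW.
move=> s _ [q dq <-]; have [dq'|dq'] := pselect (chart_dom phi q).
  by apply: sO; exact: overlapP.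
apply: sC; exists q => //; split=> // -[x Kx qE].
by apply: dq'; rewrite -qE; apply: chart_inv_dom; exact: Kphi.
Qed.

Lemma coordinate_fieldE phi a r i x : atlas phi -> 0 < r -> chart_img phi x ->
  square a r x ->
  coordinate_field phi a r i (chart_inv phi x) phi = delta_mx 0 i.
Proof.
move=> aphi r0 Ux Sx; have dx := chart_inv_dom Ux.
rewrite /coordinate_field; case: pselect => //= _.
by rewrite vec_self// chart_invK// plateau1// scale1r.
Qed.

Lemma square_sub (U : set 'rV[R]_2) a : open U -> U a ->
  exists2 r : R, 0 < r & square a (2 * r) `<=` U.
Proof.
move=> oU Ua; have /nbhs_ballP[e /= e0 eU] : nbhs a U by exact: open_nbhs_nbhs.
exists (e / 4); first by rewrite divr_gt0.
move=> x Sx; apply: eU; split=> // i j; rewrite (ord1 i).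
have := Sx j; rewrite /ball /= distrC => /le_lt_trans; apply.
by rewrite mulrC -mulrA gtr_pMr//; lra.
Qed.

Lemma nbhs_square (a : 'rV[R]_2) (r : R) : 0 < r -> nbhs a (square a r).
Proof.
move=> r0; apply/nbhs_ballP; exists r => //= x [_ ax] i.
by have := ax 0 i; rewrite /ball /= distrC => /ltW.
Qed.

End CoordinateField.

(** * The infinitesimal holonomy algebra at a point *)

Section FibreIdentities.
Context (R : realType) (A : set ('rV[R]_2 * 'rV[R]_2)) (oA : open A).
Local Notation Z := ('rV[R]_2 * 'rV[R]_2)%type.
Local Notation y := (@ycoord R).
Local Notation Y i := (pd (fibre_dir i)).
Context (v : 'I_2 -> Z -> R).

(** Euler's identities for the derivatives of [g], which have degree zero. *)
Lemma contract_hessian (g : Z -> R) z : smooth_on A g -> euler A 1 g -> A z ->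
  y 0 z * vder v (Y 0 g) z + y 1 z * vder v (Y 1 g) z = 0.
Proof.
move=> sg eg Az; have e0 := euler_dfibre oA 0 sg eg Az; have e1 := euler_dfibre oA 1 sg eg Az.
rewrite mul0r in e0 e1.
have c := pd_comm oA (fibre_dir 1) (fibre_dir 0) sg Az; rewrite c in e0.
rewrite /vder c.
transitivity (v 0 z * (y 0 z * Y 0 (Y 0 g) z + y 1 z * Y 0 (Y 1 g) z) +
  v 1 z * (y 0 z * Y 0 (Y 1 g) z + y 1 z * Y 1 (Y 1 g) z)).
  by ring.
by rewrite e0 e1; ring.
Qed.

(** The gradient is orthogonal to the position vector and to [v], which span the fibre. *)
Lemma fibre_gradient0 (g : Z -> R) z i : euler A 0 g -> A z ->
  y 0 z * v 1 z - y 1 z * v 0 z != 0 -> vder v g z = 0 -> Y i g z = 0.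
Proof.
move=> eg Az d0; have := eg z Az; rewrite mul0r /vder.
move: i; elim/ord2_ind; move: (Y 0 g z) (Y 1 g z) => a b h1 h2; apply: (mulfI d0); rewrite mulr0.
  transitivity (v 1 z * (y 0 z * a + y 1 z * b) - y 1 z * (v 0 z * a + v 1 z * b)); first ring.
  by rewrite h1 h2; ring.
transitivity (- v 0 z * (y 0 z * a + y 1 z * b) + y 0 z * (v 0 z * a + v 1 z * b)); first ring.
by rewrite h1 h2; ring.
Qed.

End FibreIdentities.

Lemma span_dependent (R : realType) (V : lmodType R) (S : set V) N (e : 'I_N -> V)
    (f : 'I_N.+1 -> V) :
  S `<=` [set v | exists a : 'I_N -> R, v = \sum_(i < N) a i *: e i] ->
  (forall i, S (f i)) ->
  exists c : 'I_N.+1 -> R, (exists i, c i != 0) /\ \sum_i c i *: f i = 0.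
Proof.
move=> Se Sf; have [a fE] := choice (fun i => Se _ (Sf i)).
pose B : 'M[R]_(N.+1, N) := \matrix_(i, j) a i j.
have : kermx B != 0.
  rewrite -mxrank_eq0 mxrank_ker subn_eq0 -ltnNge.
  exact: leq_ltn_trans (rank_leq_col B) (ltnSn N).
move=> /rowV0Pn[w /sub_kermxP wB w0].
exists (fun i => w 0 i); split.
  by apply/existsP; apply: contra_neqT w0 => /existsPn w0; apply/rowP => i;
    rewrite mxE; apply/eqP; have := w0 i; rewrite negbK.
transitivity (\sum_j (w *m B) 0 j *: e j); last first.
  by rewrite wB big1// => j _; rewrite mxE scale0r.
under [RHS]eq_bigr do rewrite mxE scaler_suml.
rewrite exchange_big; apply: eq_bigr => i _ /=.
rewrite [in LHS]fE scaler_sumr; apply: eq_bigr => j _.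
by rewrite scalerA mxE.
Qed.

Lemma sum_delta (R : pzRingType) (S : 'I_2 -> R) j :
  \sum_i S i * (delta_mx 0 j : 'rV_2) 0 i = S j.
Proof.
by rewrite sum2E !mxE; elim/ord2_ind: j; rewrite /= !mulr1n !mulr0n !(mulr0, mulr1, addr0, add0r).
Qed.

Section Holonomy.
Context (R : realType) (M : manifold R 2) (F : TM_function M) (lambda : R).
Context (F_finsler : finsler F) (F_curvature : constant_flag_curvature F lambda).
Context (lambda_neq0 : lambda != 0).
Context (phi : chart R 2 M) (aphi : atlas phi) (phi_flat : rectifying_chart F phi).
Local Notation rV := 'rV[R]_2.
Local Notation Z := (rV * rV)%type.
Local Notation y := (@ycoord R).
Local Notation X i := (pd (base_dir i)).
Local Notation Y i := (pd (fibre_dir i)).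
Local Notation f := (fun_loc F phi).
Local Notation A := (slit_coords phi).
Local Notation E := (energy f).
Local Notation P := (projective_factor E).

Lemma open_slit : open A.
Proof.
rewrite (_ : A = (fst @^-1` chart_img phi) `&` (snd @^-1` (~` [set (0 : rV)]))).
  apply: openI; apply: open_comp => //.
  - by move=> z _; exact: cvg_fst.
  - exact: chart_open_img.
  - by move=> z _; exact: cvg_snd.
  - apply: closed_openC; apply: accessible_closed_set1.
    exact: hausdorff_accessible (@norm_hausdorff _ _).
by apply/seteqP; split=> z /= [Uz z0]; split=> //; [apply/eqP|apply/eqP].
Qed.
Let oA := open_slit.

Lemma chart_at x : chart_img phi x -> charts_at (chart_inv phi x) phi.
Proof. by move=> Ux; split=> //; exact: chart_inv_dom. Qed.

Lemma smooth_fun_loc : smooth_on A (split_fun f).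
Proof. exact: (finsler_smooth F_finsler aphi). Qed.

Lemma fun_loc_gt0 z : A z -> 0 < f z.1 z.2.
Proof.
move=> [Uz z0]; apply: (finsler_gt0 F_finsler).
  by apply: vec_tangent; exact: chart_at.
by rewrite (vec_eq0 _ (chart_at Uz)).
Qed.

Lemma fun_loc_convex z (w : rV) : A z -> w != 0 ->
  0 < \sum_i \sum_j metric f i j z.1 z.2 * w 0 i * w 0 j.
Proof. by move=> [Uz z0] w0; exact: (finsler_convex F_finsler). Qed.

Lemma fun_loc_homogeneous x w (c : R) : chart_img phi x -> 0 < c ->
  f x (c *: w) = c * f x w.
Proof.
move=> Ux c0; rewrite /fun_loc /= vecZ; apply: (finsler_homogeneous F_finsler) => //.
by apply: vec_tangent; exact: chart_at.
Qed.

Lemma slit_scale z (c : R) : A z -> 0 < c -> A (z.1, c *: z.2).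
Proof. by move=> [Uz z0] c0; split=> //=; rewrite scaler_eq0 negb_or gt_eqF. Qed.

Lemma smooth_energy_loc : smooth_on A E.
Proof. exact: (smooth_energy oA smooth_fun_loc). Qed.

Lemma euler_energy_loc : euler A 2 E.
Proof.
apply: (homogeneous_euler smooth_energy_loc) => z c [Uz z0] c0.
by rewrite /energy /split_fun /= fun_loc_homogeneous//; ring.
Qed.

Lemma energy_loc_neq0 z : A z -> E z != 0.
Proof. exact: energy_neq0 fun_loc_gt0 z. Qed.

(** The lines through a point of the chart are geodesics up to reparametrisation, so
    the spray is radial. *)
Lemma geod_coef_radial z : A z -> exists a b : R,
  0 < a /\ forall i, geod_coef f i z.1 (a *: z.2) = b * (a *: z.2) 0 i.
Proof.
move=> [Uz z0]; have [_ /(_ z.1 z.2)] := phi_flat.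
have nU : nbhs z.1 (chart_img phi).
  by apply: open_nbhs_nbhs; split=> //; exact: chart_open_img.
have cl : {for (0 : R), continuous (fun s : R => z.1 + s *: z.2)}.
  by apply: continuousD; [exact: cst_continuous|exact: scalel_continuous].
have : nbhs (0 : R) (fun s => chart_img phi (z.1 + s *: z.2)).
  by apply: cl; rewrite scale0r addr0.
move=> /nbhs_ballP[e /= e0 eU].
move=> /(_ `]-e, e[%classic z0) [||s|J [s [oJ _ sJ s_incr geo]]].
- exact: interval_open.
- exact: interval_is_interval.
- rewrite /= in_itv /= => /andP[s1 s2]; apply: eU.
  by rewrite /ball /= sub0r normrN ltr_norml s1.
have [t0 Jt0 st0] : (s @` J) 0 by rewrite sJ /= in_itv /= oppr_lt0 e0.
have [_ dc ddc c0 geo0] := geo t0 Jt0.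
have [|a [b [a0 c1 c2]]] := line_velocity z0 oJ Jt0 s_incr _ ddc c0.
  move=> t /geo[_ dct _ _ _]; exact: dct.
exists a, (- (b / (2 * a))); split=> // i; have := geo0 i.
rewrite c1 c2 st0 scale0r addr0 !mxE => H.
have a00 : a != 0 by rewrite gt_eqF.
apply: (@mulfI _ 2); first by rewrite pnatr_eq0.
move/eqP: H; rewrite addrC addr_eq0 => /eqP ->.
by field.
Qed.

(** Radiality is known at the velocity [a *: y] of the geodesic only; homogeneity of the
    defect carries it to [y]. *)
Lemma energy_loc_defect0 l z : A z -> geodesic_defect E l z = 0.
Proof.
move=> Az; have [a [b [a0 G]]] := geod_coef_radial Az.
have Aaz := slit_scale Az a0.
have := geodesic_defect0 oA smooth_fun_loc fun_loc_gt0 fun_loc_convex euler_energy_loc Aaz G l.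
rewrite (euler_homogeneous (smooth_defect oA smooth_energy_loc energy_loc_neq0 l)
  (euler_defect oA smooth_energy_loc euler_energy_loc energy_loc_neq0 l) slit_scale Az a0).
by move=> /eqP; rewrite mulf_eq0 expf_eq0 /= gt_eqF//= => /eqP.
Qed.

Lemma fun_loc_curvature i j k z : A z -> riem f i j k z.1 z.2 = lambda *
    ((i == k)%:R * (\sum_m metric f j m z.1 z.2 * z.2 0 m)
     - (i == j)%:R * (\sum_m metric f k m z.1 z.2 * z.2 0 m)).
Proof. by move=> [Uz z0]; exact: F_curvature. Qed.

Let sE := smooth_energy_loc.
Let sP : smooth_on A P := smooth_projective_factor oA sE energy_loc_neq0.
Let eP : euler A 1 P := euler_projective_factor oA sE euler_energy_loc energy_loc_neq0.
Local Notation xi := (curv_coef E lambda).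
Let sxi i : smooth_on A (xi i) := smooth_curv_coef oA smooth_fun_loc lambda i.
Let exi i : euler A 1 (xi i) := euler_curv_coef oA smooth_fun_loc euler_energy_loc lambda i.

Definition xi_vec z : rV := \row_i xi i z.

(** The curvature field is nowhere radial: the determinant is
    [lambda (y^j dE/dy^j) = 2 lambda E]. *)
Lemma transverse z : A z -> y 0 z * xi 1 z - y 1 z * xi 0 z != 0.
Proof.
move=> Az; have -> : y 0 z * xi 1 z - y 1 z * xi 0 z = lambda * (2 * E z).
  by rewrite -(euler_energy_loc Az) /curv_coef /=; ring.
by rewrite mulf_neq0 // mulf_neq0 ?energy_loc_neq0 ?pnatr_eq0.
Qed.

Context (p : M) (pphi : chart_dom phi p).
Let x0 := chart_map phi p.

Lemma chart_inv_x0 : chart_inv phi x0 = p.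
Proof. by rewrite /x0 chart_mapK. Qed.

Lemma img_x0 : chart_img phi x0. Proof. exact: chart_map_dom. Qed.

Lemma slit_x0 (w : rV) : w != 0 -> A (x0, w).
Proof. by move=> w0; split=> //=; exact: img_x0. Qed.

Lemma vert_loc_comps (G : M -> comps M -> comps M) x w : chart_img phi x ->
  vert_loc (fun q v => comps_at q (G q v)) phi x w =
  G (chart_inv phi x) (vec phi (chart_inv phi x) w) phi.
Proof. by move=> Ux; rewrite /vert_loc /= comps_atE//; exact: chart_at. Qed.

(** Over the points of [V] the field is [h] times the curvature field. An open [V] allows
    to apply [nabla] again; over a single point the fields are closed under brackets. *)
Definition represents (V : set rV) (zeta : vertical_field M) (h : Z -> R) : Prop :=
  forall x w, V x -> w != 0 -> vert_loc zeta phi x w = h (x, w) *: xi_vec (x, w).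

Definition hol_coef (h : Z -> R) : Prop :=
  [/\ smooth_on A h, euler A 0 h & exists zeta, hol F zeta /\ represents [set x0] zeta h].

Section CoordinateFrame.
Context (V : set rV) (oV : open V) (VU : V `<=` chart_img phi).
Context (e : 'I_2 -> vector_field M).
Context (eE : forall i x, V x -> e i (chart_inv phi x) phi = delta_mx 0 i).

Lemma slitV x w : V x -> w != 0 -> A (x, w).
Proof. by move=> Vx w0; split=> //; exact: VU. Qed.

Lemma open_slitV : open (A `&` (fst @^-1` V)).
Proof. by apply: openI => //; apply: open_comp => // z _; exact: cvg_fst. Qed.

Lemma curvature_represents : represents V (curvature_field F (e 0) (e 1)) (fun=> 1).
Proof.
move=> x w Vx w0; have Ux := VU Vx; rewrite scale1r.
apply/rowP => i; rewrite (vert_loc_comps (fun q v phi => \row_i \sum_j \sum_k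
    riem (fun_loc F phi) i j k (chart_map phi q) (v phi)
    * e 0 q phi 0 j * e 1 q phi 0 k))//.
rewrite !mxE chart_invK// vec_self; last exact: chart_at.
transitivity (\sum_j \sum_k
    riem f i j k x w * (delta_mx 0 0 : rV) 0 j * (delta_mx 0 1 : rV) 0 k).
  apply: eq_bigr => j _; apply: eq_bigr => k _; congr (_ * _ * _).
    by rewrite (eE 0 Vx).
  by rewrite (eE 1 Vx).
under eq_bigr do rewrite sum_delta.
rewrite sum_delta.
exact: (riem_curv_coef oA smooth_fun_loc euler_energy_loc fun_loc_curvature i (slitV Vx w0)).
Qed.

Lemma nabla_represents (j : 'I_2) zeta h : smooth_on A h -> euler A 0 h ->
  represents V zeta h -> represents V (nabla F (e j) zeta) (transport E j h).
Proof.
move=> sh eh rep x w Vx w0; have Ux := VU Vx; have Az := slitV Vx w0.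
have Bz : (A `&` (fst @^-1` V)) (x, w) by [].
have loc i (z : Z) : (A `&` (fst @^-1` V)) z ->
    split_fun (fun x y => vert_loc zeta phi x y 0 i) z = h z * xi i z.
  move=> [[Uz z0] Vz]; rewrite /split_fun (rep _ _ Vz z0) !mxE.
  by rewrite -surjective_pairing.
apply/rowP => i; rewrite !mxE.
transitivity (\sum_k (dx k (fun x y => vert_loc zeta phi x y 0 i) x w
   - \sum_m geod_coef1 f m k x w * dy m (fun x y => vert_loc zeta phi x y 0 i) x w
   + \sum_m geod_coef2 f i k m x w * vert_loc zeta phi x w 0 m) * (delta_mx 0 j : rV) 0 k).
  rewrite (vert_loc_comps (fun q v phi => \row_i \sum_k
     (dx k (fun x y => vert_loc zeta phi x y 0 i) (chart_map phi q) (v phi)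
   - \sum_m geod_coef1 (fun_loc F phi) m k (chart_map phi q) (v phi)
       * dy m (fun x y => vert_loc zeta phi x y 0 i) (chart_map phi q) (v phi)
   + \sum_m geod_coef2 (fun_loc F phi) i k m (chart_map phi q) (v phi)
       * vert_loc zeta phi (chart_map phi q) (v phi) 0 m) * e j q phi 0 k))//.
  rewrite !mxE chart_invK// vec_self; last exact: chart_at.
  by apply: eq_bigr => k _; congr (_ * _); rewrite (eE j Vx).
rewrite sum_delta.
apply: etrans (nabla_curv_coef oA smooth_fun_loc fun_loc_gt0 fun_loc_convex
  euler_energy_loc energy_loc_defect0 lambda i j sh Az eh).
congr (_ - _ + _).
- rewrite dx_pd; apply: (pd_eq open_slitV) => // z; exact: loc.
- apply: eq_bigr => k _; congr (_ * _).
  by rewrite dy_pd; apply: (pd_eq open_slitV) => // z; exact: loc.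
- by apply: eq_bigr => k _; congr (_ * _); rewrite (rep x w)// !mxE.
Qed.

End CoordinateFrame.

(** Coordinate fields of [phi], cut off away from [p]. *)
Lemma coordinate_frame : exists (V : set rV) (e : 'I_2 -> vector_field M),
  [/\ open V, V x0, V `<=` chart_img phi, forall i, smooth_vector_field (e i)
    & forall i x, V x -> e i (chart_inv phi x) phi = delta_mx 0 i].
Proof.
have [r r0 Ur] := square_sub (@chart_open_img _ _ _ phi) img_x0.
have sub : square x0 r `<=` chart_img phi.
  by apply: subset_trans Ur => x Sx i; apply: le_trans (Sx i) _; lra.
exists (interior (square x0 r)), (coordinate_field phi x0 r); split.
- exact: open_interior.
- exact: nbhs_square.
- exact: subset_trans (@interior_subset _ _) sub.
- by move=> i; exact: coordinate_field_smooth.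
- move=> i x /interior_subset Sx; apply: coordinate_fieldE => //; exact: sub.
Qed.

Lemma hol_scale (a : R) zeta : hol F zeta -> hol F (a *: zeta).
Proof.
by move=> hz; rewrite -[a](subrK 1) scalerDl scale1r; exact: hol_linear.
Qed.

Lemma represents_linear V (a : R) zeta eta h g : represents V zeta h -> represents V eta g ->
  represents V (a *: zeta + eta) (fun z => a * h z + g z).
Proof.
move=> rz re x w Vx w0; rewrite scalerDl -scalerA -(rz x w)// -(re x w)//.
Qed.

Lemma represents_scale V (a : R) zeta h : represents V zeta h ->
  represents V (a *: zeta) (fun z => a * h z).
Proof. by move=> rz x w Vx w0; rewrite -scalerA -(rz x w). Qed.

Lemma represents_eq V zeta h g : V `<=` chart_img phi -> (forall z, A z -> h z = g z) ->
  represents V zeta h -> represents V zeta g.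
Proof.
move=> VU hg rz x w Vx w0; rewrite -hg; first exact: rz.
by split=> //; exact: VU.
Qed.

Lemma represents_sub V zeta h : V x0 -> represents V zeta h -> represents [set x0] zeta h.
Proof. by move=> Vx rz x w ->; exact: rz. Qed.

Lemma hol_coef_smooth h : hol_coef h -> smooth_on A h. Proof. by case. Qed.

Lemma hol_coef_linear (a : R) h g : hol_coef h -> hol_coef g -> hol_coef (fun z => a * h z + g z).
Proof.
move=> [sh eh [zeta [hz rz]]] [sg eg [eta [he re]]].
have sa : smooth_on A (fun z => a * h z) by smooth.
split; [by smooth|by apply: euler_add => //; exact: euler_scale|].
by exists (a *: zeta + eta); split; [exact: hol_linear|exact: represents_linear].
Qed.

Let sYP j : smooth_on A (Y j P). Proof. by smooth. Qed.
Let sYE j : smooth_on A (Y j E). Proof. by smooth. Qed.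
Let sYYE j k : smooth_on A (Y k (Y j E)). Proof. by smooth. Qed.
Let eYP j : euler A 0 (Y j P). Proof. exact: euler_dfibre. Qed.
Let eYE j : euler A 1 (Y j E). Proof. exact: euler_dfibre euler_energy_loc. Qed.
Let eYYE j k : euler A 0 (Y k (Y j E)). Proof. exact: euler_dfibre (eYE j). Qed.

Lemma transport1 j z : transport E j (fun=> 1) z = 3 * Y j P z.
Proof. by rewrite /transport !pd_cst; ring. Qed.

(** [dP_k/dx^j] is the fibre derivative of [dP/dx^j = P P_j - lambda E_j]. *)
Lemma transportP j k z : A z ->
  transport E j (Y k P) z = 4 * (Y j P z * Y k P z) - lambda * Y k (Y j E) z.
Proof.
move=> Az; rewrite /transport (pd_comm oA (base_dir j) (fibre_dir k) sP Az).
have fx w : A w -> X j P w = P w * Y j P w - lambda * Y j E w.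
  exact: (factor_dbase oA smooth_fun_loc fun_loc_gt0 fun_loc_convex euler_energy_loc
    energy_loc_defect0 fun_loc_curvature).
have s1 : smooth_on A (fun z => P z * Y j P z) by have := sYP j => ?; smooth.
have s2 : smooth_on A (fun z => lambda * Y j E z) by have := sYE j => ?; smooth.
rewrite (pd_eq oA (fibre_dir k) fx Az) (pd_sub _ s1 s2 Az) (pd_mul _ sP (sYP j) Az).
rewrite (pd_scale _ _ (sYE j) Az) (pd_comm oA (fibre_dir k) (fibre_dir j) sP Az).
by ring.
Qed.

(** The curvature field, its first derivatives divided by three, and the derivatives of
    these. *)
Lemma hol_coef_generators : [/\ hol_coef (fun=> 1), forall j, hol_coef (Y j P) &
  forall j k, hol_coef (fun z => 4 * (Y j P z * Y k P z) - lambda * Y k (Y j E) z)].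
Proof.
have [V [e [oV Vx VU se eE]]] := coordinate_frame.
have s1 : smooth_on A (fun=> 1 : R) by exact: smooth_cst.
have e1 : euler A 0 (fun=> 1 : R) by exact: euler_cst.
have r1 := curvature_represents VU eE.
have h1 : hol F (curvature_field F (e 0) (e 1)) by exact: hol_curvature.
pose zeta j := 3^-1 *: nabla F (e j) (curvature_field F (e 0) (e 1)).
have hP j : hol F (zeta j) by apply: hol_scale; exact: hol_nabla.
have rP j : represents V (zeta j) (Y j P).
  apply: (@represents_eq _ _ (fun z => 3^-1 * transport E j (fun=> 1) z)) => //.
    by move=> z _; rewrite transport1 mulKf// pnatr_eq0.
  by apply: represents_scale; exact: (nabla_represents oV VU eE).
split.
- by split=> //; exists (curvature_field F (e 0) (e 1)); split=> //; exact: represents_sub r1.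
- by move=> j; split=> //; exists (zeta j); split=> //; exact: represents_sub (rP j).
move=> j k; have s4 : smooth_on A (fun z => 4 * (Y j P z * Y k P z)).
  by have := sYP j; have := sYP k => ? ?; smooth.
have s5 : smooth_on A (fun z => Y j P z * Y k P z).
  by have := sYP j; have := sYP k => ? ?; smooth.
have s6 : smooth_on A (fun z => lambda * Y k (Y j E) z) by have := sYYE j k => ?; smooth.
split; first by smooth.
  apply: euler_sub => //; apply: euler_scale => //; exact: (@euler_mul _ A 0 0).
exists (nabla F (e j) (zeta k)); split; first exact: hol_nabla.
apply: (represents_sub Vx); apply: (@represents_eq _ _ (transport E j (Y k P))) => //.
  by move=> z; exact: transportP.
exact: (nabla_represents oV VU eE).
Qed.

(** The bracket differentiates along the fibre only, so it is determined by the fields over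
    [x0]. *)
Lemma hol_coef_wronskian h g : hol_coef h -> hol_coef g -> hol_coef (wronskian xi h g).
Proof.
move=> [sh eh [zeta [hz rz]]] [sg eg [eta [he re]]].
have sDh := smooth_vder oA sxi sh; have sDg := smooth_vder oA sxi sg.
have eDh := euler_vder oA sxi exi sh eh; have eDg := euler_vder oA sxi exi sg eg.
split.
- by rewrite /wronskian; smooth.
- by apply: euler_sub; [smooth|smooth|exact: (@euler_mul _ A 0 0)..].
exists (bracket zeta eta); split; first exact: hol_bracket.
move=> x w -> w0; have Ux := img_x0; have Az := slit_x0 w0.
have Fz : fibre A x0 (x0, w) by [].
have loc i (ups : vertical_field M) k : represents [set x0] ups k -> forall z : Z, fibre A x0 z ->
    split_fun (fun x y => vert_loc ups phi x y 0 i) z = k z * xi i z.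
  move=> rk [u w'] [[_ w'0] /= u0]; rewrite /split_fun /= (rk u w' u0 w'0) !mxE //.
have dloc i j (ups : vertical_field M) k : smooth_on A k -> represents [set x0] ups k ->
    dy j (fun x y => vert_loc ups phi x y 0 i) x0 w =
    Y j k (x0, w) * xi i (x0, w) + k (x0, w) * Y j (xi i) (x0, w).
  move=> sk rk; rewrite dy_pd (pd_fibre_eq oA j (loc i ups k rk) Fz).
  exact: (pd_mul _ sk (sxi i) Az).
apply/rowP => i.
rewrite (vert_loc_comps (fun q v phi => \row_i \sum_j
    (vert_loc zeta phi (chart_map phi q) (v phi) 0 j
       * dy j (fun x y => vert_loc eta phi x y 0 i) (chart_map phi q) (v phi)
   - vert_loc eta phi (chart_map phi q) (v phi) 0 j
       * dy j (fun x y => vert_loc zeta phi x y 0 i) (chart_map phi q) (v phi))))//.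
rewrite !mxE chart_invK// vec_self; last exact: chart_at.
transitivity (\sum_j (h (x0, w) * xi j (x0, w) *
     (Y j g (x0, w) * xi i (x0, w) + g (x0, w) * Y j (xi i) (x0, w))
   - g (x0, w) * xi j (x0, w) *
     (Y j h (x0, w) * xi i (x0, w) + h (x0, w) * Y j (xi i) (x0, w)))).
  apply: eq_bigr => j _; congr (_ * _ - _ * _).
  - exact: (loc j zeta h rz (x0, w) Fz).
  - exact: dloc.
  - exact: (loc j eta g re (x0, w) Fz).
  - exact: dloc.
by rewrite sum2E /wronskian /vder; ring.
Qed.

(** Elements of the algebra at [p] only see the indicatrix; since the coefficients have
    degree zero, a relation on the indicatrix holds on the whole punctured fibre. *)
Lemma hol_coef_dependent N (b : 'I_N -> comps M -> comps M) :
  hol_at F p `<=` [set v | exists a : 'I_N -> R, v = \sum_(i < N) a i *: b i] ->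
  forall h : 'I_N.+1 -> Z -> R, (forall i, hol_coef (h i)) ->
  exists c : 'I_N.+1 -> R, (exists i, c i != 0) /\
    forall z, fibre A x0 z -> \sum_i c i * h i z = 0.
Proof.
move=> hol_b h hh.
have [zeta zetaP] := choice (fun i => let: And3 _ _ z := hh i in z).
pose loc i : comps M -> comps M := patch (fun=> 0) (indicatrix F p) (zeta i p).
have [|c [c0 cE]] := span_dependent (f := loc) hol_b.
  by move=> i; exists (zeta i) => //; have [] := zetaP i.
exists c; split=> // -[x w] [[_ /= w0] /= ->].
have Az := slit_x0 w0; have r0 := fun_loc_gt0 Az.
pose a := (f x0 w)^-1; have a0 : 0 < a by rewrite invr_gt0.
have aw0 : a *: w != 0 by rewrite scaler_eq0 negb_or gt_eqF.
have hE i : h i (x0, a *: w) = h i (x0, w).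
  have [sh eh _] := hh i.
  by rewrite (euler_homogeneous sh eh slit_scale Az a0) expr0 mul1r.
under eq_bigr do rewrite -hE.
have cp : charts_at p phi by [].
have ind : indicatrix F p (vec phi p (a *: w)).
  split; first exact: vec_tangent.
  have := fun_loc_homogeneous w img_x0 a0; rewrite {1}/fun_loc /= chart_inv_x0 => ->.
  by rewrite /a mulVf// gt_eqF.
suff H i : (\sum_k c k * h k (x0, a *: w)) * xi i (x0, a *: w) = 0.
  apply: contraNeq (transverse (slit_x0 aw0)) => s0.
  have k i : xi i (x0, a *: w) = 0 by apply: (mulfI s0); rewrite mulr0.
  by rewrite !k !mulr0 subrr.
have := congr1 (fun s : comps M -> comps M => s (vec phi p (a *: w)) phi 0 i) cE.
have -> : ((0 : comps M -> comps M) (vec phi p (a *: w)) phi : rV) 0 i = 0 by exact: mxE.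
move=> E0; have {}E0 : \sum_k c k * loc k (vec phi p (a *: w)) phi 0 i = 0.
  apply: etrans E0; elim/big_rec2: _ => [|k u v _ ->]; first exact/esym/mxE.
  by symmetry; apply: etrans (mxE _ _ _ _) _; congr (_ + _); exact: mxE.
rewrite mulr_suml -[RHS]E0; apply: eq_bigr => k _; rewrite -mulrA; congr (_ * _).
have [_ rk] := zetaP k.
rewrite /loc patchT ?inE//.
have := congr1 (fun r : rV => r 0 i) (rk x0 (a *: w) erefl aw0).
by rewrite !mxE /vert_loc /= chart_inv_x0.
Qed.

(** The Hessian of [E] in the fibre is constant by [tensors_constant], and by Euler's
    identities it represents [2 E = F^2]. *)
Lemma quadratic_of_finite_dimension N (b : 'I_N -> comps M -> comps M) :
  hol_at F p `<=` [set v | exists a : 'I_N -> R, v = \sum_(i < N) a i *: b i] ->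
  quadratic_form_on (tangent p) (fun v => F p v ^+ 2).
Proof.
move=> hol_b; have [FF1 FFp FFq] := hol_coef_generators.
have e_sym z : A z -> Y 1 (Y 0 E) z = Y 0 (Y 1 E) z.
  by move=> Az; exact: (pd_comm oA (fibre_dir 1) (fibre_dir 0) sE Az).
have De z j k : fibre A x0 z -> vder xi (Y k (Y j E)) z = 0.
  move=> Fz; have [|||_ ->//] := @tensors_constant R A oA x0 xi sxi hol_coef hol_coef_smooth FF1
     hol_coef_linear hol_coef_wronskian N (hol_coef_dependent hol_b) _ (fun j => Y j P)
     (fun j k => Y k (Y j E)) lambda sYYE lambda_neq0 e_sym FFp FFq _ _ z Fz.
  - by move=> w [Aw _]; exact: transverse.
  - by move=> w [Aw _]; exact: (contract_hessian oA xi sP eP Aw).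
  - by move=> i w [Aw _]; exact: (contract_hessian oA xi (sYE i) (eYE i) Aw).
pose o : rV := delta_mx 0 0.
have o0 : o != 0 by apply/eqP => /rowP /(_ 0); rewrite !mxE /= => /eqP; rewrite oner_eq0.
pose c j k := Y k (Y j E) (x0, o).
have cE (w : rV) j k : w != 0 -> Y k (Y j E) (x0, w) = c j k.
  move=> w0; apply: (fibre_constant (sYYE j k) slit_x0 _ w0 o0) => u i u0.
  have Au := slit_x0 u0.
  by apply: (fibre_gradient0 i (eYYE j k) Au (transverse Au)); exact: De.
have c_sym j k : c j k = c k j.
  exact: (pd_comm oA (fibre_dir k) (fibre_dir j) sE (slit_x0 o0)).
pose B (u v : comps M) : R := \sum_j \sum_k c j k * u phi 0 j * v phi 0 k.
have cp : charts_at p phi by [].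
exists B; split.
- move=> v tv; rewrite -(tangent_vec cp tv) /B vec_self//.
  move: (v phi) => w {v tv}; have [->|w0] := eqVneq w 0.
    have := fun_loc_homogeneous 0 img_x0 (ltr0Sn _ 1); rewrite scaler0 /fun_loc /= chart_inv_x0.
    move=> F0; have {F0} -> : F p (vec phi p 0) = 0 by lra.
    by rewrite !sum2E !mxE; ring.
  have Az := slit_x0 w0; have := euler_energy_loc Az.
  have := eYE 0 Az; have := eYE 1 Az; rewrite !cE// !mul1r => <- <-.
  rewrite /energy /split_fun /fun_loc /= chart_inv_x0 !sum2E => H.
  rewrite expr2 -[LHS](mulKf (x := 2)) ?pnatr_eq0// mulrCA -H /ycoord /=; ring.
- by move=> u v _ _; rewrite /B !sum2E (c_sym 1 0); ring.
- move=> a u v w _ _ _; rewrite /B !sum2E !mxE; ring.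
Qed.

End Holonomy.

Theorem proposition3p2 (R : realType) (M : manifold R 2) (F : TM_function M)
    (lambda : R)
    (M_simply_connected : simply_connected R M)
    (F_finsler : finsler F)
    (F_flat : locally_projectively_flat F)
    (F_non_riemannian : non_riemannian F)
    (F_curvature : constant_flag_curvature F lambda)
    (lambda_neq0 : lambda != 0) :
  forall x : M, non_riemannian_at F x -> infinite_dimensional (hol_at F x).
Proof.
move=> x nr N e He; apply: nr; have [phi [[aphi dphi] fphi]] := F_flat x.
exact: (quadratic_of_finite_dimension F_finsler F_curvature lambda_neq0 aphi fphi dphi He).
Qed.
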